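(* Let $n\geq1$, let $K_1,\ldots,K_n$ be compact trees, let $\kappa$ be an uncountable regular cardinal, and let $X$ be a Banach space with the Mazur property and the Gelfand--Phillips property. For a compact tree $K$ put $\Lambda_\kappa(K)=\{x\in K:\chi(K,x)\geq\kappa\}$. Then \[ \mathcal S_{<\kappa}^{(n)}\bigl(C(K_1\times\cdots\times K_n,X)\bigr)\sim c_0\bigl(\{1,\ldots,n!\}\times\Lambda_\kappa(K_1)\times\cdots\times\Lambda_\kappa(K_n),X\bigr). \] In particular, if $\Lambda_\kappa(K_1)\times\cdots\times\Lambda_\kappa(K_n)$ is infinite, then \[ \mathcal S_{<\kappa}^{(n)}\bigl(C(K_1\times\cdots\times K_n,X)\bigr)\sim c_0\bigl(\Lambda_\kappa(K_1)\times\cdots\times\Lambda_\kappa(K_n),X\bigr). \]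
   Context: A tree $K$ is a partially ordered set such that for every $x\in K$ the set $\{y\in K:y<x\}$ is well ordered. The interval topology on $K$ is generated by the sets $(s,t]=\{x\in K:s<x\leq t\}$ together with the singletons $\{x\}$ with $x$ minimal in $K$. A compact tree is a tree that is a compact Hausdorff space in its interval topology. $\chi(K,x)$ is the least cardinality of a local base at $x$ in $K$. Banach spaces are real, $X\subset X^{**}$ canonically, and $\sim$ denotes linear isomorphism. $C(K,X)$ is the space of continuous functions $K\to X$ with the supremum norm; $c_0(\Gamma,X)$ is the $c_0$-sum of $|\Gamma|$ copies of $X$ indexed by $\Gamma$. For an uncountable regular cardinal $\kappa$, $\Delta_{<\kappa}(X)$ is the norm closure in $X^{**}$ of \[\{x^{**}\in X^{**}:\forall A\subset X^*\text{ with }|A|<\kappa\ \exists x\in X\text{ such that }x^{**}|_A=x|_A\},\] $\mathcal S_{<\kappa}(X)=\Delta_{<\kappa}(X)/X$, $\mathcal S_{<\kappa}^{(0)}(X)=X$ and $\mathcal S_{<\kappa}^{(m+1)}(X)=\mathcal S_{<\kappa}(\mathcal S_{<\kappa}^{(m)}(X))$. $X$ has the Mazur property if every weak$^*$-sequentially continuous functional $x^{**}\in X^{**}$ belongs to $X$. A set $A\subset X$ is limited if every weak$^*$-null sequence in $X^*$ converges to $0$ uniformly on $A$; $X$ has the Gelfand--Phillips property if every limited subset of $X$ is relatively norm compact. *)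

(* Defs.v *)
From HB Require Import structures.
From mathcomp Require Import all_boot all_order all_algebra ring lra.
From mathcomp Require Import all_classical all_reals all_analysis.
From mathcomp Require wochoice.

Set Implicit Arguments.
Unset Strict Implicit.
Unset Printing Implicit Defensive.

Import Order.TTheory GRing.Theory Num.Theory.
Import numFieldNormedType.Exports.

Local Open Scope classical_set_scope.
Local Open Scope ring_scope.
Local Open Scope quotient_scope.
Local Open Scope card_scope.

Section FunSpace.
Context {R : realType} {T : Type} {X : completeNormedModType R}.

(* A Banach space of functions T -> X normed by sup_t |f t| / w t: the weight
   w = 1 gives the supremum norm, and on the linear functionals on a normed
   space the weight w = |.| gives the operator norm (x / 0 = 0, and fs_bounded
   forces f t = 0 where w t = 0).  The real sup of the empty set is 0. *)
Record funSpace := FunSpace {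
  fs_mem : set (T -> X);
  fs_weight : T -> R;
  fs_weight_ge0 : forall t, 0 <= fs_weight t;
  fs_mem0 : fs_mem (fun=> 0);
  fs_memL : forall (a : R) f g, fs_mem f -> fs_mem g ->
    fs_mem (fun t => a *: f t + g t);
  fs_bounded : forall f, fs_mem f ->
    exists M : R, forall t, `|f t| <= M * fs_weight t;
  fs_closed : forall g : T -> X,
    (forall e : R, 0 < e -> exists2 f, fs_mem f &
       forall t, `|g t - f t| <= e * fs_weight t) -> fs_mem g }.

Record funOf (S : funSpace) :=
  FunOf { funVal :> T -> X; funValP : `[< fs_mem S funVal >] }.

Context (S : funSpace).

HB.instance Definition _ := [isSub for @funVal S].
HB.instance Definition _ := [Choice of funOf S by <:].

Lemma fs_submod : submod_closed [pred f : T -> X | `[< fs_mem S f >]].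
Proof.
split; first by apply/asboolP; exact: fs_mem0.
by move=> a f g /asboolP Sf /asboolP Sg; apply/asboolP; exact: fs_memL.
Qed.

HB.instance Definition _ :=
  GRing.SubChoice_isSubLmodule.Build R (T -> X) _ (funOf S) fs_submod.

Implicit Types f g : funOf S.

Lemma funOfP f g : (forall t, f t = g t) -> f = g.
Proof. by move=> fg; apply/val_inj/funext. Qed.

Lemma funOfDE f g t : (f + g) t = f t + g t.
Proof. by []. Qed.

Lemma funOfBE f g t : (f - g) t = f t - g t.
Proof. by []. Qed.

Lemma funOfZE (a : R) f t : (a *: f) t = a *: f t.
Proof. by []. Qed.

Definition fs_norm f : R := sup (range (fun t => `|f t| / fs_weight S t)).

Lemma fs_weight_cases t : fs_weight S t = 0 \/ 0 < fs_weight S t.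
Proof.
by have := fs_weight_ge0 S t; rewrite le0r => /orP[/eqP|]; [left|right].
Qed.

Lemma fs_norm_ub f : has_ubound (range (fun t => `|f t| / fs_weight S t)).
Proof.
have [M fM] := fs_bounded (asboolW (funValP f)).
exists `|M| => _ [t _ <-].
have [->|w0] := fs_weight_cases t; first by rewrite invr0 mulr0.
by rewrite ler_pdivrMr// (le_trans (fM t))// ler_wpM2r ?(ltW w0)// ler_norm.
Qed.

Lemma fs_norm_ge0 f : 0 <= fs_norm f.
Proof.
rewrite /fs_norm; have [->|/set0P[_ [t _ _]]] :=
  eqVneq (range (fun t => `|f t| / fs_weight S t)) set0; first by rewrite sup0.
apply: (@le_trans _ _ (`|f t| / fs_weight S t)); last first.
  by apply: (ub_le_sup (fs_norm_ub f)); exists t.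
by rewrite divr_ge0 ?fs_weight_ge0.
Qed.

Lemma fs_normP f t : `|f t| <= fs_norm f * fs_weight S t.
Proof.
have [M fM] := fs_bounded (asboolW (funValP f)).
have [w0|w0] := fs_weight_cases t; first by move: (fM t); rewrite w0 !mulr0.
by rewrite -ler_pdivrMr//; apply: (ub_le_sup (fs_norm_ub f)); exists t.
Qed.

Lemma fs_norm_le f (M : R) : 0 <= M ->
  (forall t, `|f t| <= M * fs_weight S t) -> fs_norm f <= M.
Proof.
move=> M0 fM; rewrite /fs_norm; have [->|ne] :=
  eqVneq (range (fun t => `|f t| / fs_weight S t)) set0; first by rewrite sup0.
apply: ge_sup; first exact/set0P.
move=> _ [t _ <-].
have [->|w0] := fs_weight_cases t; first by rewrite invr0 mulr0.
by rewrite ler_pdivrMr.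
Qed.

Lemma fs_ler_normD f g : fs_norm (f + g) <= fs_norm f + fs_norm g.
Proof.
apply: fs_norm_le => [|t]; first by rewrite addr_ge0 ?fs_norm_ge0.
by rewrite mulrDl (le_trans (ler_normD _ _))// lerD ?fs_normP.
Qed.

Lemma fs_normZ (a : R) f : fs_norm (a *: f) = `|a| * fs_norm f.
Proof.
have le b h : fs_norm (b *: h) <= `|b| * fs_norm h.
  apply: fs_norm_le => [|t]; first by rewrite mulr_ge0 ?fs_norm_ge0.
  by rewrite funOfZE normrZ -mulrA ler_wpM2l ?fs_normP.
apply/eqP; rewrite eq_le le/=.
have [->|a0] := eqVneq a 0; first by rewrite normr0 mul0r fs_norm_ge0.
rewrite -ler_pdivlMl ?normr_gt0// -normfV.
by apply: le_trans (le _ _); rewrite scalerA mulVf// scale1r.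
Qed.

Lemma fs_norm0_eq0 f : fs_norm f = 0 -> f = 0.
Proof.
move=> f0; apply: funOfP => t.
by apply/eqP; rewrite -normr_le0 (le_trans (fs_normP f t))// f0 mul0r.
Qed.

HB.instance Definition _ := Lmodule_isNormed.Build R (funOf S)
  fs_ler_normD fs_normZ fs_norm0_eq0.

Lemma fs_complete (F : set_system (funOf S)) :
  ProperFilter F -> cauchy F -> cvg F.
Proof.
move=> FF /cauchy_ballP Fc.
pose D (e : R) (f g : funOf S) := forall t, `|f t - g t| <= e * fs_weight S t.
have Fn (e : R) : 0 < e -> \forall f \near F, \forall g \near F, D e f g.
  move=> e0; apply: nearP_dep; near_simpl; rewrite near2E.
  apply: filterS (Fc e e0) => -[f g] /=; rewrite -ball_normE /= => fg t.
  by rewrite -funOfBE (le_trans (fs_normP _ _))// ler_wpM2r ?fs_weight_ge0 ?ltW.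
have cvF t : cvg ((fun f : funOf S => f t) @ F).
  apply: cauchy_cvg; apply/cauchy_exP => e e0.
  have w0 := fs_weight_ge0 S t.
  have e'0 : 0 < e / (fs_weight S t + 1) by rewrite divr_gt0// ltr_wpDl.
  have [f Ff] := filter_ex (Fn _ e'0).
  exists (f t); near=> g => /=; rewrite -ball_normE /=.
  apply: (@le_lt_trans _ _ (e / (fs_weight S t + 1) * fs_weight S t)).
    by near: g; apply: filterS Ff => g; apply.
  by rewrite mulrAC ltr_pdivrMr ?ltr_pM2l ?ltrDl// ltr_wpDl.
pose g t := lim ((fun f : funOf S => f t) @ F).
have Fg (e : R) : 0 < e ->
    \near F, forall t, `|g t - (F : funOf S) t| <= e * fs_weight S t.
  move=> e0; apply: filterS (Fn e e0) => f Ff t.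
  have c : (fun h : funOf S => `|h t - f t|) @ F --> `|g t - f t|.
    by apply: cvg_norm; apply: cvgB; [exact: cvF|exact: cvg_cst].
  rewrite -(cvg_lim _ c)//; apply: limr_le; first by apply/cvg_ex; eexists; exact: c.
  by apply: filterS Ff => h; rewrite distrC; apply.
have Sg : fs_mem S g.
  apply: fs_closed => e e0; have [f Ff] := filter_ex (Fg e e0).
  by exists f => //; exact: asboolW (funValP f).
apply/cvg_ex; exists (FunOf (asboolT Sg)); apply/cvgrPdist_le => /= e e0.
apply: filterS (Fg e e0) => f Ff.
by apply: fs_norm_le (ltW e0) _.
Unshelve. all: by end_near. Qed.

HB.instance Definition _ := Uniform_isComplete.Build (funOf S) fs_complete.

End FunSpace.

Section DualSpace.
Context {R : realType} (X : completeNormedModType R).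

Let pack_linear (Y : normedModType R) (f : X -> Y) (lf : linear f) :
  {linear X -> Y} := HB.pack f (GRing.isLinear.Build _ _ _ _ _ lf).

Lemma continuous_linear_bound (Y : normedModType R) (f : X -> Y) :
  linear f -> continuous f -> exists M : R, forall x, `|f x| <= M * `|x|.
Proof.
move=> lf cf; have /linear_boundedP : bounded_near (pack_linear lf) (nbhs 0).
  exact/linear_bounded_continuous.
by move=> /pinfty_ex_gt0[M _ fM]; exists M.
Qed.

Lemma bound_linear_continuous (Y : normedModType R) (f : X -> Y) (M : R) :
  linear f -> (forall x, `|f x| <= M * `|x|) -> continuous f.
Proof.
move=> lf fM; apply: (@bounded_linear_continuous _ _ _ (pack_linear lf)).
apply/linear_boundedP; near=> N => x /=; apply: (le_trans (fM x)).
by rewrite ler_wpM2r.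
Unshelve. all: by end_near. Qed.

Definition dual_mem : set (X -> R^o) := [set f | linear f /\ continuous f].

Lemma dual_mem0 : dual_mem (fun=> 0).
Proof.
split=> [a x y|]; first by rewrite scaler0 addr0.
exact: cst_continuous.
Qed.

Lemma dual_memL (a : R) f g : dual_mem f -> dual_mem g -> dual_mem (fun x => a *: f x + g x).
Proof.
move=> [lf cf] [lg cg]; split=> [b x y|x].
  by rewrite lf lg !scalerDr !scalerA mulrC -!addrA; congr +%R; rewrite addrCA.
by apply: cvgD; [apply: cvgZr; exact: cf|exact: cg].
Qed.

Lemma dual_mem_bounded f : dual_mem f -> exists M : R, forall x, `|f x| <= M * `|x|.
Proof. by move=> [lf cf]; exact: continuous_linear_bound. Qed.

Lemma dual_mem_closed (g : X -> R^o) :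
  (forall e : R, 0 < e -> exists2 f, dual_mem f &
     forall x, `|g x - f x| <= e * `|x|) -> dual_mem g.
Proof.
move=> gf; have lg : linear g.
  move=> a x y; apply/eqP; rewrite -subr_eq0 -normr_le0; apply/ler_addgt0Pl => e e0.
  pose c := `|a *: x + y| + `|a| * `|x| + `|y| + 1.
  have c0 : 0 < c by rewrite ltr_wpDl// !addr_ge0// mulr_ge0.
  have [f [lf _] fg] := gf (e / c) (divr_gt0 e0 c0).
  rewrite addr0.
  have -> : g (a *: x + y) - (a *: g x + g y) =
    (g (a *: x + y) - f (a *: x + y)) - (a *: (g x - f x) + (g y - f y)).
    rewrite lf scalerBr !opprD !opprK; ring.
  rewrite (le_trans (ler_normB _ _))//.
  rewrite (le_trans (lerD (fg _) (ler_normD _ _)))// normrZ.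
  rewrite (@le_trans _ _ (e / c * `|a *: x + y| +
     (`|a| * (e / c * `|x|) + e / c * `|y|)))//.
    by rewrite lerD// lerD// ler_wpM2l.
  rewrite mulrCA -!mulrDr -mulrA ler_piMr ?(ltW e0)// mulrC ler_pdivrMr// mul1r.
  by rewrite /c addrA ler_wpDr.
split => //; have [f [lf cf] fg] := gf 1 ltr01.
have [M fM] := continuous_linear_bound lf cf.
apply: (@bound_linear_continuous _ _ (1 + M) lg) => x.
by rewrite -[g x](subrK (f x)) mulrDl (le_trans (ler_normD _ _))// lerD.
Qed.

Definition dual_funSpace : @funSpace R X R^o :=
  FunSpace (fun x => normr_ge0 x) dual_mem0 dual_memL dual_mem_bounded dual_mem_closed.

Definition dual : completeNormedModType R := funOf dual_funSpace.

Definition mkdual (f : X -> R^o) (lf : linear f) (cf : continuous f) : dual :=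
  @FunOf _ _ _ dual_funSpace f (asboolT (conj lf cf)).

Lemma dual_normE (f : dual) : `|f| = sup (range (fun x => `|f x| / `|x|)).
Proof. by []. Qed.

End DualSpace.

Section ContinuousFunctions.
Context {R : realType} (K : topologicalType) (cK : compact [set: K]).
Context (X : completeNormedModType R).

Definition C_mem : set (K -> X) := [set f | continuous f].

Lemma C_mem0 : C_mem (fun=> 0).
Proof. exact: cst_continuous. Qed.

Lemma C_memL (a : R) f g : C_mem f -> C_mem g -> C_mem (fun x => a *: f x + g x).
Proof.
by move=> cf cg x; apply: cvgD; [apply: cvgZr; exact: cf|exact: cg].
Qed.

Lemma C_mem_bounded f : C_mem f -> exists M : R, forall x, `|f x| <= M * 1.
Proof.
move=> cf; have : compact (f @` setT).
  by apply: continuous_compact => //; exact: continuous_subspaceT.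
move=> /compact_bounded/pinfty_ex_gt0[M _ fM]; exists M => x.
by rewrite mulr1; apply: fM; exists x.
Qed.

Lemma C_mem_closed (g : K -> X) :
  (forall e : R, 0 < e -> exists2 f, C_mem f &
     forall x, `|g x - f x| <= e * 1) -> C_mem g.
Proof.
move=> gf x; apply/cvgrPdist_le => e e0.
have e30 : 0 < e / 3 by rewrite divr_gt0.
have [f cf fg] := gf _ e30; rewrite mulr1 in fg.
near=> y.
have -> : g x - g y = (g x - f x) + ((f x - f y) + (f y - g y)).
  by rewrite !addrA !subrK.
rewrite (le_trans (ler_normD _ _))//.
have -> : e = e / 3 + (e / 3 + e / 3) by field.
rewrite lerD// (le_trans (ler_normD _ _))// lerD//; last by rewrite distrC.
by near: y; apply: cvgr_dist_le => //; exact: cf.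
Unshelve. all: by end_near. Qed.

(* The norm weight is 1, and compactness makes every member bounded. *)
Definition C_funSpace : @funSpace R K X :=
  FunSpace (fun x => ler01) C_mem0 C_memL C_mem_bounded C_mem_closed.

Definition C_space : completeNormedModType R := funOf C_funSpace.

Lemma C_normE (f : C_space) : `|f| = sup (range (fun t => `|f t|)).
Proof. by congr sup; apply: eq_imagel => t _ /=; rewrite divr1. Qed.

End ContinuousFunctions.

Section C0Sum.
Context {R : realType} (I : Type) (X : completeNormedModType R).

Definition c0_mem : set (I -> X) :=
  [set f | forall e : R, 0 < e -> finite_set [set i | e <= `|f i|]].

Lemma c0_mem0 : c0_mem (fun=> 0).
Proof.
move=> e e0; apply: (@sub_finite_set _ _ set0) => // i /=.
by rewrite normr0 leNgt e0.
Qed.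

Lemma c0_memL (a : R) f g : c0_mem f -> c0_mem g -> c0_mem (fun x => a *: f x + g x).
Proof.
move=> cf cg e e0.
have e20 : 0 < e / 2 by rewrite divr_gt0.
have a0 : 0 < `|a| + 1 by rewrite ltr_wpDl.
apply: (@sub_finite_set _ _
  ([set i | e / 2 / (`|a| + 1) <= `|f i|] `|` [set i | e / 2 <= `|g i|])).
  move=> i /= ei; apply/orP; rewrite -implyNb; apply/implyP; rewrite -ltNge => fi.
  move: ei; apply: contraTT; rewrite -!ltNge => gi.
  rewrite [ltRHS]splitr (le_lt_trans (ler_normD _ _))// ltrD// normrZ.
  rewrite (@le_lt_trans _ _ ((`|a| + 1) * `|f i|))//.
    by rewrite ler_wpM2r// lerDl.
  by rewrite -ltr_pdivlMl// mulrC.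
by rewrite finite_setU; split; [apply: cf; rewrite divr_gt0|exact: cg].
Qed.

Lemma c0_mem_bounded f : c0_mem f -> exists M : R, forall x, `|f x| <= M * 1.
Proof.
move=> cf; have : finite_set (f @` [set i | 1 <= `|f i|]).
  by apply: finite_image; exact: cf.
move=> /finite_compact/compact_bounded/pinfty_ex_gt0[M M0 fM].
exists (M + 1) => i; rewrite mulr1.
have [fi|fi] := leP 1 `|f i|; last by rewrite ler_wpDl ?(ltW M0) ?(ltW fi).
by rewrite ler_wpDr//; apply: fM; exists i.
Qed.

Lemma c0_mem_closed (g : I -> X) :
  (forall e : R, 0 < e -> exists2 f, c0_mem f &
     forall x, `|g x - f x| <= e * 1) -> c0_mem g.
Proof.
move=> gf e e0; have e20 : 0 < e / 2 by rewrite divr_gt0.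
have [f cf fg] := gf _ e20; apply: sub_finite_set (cf _ e20) => i /= gi.
rewrite -(lerD2l (e / 2)) -splitr (le_trans gi)//.
by rewrite -[g i](subrK (f i)) (le_trans (ler_normD _ _))// lerD2r -[leRHS]mulr1.
Qed.

Definition c0_funSpace : @funSpace R I X :=
  FunSpace (fun x => ler01) c0_mem0 c0_memL c0_mem_bounded c0_mem_closed.

Definition c0_sum : completeNormedModType R := funOf c0_funSpace.

Lemma c0_normE (f : c0_sum) : `|f| = sup (range (fun t => `|f t|)).
Proof. by congr sup; apply: eq_imagel => t _ /=; rewrite divr1. Qed.

End C0Sum.

Section ClosedSubspace.
Context {R : realType} {V : completeNormedModType R}.

Record closedSubspace := ClosedSubspace {
  cs_set : set V;
  cs_set0 : cs_set 0;
  cs_setL : forall (a : R) x y, cs_set x -> cs_set y -> cs_set (a *: x + y);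
  cs_closed : closed cs_set }.

Context (S : closedSubspace).

Definition cs_pred : {pred V} := [pred x | `[< cs_set S x >]].

Lemma cs_predP x : reflect (cs_set S x) (x \in cs_pred).
Proof. exact: asboolP. Qed.

Lemma cs_pred_submod : submod_closed cs_pred.
Proof.
split; first exact/cs_predP/cs_set0.
by move=> a x y /cs_predP Sx /cs_predP Sy; exact/cs_predP/cs_setL.
Qed.

HB.instance Definition _ :=
  GRing.isSubmodClosed.Build R V cs_pred cs_pred_submod.

Record subOf := SubOf { subVal :> V; subValP : subVal \in cs_pred }.

HB.instance Definition _ := [isSub for subVal].
HB.instance Definition _ := [Choice of subOf by <:].
HB.instance Definition _ :=
  GRing.SubChoice_isSubLmodule.Build R V _ subOf cs_pred_submod.

Definition sub_norm (x : subOf) : R := `|(x : V)|.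

Lemma sub_ler_normD x y : sub_norm (x + y) <= sub_norm x + sub_norm y.
Proof. exact: ler_normD. Qed.

Lemma sub_normZ (a : R) x : sub_norm (a *: x) = `|a| * sub_norm x.
Proof. exact: normrZ. Qed.

Lemma sub_norm0_eq0 x : sub_norm x = 0 -> x = 0.
Proof. by move=> /normr0_eq0 x0; apply: val_inj. Qed.

HB.instance Definition _ := Lmodule_isNormed.Build R subOf
  sub_ler_normD sub_normZ sub_norm0_eq0.

Lemma sub_complete (F : set_system subOf) :
  ProperFilter F -> cauchy F -> cvg F.
Proof.
move=> FF /cauchyP Fc.
have cF : cvg (subVal @ F).
  apply: cauchy_cvg; apply/cauchy_exP => e e0; have [x Fx] := Fc e e0.
  exists (x : V); apply: filterS Fx => y; rewrite -!ball_normE.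
  exact.
have Sl : lim (subVal @ F) \in cs_pred.
  apply/cs_predP; apply: (@closed_cvg _ _ F _ subVal _ (@cs_closed S)) cF.
  by apply: nearW => x; exact/cs_predP/subValP.
apply/cvg_ex; exists (SubOf Sl); apply/cvgrPdist_lt => e e0.
by move: cF => /cvgrPdist_lt/(_ e e0).
Qed.

HB.instance Definition _ := Uniform_isComplete.Build subOf sub_complete.

Lemma subVal_norm (x : subOf) : `|x| = `|(x : V)|.
Proof. by []. Qed.

Lemma subVal_continuous : continuous subVal.
Proof.
move=> x; apply/(@cvgrPdist_lt _ _ _ _ (nbhs_filter x)) => e e0.
by apply/nbhs_ballP; exists e => // y; rewrite -ball_normE.
Qed.

Definition quotOf : Type := Quotient.quot cs_pred.

HB.instance Definition _ := GRing.Zmodule.on quotOf.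
HB.instance Definition _ := Quotient.on quotOf.

Definition quot_pi (x : V) : quotOf := \pi_(Quotient.quot cs_pred) x.

Lemma quot_piK q : quot_pi (repr q) = q.
Proof. exact: reprK. Qed.

Lemma quot_piD x y : quot_pi (x + y) = quot_pi x + quot_pi y.
Proof. exact: Quotient.pi_add. Qed.

Lemma quot_piN x : quot_pi (- x) = - quot_pi x.
Proof. exact: Quotient.pi_opp. Qed.

Lemma quot_pi0 : quot_pi 0 = 0.
Proof. by rewrite -(subrr 0) quot_piD quot_piN subrr. Qed.

Lemma quot_piP x y : quot_pi x = quot_pi y <-> cs_set S (x - y).
Proof.
split=> [/eqP|/cs_predP]; rewrite /quot_pi.
  by rewrite -Quotient.idealrBE => /cs_predP.
by rewrite Quotient.idealrBE => /eqP.
Qed.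

Definition quot_scale (a : R) (q : quotOf) : quotOf := quot_pi (a *: repr q).

Lemma quot_piZ a x : quot_pi (a *: x) = quot_scale a (quot_pi x).
Proof.
apply/quot_piP; rewrite -scalerBr -[_ *: _]addr0; apply: cs_setL (@cs_set0 S).
by apply/quot_piP; rewrite quot_piK.
Qed.

Lemma quot_scalerA a b q : quot_scale a (quot_scale b q) = quot_scale (a * b) q.
Proof. by rewrite -[q]quot_piK -!quot_piZ scalerA. Qed.

Lemma quot_scale1r : left_id 1 quot_scale.
Proof. by move=> q; rewrite -[q]quot_piK -quot_piZ scale1r. Qed.

Lemma quot_scalerDr : right_distributive quot_scale +%R.
Proof.
by move=> a p q; rewrite -[p]quot_piK -[q]quot_piK -quot_piD -!quot_piZ
  -quot_piD scalerDr.
Qed.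

Lemma quot_scalerDl q : {morph quot_scale^~ q : a b / a + b}.
Proof.
by move=> a b; rewrite -[q]quot_piK -!quot_piZ -quot_piD scalerDl.
Qed.

HB.instance Definition _ := GRing.Zmodule_isLmodule.Build R quotOf
  quot_scalerA quot_scale1r quot_scalerDr quot_scalerDl.

Definition quot_norm (q : quotOf) : R :=
  inf [set `|x| | x in [set x : V | quot_pi x = q]].

Lemma quot_norm_has_inf q :
  has_inf [set `|x| | x in [set x : V | quot_pi x = q]].
Proof.
split; first by exists `|repr q|; exists (repr q) => //; exact: quot_piK.
by exists 0 => _ [x _ <-].
Qed.

Lemma quot_norm_ge0 q : 0 <= quot_norm q.
Proof.
apply: lb_le_inf; first by case: (quot_norm_has_inf q).
by move=> _ [x _ <-].
Qed.

Lemma quot_norm_le x : quot_norm (quot_pi x) <= `|x|.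
Proof.
by apply: ge_inf; [case: (quot_norm_has_inf (quot_pi x))|exists x].
Qed.

Lemma quot_norm_lt q (e : R) : 0 < e ->
  exists2 x, quot_pi x = q & `|x| < quot_norm q + e.
Proof.
by move=> e0; have [_ [x xq <-] xe] := inf_adherent e0 (quot_norm_has_inf q);
  exists x.
Qed.

Lemma quot_ler_normD p q : quot_norm (p + q) <= quot_norm p + quot_norm q.
Proof.
apply/ler_addgt0Pl => e e0; have e20 : 0 < e / 2 by rewrite divr_gt0.
have [x <- xe] := quot_norm_lt p e20; have [y <- ye] := quot_norm_lt q e20.
rewrite -quot_piD (le_trans (quot_norm_le _))// (le_trans (ler_normD _ _))//.
by move: xe ye; set a := quot_norm _; set b := quot_norm _; lra.
Qed.

Lemma quot_normZ (a : R) q : quot_norm (a *: q) = `|a| * quot_norm q.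
Proof.
have le b p : quot_norm (b *: p) <= `|b| * quot_norm p.
  apply/ler_addgt0Pl => e e0.
  have b0 : 0 < `|b| + 1 by rewrite ltr_wpDl.
  have [x xp xe] := quot_norm_lt p (divr_gt0 e0 b0).
  rewrite -[in leLHS]xp -[_ *: _]quot_piZ (le_trans (quot_norm_le _))// normrZ.
  apply: (@le_trans _ _ (`|b| * (quot_norm p + e / (`|b| + 1)))).
    by rewrite ler_wpM2l// ltW.
  rewrite mulrDr addrC lerD2r mulrCA ler_piMr ?(ltW e0)//.
  by rewrite ler_pdivrMr// mul1r lerDl.
apply/eqP; rewrite eq_le le/=.
have [->|a0] := eqVneq a 0; first by rewrite normr0 mul0r quot_norm_ge0.
rewrite -ler_pdivlMl ?normr_gt0// -normfV.
by apply: le_trans (le _ _); rewrite scalerA mulVf// scale1r.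
Qed.

Lemma quot_norm0_eq0 q : quot_norm q = 0 -> q = 0.
Proof.
move=> q0; rewrite -[q]quot_piK.
suff : closure (cs_set S) (repr q).
  move=> /(@cs_closed S) Sq; rewrite -quot_pi0.
  by apply/quot_piP; rewrite subr0.
move=> B /nbhs_ballP[e /= e0 eB].
have [x xq] := quot_norm_lt q e0; rewrite q0 add0r => xe.
exists (repr q - x); split; first by apply/quot_piP; rewrite quot_piK.
by apply: eB; rewrite -ball_normE /= opprB addrC subrK.
Qed.

HB.instance Definition _ := Lmodule_isNormed.Build R quotOf
  quot_ler_normD quot_normZ quot_norm0_eq0.

End ClosedSubspace.

Section CompletenessCriterion.
Context {R : realType}.

Lemma complete_of_seq (V : normedModType R) :
  (forall u : nat -> V, (forall n, `|u n.+1 - u n| <= 2^-1 ^+ n) -> cvgn u) ->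
  forall F : set_system V, ProperFilter F -> cauchy F -> cvg F.
Proof.
move=> Vc F FF /cauchyP Fc.
pose r n : R := 2^-1 ^+ n / 2.
have r0 n : 0 < r n by rewrite divr_gt0// exprn_gt0// invr_gt0.
have /choice[u Fu] : forall n, exists x, F (ball x (r n)) by move=> n; exact: Fc.
have /Vc/cvg_ex[l ul] n : `|u n.+1 - u n| <= 2^-1 ^+ n.
  have [x []] := filter_ex (filterI (Fu n) (Fu n.+1)).
  rewrite -!ball_normE /= => xn xn1.
  rewrite -(subrKA x) (le_trans (ler_normD _ _))// [X in _ + X]distrC.
  rewrite (le_trans (lerD (ltW xn1) (ltW xn)))// /r.
  have : 0 < (2^-1 : R) ^+ n by rewrite exprn_gt0// invr_gt0.
  by rewrite exprS; set a := _ ^+ n; lra.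
apply/cvg_ex; exists l; apply/cvgrPdist_lt => e e0.
have e20 : 0 < e / 2 by rewrite divr_gt0.
have rc : r @ \oo --> (0 : R).
  rewrite /r -[X in _ --> X](mul0r 2^-1); apply: cvgMl; apply: cvg_expr.
  by rewrite ger0_norm ?invr_ge0// invf_lt1// ltr1n.
have /filter_ex[n [/= ln rn]] : \forall n \near \oo,
    `|l - u n| < e / 2 /\ `|0 - r n| < e / 2.
  by apply: filterI; [move/cvgrPdist_lt: ul|move/cvgrPdist_lt: rc]; apply.
apply: filterS (Fu n) => x; rewrite -ball_normE /= => ux.
rewrite -(subrKA (u n)) (le_lt_trans (ler_normD _ _))//.
move: rn; rewrite sub0r normrN ger0_norm ?(ltW (r0 n))// => rn.
by rewrite [ltRHS]splitr ltrD// (lt_trans ux).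
Qed.

Context {V : completeNormedModType R} (S : @closedSubspace R V).

Lemma quot_complete (F : set_system (quotOf S)) :
  ProperFilter F -> cauchy F -> cvg F.
Proof.
apply: complete_of_seq => u uc.
have r0 n : 0 < (2^-1 : R) ^+ n by rewrite exprn_gt0// invr_gt0.
have /choice[d du] : forall n, exists x,
    quot_pi S x = u n.+1 - u n /\ `|x| <= geometric 2 2^-1 n.
  move=> n; have [x xu xe] := quot_norm_lt (u n.+1 - u n) (r0 n).
  exists x; split => //; rewrite (le_trans (ltW xe))// /geometric /=.
  by rewrite mulr2n mulrDl mul1r lerD2r; exact: uc.
have /cvg_ex[l dl] : cvgn (series d).
  apply: normed_cvg; apply: (@series_le_cvg _ _ (geometric 2 2^-1)) => [n|n|n|].
  - exact: normr_ge0.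
  - by rewrite mulr_ge0// ltW.
  - by case: (du n).
  - apply: is_cvg_geometric_series.
    by rewrite ger0_norm ?invr_ge0// invf_lt1// ltr1n.
have ud n : u n = quot_pi S (repr (u 0%N) + series d n).
  elim: n => [|n IH]; first by rewrite /series /= big_geq// addr0 quot_piK.
  rewrite /series /= big_nat_recr//= addrA quot_piD -IH.
  by rewrite (proj1 (du n)) addrC subrK.
apply/cvg_ex; exists (quot_pi S (repr (u 0%N) + l)).
apply/cvgrPdist_lt => e e0; move/cvgrPdist_lt: dl => /(_ e e0).
apply: filterS => n dn; rewrite (ud n) -quot_piN -quot_piD.
apply: le_lt_trans dn; apply: (le_trans (quot_norm_le _ _)).
by rewrite opprD addrACA subrr add0r.
Qed.

HB.instance Definition _ := Uniform_isComplete.Build (quotOf S) quot_complete.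

End CompletenessCriterion.

Definition sub_space {R : realType} {V : completeNormedModType R}
  (S : @closedSubspace R V) : completeNormedModType R := subOf S.

Definition quot_space {R : realType} {V : completeNormedModType R}
  (S : @closedSubspace R V) : completeNormedModType R := quotOf S.

Section HahnBanach.
Context {R : realType} (V : completeNormedModType R) (x0 : V).

Let P (G : set (V * R)) :=
  [/\ forall (a : R) x y r s, G (x, r) -> G (y, s) ->
        G (a *: x + y, a * r + s),
      forall x r, G (x, r) -> r <= `|x|
    & G !=set0 -> G (x0, `|x0|)].

Let P_ge0 G : P G -> G !=set0 -> G (0, 0).
Proof.
move=> [GL _ Gx] /Gx {}Gx; have := GL (-1) _ _ _ _ Gx Gx.
by rewrite scaleN1r mulN1r !addNr.
Qed.

Let PZ G (a : R) x r : P G -> G (x, r) -> G (a *: x, a * r).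
Proof.
move=> PG Gx; have G0 : G (0, 0) by apply: P_ge0 => //; exists (x, r).
by case: PG => GL _ _; have := GL a _ _ _ _ Gx G0; rewrite !addr0.
Qed.

Let P_fun G x r s : P G -> G (x, r) -> G (x, s) -> r = s.
Proof.
move=> PG Gr Gs; have [GL Gn _] := PG.
have := Gn _ _ (GL (-1) _ _ _ _ Gr Gs); have := Gn _ _ (GL (-1) _ _ _ _ Gs Gr).
rewrite scaleN1r addNr normr0; lra.
Qed.

Let P_ext G v : P G -> G !=set0 -> (forall r, ~ G (v, r)) ->
  exists2 H, P H & G `<` H.
Proof.
move=> PG Gne Gv; have G0 := P_ge0 PG Gne; have [GL Gn Gx] := PG.
pose E := [set z : R | exists y s, G (y, s) /\ z = s - `|y - v|].
have E0 : E !=set0 by exists (0 - `|0 - v|), 0, 0.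
have Eub x r : G (x, r) -> ubound E (`|x + v| - r).
  move=> Gxr _ [y [s [Gy ->]]].
  have := Gn _ _ (GL 1 _ _ _ _ Gxr Gy); rewrite scale1r mul1r.
  have -> : x + y = (x + v) + (y - v) by rewrite addrACA subrr addr0.
  by have := ler_normD (x + v) (y - v); lra.
pose c := sup E.
have cle x r : G (x, r) -> r + c <= `|x + v|.
  by move=> Gxr; have := ge_sup E0 (Eub _ _ Gxr); rewrite -/c; lra.
have cge y s : G (y, s) -> s - c <= `|y - v|.
  move=> Gy; have : s - `|y - v| <= c.
    by apply: ub_le_sup; [exists (`|0 + v| - 0); exact: Eub|exists y, s].
  lra.
exists [set p | exists x r t, G (x, r) /\ p = (x + t *: v, r + t * c)].
  split.
  - move=> a _ _ _ _ [x [r [t [Gxr [-> ->]]]]] [y [s [t' [Gys [-> ->]]]]].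
    exists (a *: x + y), (a * r + s), (a * t + t'); split; first exact: GL.
    congr pair; last by ring.
    by rewrite scalerDr scalerA scalerDl addrACA.
  - move=> _ _ [x [r [t [Gxr [-> ->]]]]].
    have [t0|t0|->] := ltgtP t 0; last by rewrite scale0r mul0r !addr0; exact: Gn.
    + have := cge _ _ (PZ (- t)^-1 PG Gxr).
      have -> : (- t)^-1 *: x - v = (- t)^-1 *: (x + t *: v).
        rewrite scalerDr scalerA invrN mulNr mulVf ?lt_eqF//.
        by rewrite scaleN1r.
      have nt0 : 0 < - t by rewrite oppr_gt0.
      rewrite normrZ ger0_norm ?invr_ge0 ?(ltW nt0)//.
      rewrite -(ler_pM2l nt0) mulrBr !mulrA mulfV ?gt_eqF// !mul1r.
      by rewrite mulNr opprK.
    + have := cle _ _ (PZ t^-1 PG Gxr).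
      have -> : t^-1 *: x + v = t^-1 *: (x + t *: v).
        by rewrite scalerDr scalerA mulVf ?gt_eqF// scale1r.
      rewrite normrZ ger0_norm ?invr_ge0 ?(ltW t0)//.
      by rewrite -(ler_pM2l t0) mulrDr !mulrA mulfV ?gt_eqF// !mul1r.
  - move=> _; exists x0, `|x0|, 0; split; first exact: Gx.
    by rewrite scale0r mul0r !addr0.
split; last first.
  move=> HG; apply: (Gv c); apply: HG.
  by exists 0, 0, 1; rewrite scale1r mul1r !add0r.
move=> [x r] Gxr; exists x, r, 0; split => //.
by rewrite scale0r mul0r !addr0.
Qed.

Lemma norming_functional : exists f : dual V, f x0 = `|x0| /\ `|f| <= 1.
Proof.
have [G [PG Gmax]] : exists G, P G /\ forall H, G `<` H -> ~ P H.
  apply: Zorn_bigcup => F FP Ftot; split.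
  - move=> a x y r s [G FG Gx] [H FH Hy].
    have [GH|HG] := Ftot _ _ FG FH.
      by exists H => //; case: (FP _ FH) => HL _ _; apply: HL => //; exact: GH.
    by exists G => //; case: (FP _ FG) => GL _ _; apply: GL => //; exact: HG.
  - by move=> x r [G FG Gx]; case: (FP _ FG) => _ + _; apply.
  - move=> [p [G FG Gp]]; exists G => //; case: (FP _ FG) => _ _; apply.
    by exists p.
have Gne : G !=set0.
  apply: contrapT => /set0P/negP/negPn/eqP G0.
  apply: (Gmax [set p | exists t, p = (t *: x0, t * `|x0|)]).
    rewrite G0; split; first by move=> p.
    by move=> /(_ (0, 0)); apply; exists 0; rewrite scale0r mul0r.
  split.
  - move=> a _ _ _ _ [t [-> ->]] [t' [-> ->]]; exists (a * t + t').
    by rewrite scalerDl scalerA mulrDl mulrA.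
  - by move=> _ _ [t [-> ->]]; rewrite normrZ ler_wpM2r// ler_norm.
  - by move=> _; exists 1; rewrite scale1r mul1r.
have /choice[f Gf] : forall v, exists r, G (v, r).
  move=> v; apply: contrapT => /forallNP Gv.
  by have [H PH GH] := P_ext PG Gne Gv; exact: Gmax GH PH.
have [GL Gn Gx] := PG.
have lf : linear (f : V -> R^o).
  by move=> a x y; apply: (P_fun PG (Gf _)); apply: GL.
have fle x : `|f x| <= 1 * `|x|.
  rewrite mul1r ler_norml lerNl; apply/andP; split; last exact: Gn (Gf x).
  have := Gn _ _ (PZ (-1) PG (Gf x)); rewrite scaleN1r normrN mulN1r.
  exact.
exists (mkdual lf (@bound_linear_continuous _ _ R^o _ _ lf fle)); split.
  exact: P_fun PG (Gf _) (Gx Gne).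
exact: fs_norm_le.
Qed.

End HahnBanach.

Section Bidual.
Context {R : realType} (X : completeNormedModType R).

Definition bidual : completeNormedModType R := dual (dual X).

Definition eval_at (x : X) : dual X -> R^o := fun f => f x.

Lemma eval_at_linear x : linear (eval_at x).
Proof. by []. Qed.

Lemma eval_at_le x f : `|eval_at x f| <= `|x| * `|f|.
Proof. by rewrite mulrC; exact: (fs_normP f x). Qed.

Definition bidual_emb (x : X) : bidual :=
  mkdual (eval_at_linear x) (bound_linear_continuous (eval_at_linear x) (eval_at_le x)).

Lemma bidual_emb_linear : linear bidual_emb.
Proof.
move=> a x y; apply: funOfP => f.
by have [lf _] := asboolW (funValP f); exact: lf.
Qed.

HB.instance Definition _ := GRing.isLinear.Build R X bidual _ bidual_emb bidual_emb_linear.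

Lemma bidual_emb_norm x : `|bidual_emb x| = `|x|.
Proof.
apply/eqP; rewrite eq_le; apply/andP; split.
  by apply: fs_norm_le => // f; exact: eval_at_le.
have [f [fx f1]] := norming_functional x.
rewrite -[leLHS]normr_id -fx; apply: (le_trans (fs_normP (bidual_emb x) f)).
exact: (ler_piMr (normr_ge0 (bidual_emb x)) f1).
Qed.

Lemma bidual_emb_closed : closed (range bidual_emb).
Proof.
move=> d dJ.
have Jd (e : R) : 0 < e -> exists x, `|d - bidual_emb x| < e.
  move=> e0; have [_ [[x _ <-] xe]] := dJ _ (nbhsx_ballx d e e0).
  by exists x; move: xe; rewrite -ball_normE.
pose B (e : R) := [set x | `|d - bidual_emb x| < e].
pose F : set_system X := filter_from [set e : R | 0 < e] B.
have FF : ProperFilter F.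
  apply: filter_from_proper => [|e e0]; last exact: Jd.
  apply: filter_from_filter => [|a b a0 b0]; first by exists 1 => /=.
  exists (Num.min a b) => /=; first by rewrite lt_min a0.
  by move=> x; rewrite /B /= lt_min => /andP[].
have : cvg F.
  apply: cauchy_cvg; apply/cauchyP => e e0.
  have e20 : 0 < e / 2 by rewrite divr_gt0.
  have [x xe] := Jd _ e20; exists x, (e / 2) => // y ye.
  rewrite -ball_normE /= -bidual_emb_norm linearB -(subrKA d).
  rewrite (le_lt_trans (ler_normD _ _))// [ltRHS]splitr ltrD//.
  by rewrite distrC.
move=> /cvg_ex[l Fl]; exists l => //; apply/esym/eqP.
rewrite -subr_eq0 -normr_le0; apply/ler_addgt0Pl => e e0; rewrite addr0.
have e20 : 0 < e / 2 by rewrite divr_gt0.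
have /filter_ex[x [xd xl]] : F (B (e / 2) `&` ball l (e / 2)).
  by apply: filterI; [exists (e / 2)|apply/Fl/nbhsx_ballx].
rewrite -(subrKA (bidual_emb x)) (le_trans (ler_normD _ _))// [leRHS]splitr.
rewrite lerD ?(ltW xd)// -linearB bidual_emb_norm distrC ltW//.
by move: xl; rewrite -ball_normE.
Qed.

End Bidual.

Section Cardinals.

(* Cardinals are represented by (sets in) types, up to equipotence. *)
Definition card_lt {T U : Type} (A : set T) (B : set U) : Prop :=
  (A #<= B) && ~~ (B #<= A).

(* An infinite cardinal is regular when it is not the union of fewer than kappa
   sets of size less than kappa; the index set may be taken inside kappa. *)
Definition regular_cardinal (kappa : Type) : Prop :=
  infinite_set [set: kappa] /\
  forall (I : set kappa) (F : kappa -> set kappa),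
    card_lt I [set: kappa] ->
    (forall i, I i -> card_lt (F i) [set: kappa]) ->
    card_lt (\bigcup_(i in I) F i) [set: kappa].

End Cardinals.

Section Delta.
Context {R : realType} (kappa : Type) (X : completeNormedModType R).

Definition pre_Delta : set (bidual X) :=
  [set phi | forall A : set (dual X), card_lt A [set: kappa] ->
     exists x : X, forall f, A f -> phi f = f x].

Lemma pre_Delta_closureP (x : bidual X) (e : R) :
  closure pre_Delta x -> 0 < e -> exists2 y, pre_Delta y & `|x - y| < e.
Proof.
move=> cx e0; have [y [Ay ye]] := cx _ (nbhsx_ballx x e e0).
by exists y => //; move: ye; rewrite -ball_normE.
Qed.

Lemma canon_pre_Delta x : pre_Delta (bidual_emb x).
Proof. by move=> A _; exists x. Qed.

Lemma Delta0 : closure pre_Delta 0.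
Proof.
apply: subset_closure; rewrite -[0](linear0 (@bidual_emb R X)).
exact: canon_pre_Delta.
Qed.

Lemma DeltaL (a : R) x y : closure pre_Delta x -> closure pre_Delta y ->
  closure pre_Delta (a *: x + y).
Proof.
move=> cx cy B /nbhs_ballP[e /= e0 eB].
have a0 : 0 < `|a| + 1 by rewrite ltr_wpDl.
have e20 : 0 < e / 2 by rewrite divr_gt0.
have [x' x'D xx'] := pre_Delta_closureP cx (divr_gt0 e20 a0).
have [y' y'D yy'] := pre_Delta_closureP cy e20.
exists (a *: x' + y'); split.
  move=> A Ak; have [u ux] := x'D A Ak; have [v vy] := y'D A Ak.
  exists (a *: u + v) => f Af; have [lf _] := asboolW (funValP f).
  by rewrite lf -(ux f Af) -(vy f Af).
apply: eB; rewrite -ball_normE /= opprD addrACA -scalerBr.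
rewrite (le_lt_trans (ler_normD _ _))// [ltRHS]splitr ler_ltD// normrZ.
apply: (@le_trans _ _ (`|a| * (e / 2 / (`|a| + 1)))).
  by rewrite ler_wpM2l// ltW.
rewrite mulrCA ler_piMr ?(ltW e20)//.
by rewrite ler_pdivrMr// mul1r lerDl.
Qed.

Definition Delta : closedSubspace :=
  ClosedSubspace Delta0 DeltaL (@closed_closure _ pre_Delta).

Definition emb_mem : set (sub_space Delta) := [set d | range (@bidual_emb R X) (\val d)].

Lemma emb_mem0 : emb_mem 0.
Proof. by exists 0 => //; rewrite linear0. Qed.

Lemma emb_memL (a : R) x y : emb_mem x -> emb_mem y -> emb_mem (a *: x + y).
Proof.
move=> [u _ ux] [v _ vy]; exists (a *: u + v) => //.
by rewrite bidual_emb_linear ux vy.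
Qed.

Lemma emb_mem_closed : closed emb_mem.
Proof.
apply: (@closed_comp _ _ (@subVal _ _ Delta)); last exact: bidual_emb_closed.
by move=> d _; exact: subVal_continuous.
Qed.

(* The canonical copy of X, as a closed subspace of the Banach space Delta. *)
Definition emb_in_Delta : closedSubspace :=
  ClosedSubspace emb_mem0 emb_memL emb_mem_closed.

Definition S_lt : completeNormedModType R := quot_space emb_in_Delta.

End Delta.

Definition S_iter {R : realType} (kappa : Type) (m : nat)
  (X : completeNormedModType R) : completeNormedModType R :=
  iter m (S_lt kappa) X.

Section BanachProperties.
Context {R : realType} (X : completeNormedModType R).

Definition weakstar_cvg (u : nat -> dual X) (f : dual X) : Prop :=
  forall x : X, u n x @[n --> \oo] --> f x.

Definition mazur : Prop :=
  forall phi : bidual X,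
    (forall u f, weakstar_cvg u f -> phi (u n) @[n --> \oo] --> phi f) ->
    exists x : X, phi = bidual_emb x.

Definition limited (A : set X) : Prop :=
  forall u : nat -> dual X, weakstar_cvg u 0 ->
    forall e : R, 0 < e ->
      \forall n \near \oo, forall x, A x -> `|u n x| <= e.

Definition gelfand_phillips : Prop :=
  forall A : set X, limited A -> precompact A.

End BanachProperties.

Definition isomorphic {R : realType} (X Y : completeNormedModType R) : Prop :=
  exists (f : {linear X -> Y}) (g : {linear Y -> X}),
    [/\ cancel f g, cancel g f, continuous f & continuous g].

Definition is_tree {d} (K : porderType d) : Prop :=
  forall x : K, wochoice.wo_chain <=%O [pred y : K | (y < x)%O].

Definition interval_subbase {d} (K : porderType d) : set (set K) :=
  [set U | (exists s t, U = [set` `]s, t] : interval K]) \/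
           (exists2 x, forall y, ~ (y < x)%O & U = [set x])].

Definition interval_space {d} (K : porderType d) : Type := K.

HB.instance Definition _ d (K : porderType d) := Choice.on (interval_space K).
HB.instance Definition _ d (K : porderType d) :=
  @isSubBaseTopological.Build (interval_space K) (set K)
    (@interval_subbase d K) id.

Record compactTree := CompactTree {
  ct_disp : Order.disp_t;
  ct_order :> porderType ct_disp;
  ct_tree : is_tree ct_order;
  ct_compact : compact [set: interval_space ct_order];
  ct_hausdorff : hausdorff_space (interval_space ct_order) }.

Definition tree_space (K : compactTree) : topologicalType :=
  interval_space K.

Definition tree_prod {n} (K : 'I_n -> compactTree) : topologicalType :=
  prod_topology (fun i => tree_space (K i)).

Lemma tree_prod_compact {n} (K : 'I_n -> compactTree) :
  compact [set: tree_prod K].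
Proof.
have := tychonoff (fun i => @ct_compact (K i)).
by rewrite (_ : [set _ | _] = setT)//; apply/seteqP; split.
Qed.

Arguments tree_prod_compact {n} K F FF FA : rename.

Section Character.
Context {T : topologicalType}.

Definition local_base (x : T) (B : set (set T)) : Prop :=
  B `<=` nbhs x /\ forall U, nbhs x U -> exists2 V, B V & V `<=` U.

(* The cardinal of a local base B with least_local_base x B is chi(T, x). *)
Definition least_local_base (x : T) (B : set (set T)) : Prop :=
  local_base x B /\ forall B', local_base x B' -> B #<= B'.

Definition character_ge (kappa : Type) (x : T) : Prop :=
  exists2 B, least_local_base x B & [set: kappa] #<= B.

End Character.

Definition Lambda (kappa : Type) (K : compactTree) : set (tree_space K) :=
  [set x | character_ge kappa x].

Arguments Lambda kappa K _ : clear implicits.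

(* Main.v *)
(* In the interval topology a compact tree is a finite union of chains, so it may
   be well ordered by a compact order without changing the topology, and
   [chi(K, x) >= kappa] becomes: no fewer than [kappa] points are cofinal below [x].
   Every space below consists of X-valued functions on points of the product whose
   coordinates carry labels: label 0 means "continuous in this coordinate", label
   [j >= 1] means "c_0 in this coordinate", and records that a jump at a point of
   Lambda was split off in the [j]-th application of S.  Membership is a condition
   on one coordinate at a time, uniformly in the others: up to [e], the function
   only depends on the position of that coordinate with respect to finitely many
   cut points.  Let [E_m] be the space whose labels are at most [m] with 1, ..., [m]
   all used; [E_0] is C(K_1 x ... x K_n, X), and the labellings of [E_n] are the n!
   bijections from the coordinates onto {1, ..., n}.
   - Dual: a functional on [E_m] has countably many atoms, and one that kills the
     atoms vanishes, by well-founded induction over boxes.  So an element of Delta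
     is a function phi on points, X-valued by the Mazur property.  Testing phi
     against fewer than [kappa] evaluations shows that it satisfies the same
     condition with the points of Lambda isolated; conversely, composing such a phi
     with an order retraction gives an element of [E_m] that agrees with phi on any
     prescribed set of fewer than [kappa] points.
   - Splitting: subtracting left limits at Lambda in one coordinate after the other
     turns phi into an element of [E_m] plus functions in which a nonempty set of
     coordinates gets the label [m+1].  Hence S(E_m) ~ E_(m+1). *)

Require Import Defs.
From HB Require Import structures.
From mathcomp Require Import fingroup perm.
From mathcomp Require Import all_boot all_order all_algebra ring lra.
From mathcomp Require Import finmap.
From mathcomp Require Import all_classical all_reals all_analysis.
From mathcomp Require wochoice.

Set Implicit Arguments.
Unset Strict Implicit.
Unset Printing Implicit Defensive.

Import Order.TTheory GRing.Theory Num.Theory.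
Import numFieldNormedType.Exports.

Local Open Scope classical_set_scope.
Local Open Scope ring_scope.
Local Open Scope card_scope.

(** * Cardinals *)

Section Cardinality.

Lemma card_le_exinj {T U : Type} (A : set T) (B : set U) :
  A #<= B <-> exists f : A -> B, injective f.
Proof.
split=> [/card_leP[f]|[f fi]].
  by exists f => x y; apply: (@inj _ _ _ f); rewrite in_setT.
apply/card_leP/injfunPex; exists f => //.
by move=> x y _ _; exact: fi.
Qed.

Lemma card_le_ex {T U : Type} (A : set T) (B : set U) (f : T -> U) :
  (forall x, A x -> B (f x)) -> (forall x y, A x -> A y -> f x = f y -> x = y) ->
  A #<= B.
Proof.
move=> fAB fi; apply/card_le_exinj.
exists (fun x : A => SigSub (mem_set (fAB _ (set_mem (valP x)))) : B).
move=> x y /(congr1 val) /= /fi xy; apply: val_inj.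
by apply: xy; apply: set_mem; exact: valP.
Qed.

Lemma card_le_type {T U : Type} (f : T -> U) (B : set U) :
  injective f -> (forall x, B (f x)) -> [set: T] #<= B.
Proof. by move=> fi fB; apply: (@card_le_ex _ _ _ _ f) => // x y _ _; exact: fi. Qed.

Lemma card_le_typeE {T U : Type} (B : set U) : [set: T] #<= B ->
  exists2 f : T -> U, injective f & forall x, B (f x).
Proof.
move=> /card_le_exinj[f fi]; exists (fun x => val (f (SigSub (in_setT x)))).
  by move=> x y /val_inj/fi[].
by move=> x; apply: set_mem; exact: valP.
Qed.

Lemma card_leE {T U : Type} (u0 : U) (A : set T) (B : set U) : A #<= B ->
  exists f : T -> U, (forall x, A x -> B (f x)) /\
    (forall x y, A x -> A y -> f x = f y -> x = y).
Proof.
move=> /card_le_exinj[g gi].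
exists (fun x => if pselect (A x) is left Ax then val (g (SigSub (mem_set Ax))) else u0).
split=> [x Ax|x y Ax Ay]; case: pselect => // Ax'.
  by apply: set_mem; exact: valP.
by case: pselect => // Ay' /val_inj/gi[].
Qed.

Lemma countableU {T : Type} (A B : set T) :
  countable A -> countable B -> countable (A `|` B).
Proof.
move=> cA cB; rewrite -bigcup2E; apply: bigcup_countable => // -[|[|k]] _ //.
Qed.

(* Hoenig's argument: a maximal family of choice functions that pairwise differ
   in every coordinate must exhaust one of the coordinates. *)
Lemma card_least {U : Type} (F : set (set U)) : F !=set0 ->
  exists2 B, F B & forall B', F B' -> B #<= B'.
Proof.
move=> F0.
have [[B0 [FB0 B00]]|Fne] := pselect (exists B, F B /\ B = set0).
  by exists B0 => // B' _; rewrite B00; exact: card_ge0.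
pose ok (G : set (set U -> U)) :=
  (forall h, G h -> forall B, F B -> B (h B)) /\
  (forall h h', G h -> G h' -> forall B, F B -> h B = h' B -> h = h').
have [G [[G1 G2] Gmax]] : exists G, ok G /\ forall H, G `<` H -> ~ ok H.
  apply: Zorn_bigcup => C Cok Ct; split.
    by move=> h [G CG Gh]; have [+ _] := Cok _ CG; apply.
  move=> h h' [G CG Gh] [G' CG' Gh'].
  have [GG'|G'G] := Ct _ _ CG CG'.
    by have [_ +] := Cok _ CG'; apply=> //; exact: GG'.
  by have [_ +] := Cok _ CG; apply=> //; exact: G'G.
(* Otherwise every member of [F] contains a point that no function of [G] takes there, and choosing
   such points gives a function that enlarges [G]. *)
have [B FB BG] : exists2 B, F B & forall x, B x -> exists2 h, G h & h B = x.
  apply: contrapT => nB.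
  have /choice[h hB] : forall B, exists x, F B -> B x /\ forall k, G k -> k B <> x.
    move=> B; have [FB|nFB] := pselect (F B); last first.
      have [B0 FB0] := F0; have [[x _]|B0e] := pselect (B0 !=set0).
        by exists x.
      exfalso; apply: Fne; exists B0; split => //.
      by apply/eqP; apply: contrapT => /negP/set0P.
    apply: contrapT => nx; apply: nB; exists B => // x Bx.
    apply: contrapT => nh; apply: nx; exists x => _; split => // k Gk kx.
    by apply: nh; exists k.
  apply: (Gmax (G `|` [set h])).
    split; first by move=> k; left.
    move=> /(_ h (or_intror erefl)) Gh; have [B0 FB0] := F0.
    by have [_ /(_ _ Gh)] := hB B0 FB0.
  split=> [k [/G1//|->] B FB|k k' [Gk|->] [Gk'|->] B FB //].
  - by have [] := hB B FB.
  - exact: G2.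
  - by have [_ /(_ _ Gk)] := hB B FB.
  - by move=> /esym; have [_ /(_ _ Gk')] := hB B FB.
exists B => // B' FB'.
have /choice[g gP] : forall x, exists h, B x -> G h /\ h B = x.
  move=> x; have [/BG[h Gh hx]|nx] := pselect (B x); first by exists h.
  by exists (fun=> x).
apply: (@card_le_ex _ _ _ _ (fun x => g x B')).
  by move=> x /gP[Gx _]; exact: (G1 _ Gx _ FB').
move=> x y /gP[Gx gx] /gP[Gy gy] xy.
by rewrite -gx -gy (G2 _ _ Gx Gy _ FB' xy).
Qed.

(** Sets in different types are compared by copying both into the sum type, where [card_least]
    applies to the pair of copies. *)
Lemma card_le_total {T U : Type} (A : set T) (B : set U) : A #<= B \/ B #<= A.
Proof.
pose A' : set (T + U) := inl @` A; pose B' : set (T + U) := inr @` B.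
have AA' : A #<= A' /\ A' #<= A.
  split; last exact: card_image_le.
  apply: (@card_le_ex _ _ _ _ inl); last by move=> x y _ _ [].
  by move=> x Ax; exists x.
have BB' : B #<= B' /\ B' #<= B.
  split; last exact: card_image_le.
  apply: (@card_le_ex _ _ _ _ inr); last by move=> x y _ _ [].
  by move=> x Ax; exists x.
have [|C CAB CP] := @card_least _ [set A'; B']; first by exists A'; left.
have CA := CP _ (or_introl erefl); have CB := CP _ (or_intror erefl).
case: CAB => CE; rewrite CE in CA CB; [left|right].
  exact: card_le_trans AA'.1 (card_le_trans CB BB'.2).
exact: card_le_trans BB'.1 (card_le_trans CA AA'.2).
Qed.

Lemma card_ltN {T U : Type} (A : set T) (B : set U) :
  card_lt A B <-> ~ (B #<= A).
Proof.
split=> [/andP[_ /negP]//|BA]; apply/andP; split; last exact/negP.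
by have [] := card_le_total A B.
Qed.

Lemma card_le_lt {T U V : Type} (A : set T) (B : set U) (C : set V) :
  A #<= B -> card_lt B C -> card_lt A C.
Proof.
by rewrite !card_ltN => AB BC CA; apply: BC; exact: card_le_trans CA AB.
Qed.

Section Regular.
Variables (kappa : Type) (kr : regular_cardinal kappa).
Hypothesis ku : ~ countable [set: kappa].

Lemma countable_card_lt {T} (A : set T) : countable A -> card_lt A [set: kappa].
Proof. by move=> cA; apply/card_ltN => kA; apply: ku; exact: card_le_trans kA cA. Qed.

(** Regularity speaks of subsets of [kappa] only: an injection [e] of [kappa] into the union pulls
    each [D x] back to a countable subset of [kappa], and [g] moves the index set into [kappa]. *)
Lemma bigcup_card_lt {S T} (A : set S) (D : S -> set T) :
  card_lt A [set: kappa] -> (forall x, A x -> countable (D x)) ->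
  card_lt (\bigcup_(x in A) D x) [set: kappa].
Proof.
move=> Ak Dc; apply/card_ltN => /card_le_typeE[e ei eD].
have [k0 _] : [set: kappa] !=set0.
  by apply: contrapT => /set0P/negP/negPn/eqP k0; apply: ku; rewrite k0; exact: countable0.
have [/(card_leE k0)[g [_ gi]] _] := andP Ak.
have [_ kreg] := kr.
pose F (k : kappa) : set kappa :=
  [set k' | exists x, [/\ A x, g x = k & D x (e k')]].
have : card_lt (\bigcup_(k in g @` A) F k) [set: kappa].
  apply: kreg; first exact: card_le_lt (card_image_le _ _) Ak.
  move=> _ [x Ax <-]; apply: countable_card_lt; apply: card_le_trans (Dc x Ax).
  apply: (@card_le_ex _ _ _ _ e) => [k' [y [Ay /gi <-//]]|a b _ _ /ei//].
move=> /card_ltN; apply; apply: subset_card_le => k' _.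
have [x Ax Dx] := eD k'.
by exists (g x); [exists x|exists x].
Qed.

End Regular.

(** A maximal family [G] of injective sequences with disjoint ranges misses only finitely many
    points, so points are coded by a sequence and an index, and a pairing function absorbs the extra
    natural number. *)
Lemma card_le_nat_prod (I : Type) : infinite_set [set: I] ->
  [set: nat * I] #<= [set: I].
Proof.
move=> Iinf.
pose ok (G : set (nat -> I)) := (forall u, G u -> injective u) /\
  (forall u v a b, G u -> G v -> u a = v b -> u = v).
have [G [[G1 G2] Gmax]] : exists G, ok G /\ forall H, G `<` H -> ~ ok H.
  apply: Zorn_bigcup => C Cok Ct; split.
    by move=> h [G CG Gh]; have [+ _] := Cok _ CG; apply.
  move=> h h' a b [G CG Gh] [G' CG' Gh'].
  have [GG'|G'G] := Ct _ _ CG CG'.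
    by have [_ +] := Cok _ CG'; apply=> //; exact: GG'.
  by have [_ +] := Cok _ CG; apply=> //; exact: G'G.
have next (D : set I) : infinite_set D -> exists2 u : nat -> I, injective u & forall k, D (u k).
  by move=> /infiniteP/card_le_typeE.
pose Rm := [set x | forall u k, G u -> u k <> x].
have Rc : finite_set Rm.
  apply: contrapT => /next[u ui uR].
  apply: (Gmax (G `|` [set u])).
    split; first by move=> k; left.
    by move=> /(_ u (or_intror erefl)) Gu; exact: (uR 0%N _ 0%N Gu).
  split=> [k [/G1//|->//]|k k' a b [Gk|->] [Gk'|->] //].
  - exact: G2.
  - by move=> /esym; have := uR b _ a Gk; move=> + /esym.
  - by move=> /esym; have := uR a _ b Gk'.
have [u0 Gu0] : G !=set0.
  apply: contrapT => nG; apply: Iinf; apply: sub_finite_set Rc => x _ u k Gu.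
  by exfalso; apply: nG; exists u.
have [r [_ ri]] := card_leE 0%N (finite_set_countable Rc).
(* Points on a sequence get even indices; the finite remainder [Rm] gets odd indices on the fixed
   sequence [u0], which keeps the code injective. *)
have /choice[c cP] : forall x, exists p : (nat -> I) * nat, G p.1 /\
    ((exists2 k, p.2 = k.*2 & p.1 k = x) \/
     (Rm x /\ p = (u0, (r x).*2.+1))).
  move=> x; have [xR|] := pselect (Rm x).
    by exists (u0, (r x).*2.+1); split => //; right.
  move=> nR; have [u [k [Gu uk]]] : exists u k, G u /\ u k = x.
    apply: contrapT => nu; apply: nR => u k Gu uk; apply: nu.
    by exists u, k.
  by exists (u, k.*2); split => //; left; exists k.
have ci : injective c.
  move=> x y cxy; have [_] := cP x; have [_] := cP y; rewrite cxy.
  case=> [[k e1 yk]|[Ry e1]] [[k' e2 xk]|[Rx e2]].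
  - by rewrite -xk -[RHS]yk; congr ((c y).1 _); apply: double_inj; rewrite -e1 -e2.
  - by move: e1; rewrite e2 /= => /(congr1 odd); rewrite /= !odd_double.
  - by move: e2; rewrite e1 /= => /(congr1 odd); rewrite /= !odd_double.
  - by apply: ri => //; apply: double_inj; move: e2; rewrite e1 => -[->].
apply: (@card_le_type _ _ (fun ax => (c ax.2).1 (choice.pickle (ax.1, (c ax.2).2)))) => //.
move=> [a x] [b y] /= E; have [Gx _] := cP x; have [Gy _] := cP y.
have E1 := G2 _ _ _ _ Gx Gy E; move: E; rewrite E1 => /(G1 _ Gy).
move=> /(pcan_inj choice.pickleK)[-> E2].
congr pair; apply: ci.
by rewrite (surjective_pairing (c x)) E1 E2 -surjective_pairing.
Qed.

End Cardinality.

(** * Isomorphisms, adjoints and quotients *)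

Section Isomorphisms.
Context {R : realType}.
Implicit Types X Y Z V : completeNormedModType R.

Let pack_linear X Y (f : X -> Y) (lf : linear f) : {linear X -> Y} :=
  HB.pack f (GRing.isLinear.Build _ _ _ _ _ lf).

Lemma isomorphic_intro X Y (g : X -> Y) (C C' : R) : linear g ->
  (forall x, `|g x| <= C * `|x|) -> (forall x, `|x| <= C' * `|g x|) ->
  (forall y, exists x, g x = y) -> isomorphic X Y.
Proof.
move=> gl gC gC' /choice[k gk].
pose g' := pack_linear gl.
have gi : injective g.
  move=> x y gxy; apply/eqP; rewrite -subr_eq0 -normr_le0.
  apply: (le_trans (gC' _)); have -> : g (x - y) = 0.
    by rewrite -[g]/(g' : X -> Y) linearB /= gxy subrr.
  by rewrite normr0 mulr0.
have kl : linear k.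
  move=> a x y; apply: gi; rewrite gk.
  by rewrite gl !gk.
exists g', (pack_linear kl); split.
- by move=> x; apply: gi; rewrite gk.
- by move=> y; exact: gk.
- exact: bound_linear_continuous gl gC.
- by apply: (bound_linear_continuous (M := C') kl) => y; rewrite -[in leRHS](gk y).
Qed.

Lemma isomorphic_sym X Y : isomorphic X Y -> isomorphic Y X.
Proof. by move=> [f [g [fg gf cf cg]]]; exists g, f; split. Qed.

Lemma isomorphicE X Y : isomorphic X Y -> exists (f : X -> Y) (g : Y -> X) (C : R),
  [/\ [/\ linear f, linear g & 0 <= C], cancel f g, cancel g f,
    forall x, `|f x| <= C * `|x| & forall y, `|g y| <= C * `|y|].
Proof.
move=> [f [g [fg gf cf cg]]].
have lf : linear f by exact: linearP.
have lg : linear g by exact: linearP.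
have [M fM] := continuous_linear_bound lf cf.
have [N gN] := continuous_linear_bound lg cg.
exists f, g, (`|M| + `|N|); split; [by split; rewrite ?addr_ge0|exact: fg|exact: gf| |].
- move=> x; apply: (le_trans (fM x)); rewrite ler_wpM2r//.
  by rewrite (le_trans (ler_norm _))// lerDl.
- move=> x; apply: (le_trans (gN x)); rewrite ler_wpM2r//.
  by rewrite (le_trans (ler_norm _))// lerDr.
Qed.

Lemma linear_comp_id X Y Z (f : X -> Y) (g : Y -> Z) :
  linear f -> linear g -> linear (g \o f).
Proof. by move=> lf lg a x y; rewrite /= lf lg. Qed.

Lemma isomorphic_trans X Y Z : isomorphic X Y -> isomorphic Y Z -> isomorphic X Z.
Proof.
move=> /isomorphicE[f [f' [C [[lf lf' C0] ff' f'f fC f'C]]]].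
move=> /isomorphicE[g [g' [D [[lg lg' D0] gg' g'g gD g'D]]]].
apply: (@isomorphic_intro _ _ (g \o f) (D * C) (C * D)).
- exact: linear_comp_id.
- by move=> x /=; rewrite (le_trans (gD _))// -mulrA ler_wpM2l.
- move=> x; rewrite -mulrA /= -[X in `|X| <= _]ff' (le_trans (f'C _))// ler_wpM2l//.
  by rewrite -[X in `|X| <= _]gg'.
- by move=> z; exists (f' (g' z)); rewrite /= f'f g'g.
Qed.

Lemma dual_linear X (f : dual X) : linear f.
Proof. by have [] := asboolW (funValP f). Qed.

Lemma dual_bound X (f : dual X) x : `|f x| <= `|f| * `|x|.
Proof. exact: (fs_normP f x). Qed.

Lemma dualB X (f : dual X) x y : f (x - y) = f x - f y.
Proof. exact: (linearB (pack_linear (Y := R^o) (dual_linear f))). Qed.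

Lemma dualD X (f : dual X) x y : f (x + y) = f x + f y.
Proof. exact: (linearD (pack_linear (Y := R^o) (dual_linear f))). Qed.

Lemma dual0 X (f : dual X) : f 0 = 0.
Proof. exact: (linear0 (pack_linear (Y := R^o) (dual_linear f))). Qed.

Lemma dual_sum X (f : dual X) I (r : seq I) (F : I -> X) :
  f (\sum_(i <- r) F i) = \sum_(i <- r) (f (F i) : R^o).
Proof.
exact: (linear_sum (pack_linear (Y := R^o) (dual_linear f))).
Qed.

Lemma dual_norm_le X (f : dual X) (M : R) : 0 <= M ->
  (forall x, `|f x| <= M * `|x|) -> `|f| <= M.
Proof. exact: fs_norm_le. Qed.

Definition mkdual_le X (f : X -> R^o) (M : R) (lf : linear f)
  (fM : forall x, `|f x| <= M * `|x|) : dual X :=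
  mkdual lf (bound_linear_continuous lf fM).

Section Adjoint.
Variables (X Y : completeNormedModType R) (h : X -> Y) (C : R).
Hypotheses (lh : linear h) (C0 : 0 <= C) (hC : forall x, `|h x| <= C * `|x|).

Lemma adjoint_linear (b : dual Y) : linear ((b : Y -> R^o) \o h).
Proof. by move=> a x y; rewrite /= lh dual_linear. Qed.

Lemma adjoint_le (b : dual Y) x : `|((b : Y -> R^o) \o h) x| <= `|b| * C * `|x|.
Proof. by rewrite -mulrA (le_trans (dual_bound b _))// ler_wpM2l. Qed.

Definition adjoint (b : dual Y) : dual X :=
  mkdual_le (adjoint_linear b) (adjoint_le b).

Lemma adjoint_is_linear : linear adjoint.
Proof. by move=> a x y; exact: funOfP. Qed.

Lemma adjoint_norm b : `|adjoint b| <= C * `|b|.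
Proof. by rewrite mulrC; apply: dual_norm_le => [|x]; [rewrite mulr_ge0|exact: adjoint_le]. Qed.

End Adjoint.

Section Biadjoint.
Variables (X Y : completeNormedModType R) (h : X -> Y) (C : R).
Hypotheses (lh : linear h) (C0 : 0 <= C) (hC : forall x, `|h x| <= C * `|x|).

Definition biadjoint : bidual X -> bidual Y :=
  adjoint (adjoint_is_linear lh hC) (adjoint_norm lh C0 hC).

Lemma biadjoint_emb x : biadjoint (bidual_emb x) = bidual_emb (h x).
Proof. exact: funOfP. Qed.

Lemma biadjoint_linear : linear biadjoint.
Proof. exact: adjoint_is_linear. Qed.

Lemma biadjoint_norm Phi : `|biadjoint Phi| <= C * `|Phi|.
Proof. exact: adjoint_norm. Qed.

Lemma biadjoint_pre_Delta kappa Phi :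
  pre_Delta kappa Phi -> pre_Delta kappa (biadjoint Phi).
Proof.
move=> PhiD A Ak.
have [x Ax] := PhiD (adjoint lh hC @` A) (card_le_lt (card_image_le _ _) Ak).
by exists (h x) => f Af; apply: (Ax (adjoint lh hC f)); exists f.
Qed.

Lemma biadjoint_Delta kappa Phi : closure (@pre_Delta R kappa _) Phi ->
  closure (@pre_Delta R kappa _) (biadjoint Phi).
Proof.
move=> PhiD B /nbhs_ballP[e /= e0 eB].
have [y yD ye] := pre_Delta_closureP PhiD (divr_gt0 e0 (ltr_wpDl C0 ltr01)).
exists (biadjoint y); split; first exact: biadjoint_pre_Delta.
apply: eB; rewrite -ball_normE /=.
have -> : biadjoint Phi - biadjoint y = biadjoint (Phi - y) by exact: funOfP.
rewrite (le_lt_trans (biadjoint_norm _))//.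
rewrite (le_lt_trans (ler_wpM2l C0 (ltW ye)))// mulrA ltr_pdivrMr ?ltr_wpDl//.
by rewrite mulrDr mulr1 [e * C]mulrC ltrDl.
Qed.

End Biadjoint.

(** [g] maps onto a complement of the subspace. The lower bound is required against all translates
    because the quotient norm is an infimum over them. *)
Lemma quot_isomorphic V (S : @closedSubspace R V) Z (g : Z -> V) (C D : R) :
  linear g -> 0 <= D -> (forall z, `|g z| <= C * `|z|) ->
  (forall z s, cs_set S s -> `|z| <= D * `|g z + s|) ->
  (forall v, exists z s, cs_set S s /\ v = g z + s) ->
  isomorphic Z (quot_space S).
Proof.
move=> lg D0 gC gD gs.
apply: (@isomorphic_intro _ _ (fun z => quot_pi S (g z)) C D).
- by move=> a x y; rewrite lg quot_piD -[_ *: quot_pi S _]quot_piZ.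
- by move=> z; rewrite (le_trans (quot_norm_le _ _)).
- move=> z; apply/ler_addgt0Pl => e e0.
  have [x xz xe] := quot_norm_lt (quot_pi S (g z)) (divr_gt0 e0 (ltr_wpDl D0 ltr01)).
  have Sx : cs_set S (x - g z) by apply/quot_piP.
  have := gD z _ Sx; rewrite addrC subrK => /le_trans; apply.
  rewrite (le_trans (ler_wpM2l D0 (ltW xe)))// mulrDr addrC lerD2r.
  by rewrite mulrCA ler_piMr ?(ltW e0)// ler_pdivrMr ?ltr_wpDl// mul1r lerDl.
- move=> q; have [z [s [Ss qE]]] := gs (repr q); exists z.
  rewrite -[RHS]quot_piK; apply/quot_piP.
  rewrite qE opprD addNKr -[- s]addr0 -scaleN1r.
  by apply: cs_setL => //; exact: cs_set0.
Qed.

Lemma S_lt_isomorphic kappa X Z (g : Z -> bidual X) (C D : R) :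
  linear g -> 0 <= D -> (forall z, closure (@pre_Delta R kappa _) (g z)) ->
  (forall z, `|g z| <= C * `|z|) ->
  (forall z x, `|z| <= D * `|g z + bidual_emb x|) ->
  (forall v, closure (@pre_Delta R kappa _) v -> exists z x, v = g z + bidual_emb x) ->
  isomorphic Z (S_lt kappa X).
Proof.
move=> lg D0 gcl gC gD gs.
have gin z : g z \in cs_pred (Delta kappa X) by apply/cs_predP; exact: gcl.
apply: (@quot_isomorphic _ (emb_in_Delta kappa X) Z (fun z => SubOf (gin z)) C D) => //.
- by move=> a x y; apply: val_inj; exact: lg.
- by move=> z s [x _ xs]; have := gD z x; rewrite xs.
- move=> [v vin]; have [z [x vE]] := gs v (elimT (cs_predP _ _) vin).
  have xin : bidual_emb x \in cs_pred (Delta kappa X).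
    by apply/cs_predP/subset_closure; exact: canon_pre_Delta.
  exists z, (SubOf xin); split; first by exists x.
  exact: val_inj.
Qed.

(** The biadjoint of an isomorphism carries Delta and the canonical copy to those of the other
    space, so S may be computed in any isomorphic model; this makes iteration possible. *)
Lemma S_lt_isomorphic_transport kappa X Y Z (g : Z -> bidual X) (C D : R) :
  isomorphic Y X ->
  linear g -> 0 <= D -> (forall z, closure (@pre_Delta R kappa _) (g z)) ->
  (forall z, `|g z| <= C * `|z|) ->
  (forall z x, `|z| <= D * `|g z + bidual_emb x|) ->
  (forall v, closure (@pre_Delta R kappa _) v -> exists z x, v = g z + bidual_emb x) ->
  isomorphic Z (S_lt kappa Y).
Proof.
move=> /isomorphicE[h [k [M [[lh lk M0] hk kh hM kM]]]] lg D0 gcl gC gD gs.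
pose h2 := biadjoint lh M0 hM; pose k2 := biadjoint lk M0 kM.
have h2k2 v : h2 (k2 v) = v.
  apply: funOfP => f; congr (v _); apply: funOfP => x; congr (f _); exact: kh.
have k2h2 v : k2 (h2 v) = v.
  apply: funOfP => f; congr (v _); apply: funOfP => x; congr (f _); exact: hk.
have h2D u v : h2 (u + v) = h2 u + h2 v by exact: funOfP.
have k2D u v : k2 (u + v) = k2 u + k2 v by exact: funOfP.
apply: (@S_lt_isomorphic kappa Y Z (k2 \o g) (M * C) (D * M)).
- by move=> a x y; rewrite /= lg /k2 biadjoint_linear.
- by rewrite mulr_ge0.
- by move=> z; exact: biadjoint_Delta.
- by move=> z; rewrite (le_trans (biadjoint_norm _ _ _ _))// -mulrA ler_wpM2l.
- move=> z y; have := gD z (h y).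
  have -> : g z + bidual_emb (h y) = h2 ((k2 \o g) z + bidual_emb y).
    by rewrite h2D /= h2k2 /h2 biadjoint_emb.
  move=> /le_trans; apply; rewrite -mulrA ler_wpM2l//; exact: biadjoint_norm.
- move=> v vD; have [|z [x vE]] := gs (h2 v); first exact: biadjoint_Delta.
  exists z, (k x); rewrite -[LHS]k2h2 vE k2D /= /k2.
  by rewrite biadjoint_emb.
Qed.

(** By the lower bound on [g], approximate preimages of a limit point form a Cauchy filter, whose
    limit is an exact preimage. This will show that [pre_Delta] is already closed. *)
Lemma bounded_linear_closure Z V (g : Z -> V) (C : R) (A : set V) : linear g ->
  (forall z, A (g z)) -> (forall v, A v -> exists z, v = g z) ->
  (forall z, `|z| <= C * `|g z|) -> (forall z, `|g z| <= C * `|z|) ->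
  closed A.
Proof.
move=> lg gA Ag gC Cg v vg; pose g' := pack_linear lg.
have gB x y : g (x - y) = g x - g y by rewrite -[g]/(g' : Z -> V) linearB.
have gv (e : R) : 0 < e -> exists x, `|v - g x| < e.
  move=> e0; have [_ [/Ag[x ->] xe]] := vg _ (nbhsx_ballx v e e0).
  by exists x; move: xe; rewrite -ball_normE.
pose D := `|C| + 1; have D0 : 0 < D by rewrite ltr_wpDl.
have CD : C <= D by rewrite (le_trans (ler_norm _))// lerDl.
have gD z : `|z| <= D * `|g z| by rewrite (le_trans (gC z))// ler_wpM2r.
have Dg z : `|g z| <= D * `|z| by rewrite (le_trans (Cg z))// ler_wpM2r.
pose B (e : R) := [set x | `|v - g x| < e].
pose F : set_system Z := filter_from [set e : R | 0 < e] B.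
have FF : ProperFilter F.
  apply: filter_from_proper => [|e e0]; last exact: gv.
  apply: filter_from_filter => [|a b a0 b0]; first by exists 1 => /=.
  exists (Num.min a b) => /=; first by rewrite lt_min a0.
  by move=> x; rewrite /B /= lt_min => /andP[].
have : cvg F.
  apply: cauchy_cvg; apply/cauchyP => e e0.
  have e20 : 0 < e / D / 2 by rewrite !divr_gt0.
  have [x xe] := gv _ e20; exists x, (e / D / 2) => // y ye.
  rewrite -ball_normE /= (le_lt_trans (gD _))// gB -ltr_pdivlMl// mulrC.
  rewrite -(subrKA v) (le_lt_trans (ler_normD _ _))// [ltRHS]splitr ltrD//.
  by rewrite distrC.
move=> /cvg_ex[l Fl]; suff -> : v = g l by [].
apply/eqP; rewrite -subr_eq0 -normr_le0; apply/ler_addgt0Pl => e e0; rewrite addr0.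
have e20 : 0 < e / 2 by rewrite divr_gt0.
have /filter_ex[x [xd xl]] : F (B (e / 2) `&` ball l (e / 2 / D)).
  by apply: filterI; [exists (e / 2)|apply/Fl/nbhsx_ballx; rewrite divr_gt0].
rewrite -(subrKA (g x)) (le_trans (ler_normD _ _))// [leRHS]splitr.
rewrite lerD ?(ltW xd)// -gB (le_trans (Dg _))// -ler_pdivlMl// mulrC.
by rewrite distrC ltW//; move: xl; rewrite -ball_normE.
Qed.

End Isomorphisms.

(** * Functions with small oscillation on finite partitions *)

(** Strict inequality is written as the negation of the reverse [le]. The greatest element reflects
    compactness; it is conditional on a point [x0] because the empty order is allowed. *)
Record well_order {W : eqType} (le : rel W) : Prop := WellOrder {
  wo_total : total le;
  wo_anti : antisymmetric le;
  wo_trans : transitive le;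
  wo_min : forall A : set W, A !=set0 -> exists x, A x /\ forall y, A y -> le x y;
  wo_top : forall x0 : W, exists t, forall y, le y t }.

Section WellOrderTheory.
Context {W : eqType} (le : rel W) (wo : well_order le).

Lemma wo_refl x : le x x.
Proof. by have := wo_total wo x x; rewrite orbb. Qed.

Lemma wo_nle x y : ~~ le y x -> le x y.
Proof. by move=> /negbTE yx; have := wo_total wo x y; rewrite yx orbF. Qed.

Lemma wo_lt_trans y x z : ~~ le y x -> ~~ le z y -> ~~ le z x.
Proof. by move=> yx; apply: contra => zx; exact: (wo_trans wo) (wo_nle yx). Qed.

Lemma wo_le_lt_trans y x z : le x y -> ~~ le z y -> ~~ le z x.
Proof. by move=> xy; apply: contra => zx; exact: (wo_trans wo) xy. Qed.

Lemma wo_lt_le_trans y x z : ~~ le y x -> le y z -> ~~ le z x.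
Proof. by move=> yx yz; apply: contra yx => zx; exact: (wo_trans wo) zx. Qed.

Lemma wo_eq x y : le x y -> le y x -> x = y.
Proof. by move=> xy yx; apply: (wo_anti wo); rewrite xy. Qed.

Lemma wo_ltNeq x y : ~~ le y x -> (x == y) = false.
Proof. by apply: contraNF => /eqP ->; exact: wo_refl. Qed.

(** No point of [P] is left strictly between [s'] and [t], so every point above [s'] and at most [t]
    lies on the same side of each cut of [P] as [t]. *)
Lemma wo_below (P : seq W) (s t : W) : ~~ le t s ->
  exists s', [/\ ~~ le t s', le s s' & forall p, p \in P -> ~~ le t p -> le p s'].
Proof.
elim: P s => [|p P IH] s st; first by exists s; split => //; exact: wo_refl.
have [s' [s't ss' s'P]] := IH _ st.
have [tp|tp] := boolP (le t p).
  exists s'; split => // q; rewrite inE => /orP[/eqP ->|]; [by rewrite tp|exact: s'P].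
have [ps|/wo_nle sp] := boolP (le p s').
  exists s'; split => // q; rewrite inE => /orP[/eqP -> //|]; exact: s'P.
exists p; split => // [|q]; first exact: (wo_trans wo) sp.
rewrite inE => /orP[/eqP -> _|qP tq]; first exact: wo_refl.
exact: (wo_trans wo) (s'P _ qP tq) sp.
Qed.

End WellOrderTheory.

Section Spaces.
Context {R : realType} {n : nat} {W : 'I_n -> eqType} (le : forall i, rel (W i)).
Hypothesis wo : forall i, well_order (@le i).
Context {X : completeNormedModType R}.

(* A coordinate with label 0 runs through [W i] continuously; a coordinate with
   a positive label runs through a discrete copy of [W i]. *)
Definition point := forall i : 'I_n, (W i * nat)%type.

(* Two points of a coordinate are in the same cell of the partition cut out by
   the finite list [P]; the points of [P] lying in [Q] are isolated. *)
Definition same i (Q : set (W i)) (P : seq (W i)) (z z' : W i * nat) : Prop :=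
  z.2 = z'.2 /\
  if z.2 == 0%N then
    (forall p, p \in P -> le z.1 p = le z'.1 p) /\
    (forall p, p \in P -> Q p -> (z.1 == p) = (z'.1 == p))
  else z.1 = z'.1.

Definition agree_off i (t t' : point) := forall j, j != i -> t j = t' j.

(** For label 0 the first clause is a uniform continuity condition in coordinate [i]. For a positive
    label it is automatic, since [same] forces equality, and the second clause is the c_0
    condition. *)
Definition cut_by (Q : forall i, set (W i)) (f : point -> X) i (e : R) (P : seq (W i)) : Prop :=
  (forall t t', agree_off i t t' -> same (Q i) P (t i) (t' i) -> `|f t - f t'| <= e) /\
  (forall t, (t i).2 != 0%N -> (t i).1 \notin P -> `|f t| <= e).

Definition cut (Q : forall i, set (W i)) (f : point -> X) : Prop :=
  forall (i : 'I_n) (e : R), 0 < e -> exists P : seq (W i), cut_by Q f e P.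

(** [T] prescribes the admissible labellings and [Q i] the isolated points of coordinate [i]: none
    for the spaces E_m themselves, those of Lambda for the values of elements of Delta. *)
Definition E_mem Q (T : set point) : set (point -> X) :=
  [set f | [/\ forall t, ~ T t -> f t = 0, exists M : R, forall t, `|f t| <= M & cut Q f]].

Lemma same_refl i (Q : set (W i)) P z : same Q P z z.
Proof. by split => //; case: ifP. Qed.

Lemma same_sym i (Q : set (W i)) P z z' : same Q P z z' -> same Q P z' z.
Proof.
move=> [z2 zz]; split; first by [].
rewrite -z2; case: ifP zz => // _ [zP zQ]; split=> p pP; rewrite ?zP//.
by move=> Qp; rewrite zQ.
Qed.

Lemma same_trans i (Q : set (W i)) P z z' z'' :
  same Q P z z' -> same Q P z' z'' -> same Q P z z''.
Proof.
move=> [z2 zz] [z'2 zz']; split; first by rewrite z2.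
move: zz zz'; rewrite -z2; case: ifP => [_ [zP zQ] [z'P z'Q]|_ -> //].
by split=> p pP; [rewrite zP// z'P|move=> Qp; rewrite zQ// z'Q].
Qed.

Lemma same_sub i (Q Q' : set (W i)) (P P' : seq (W i)) z z' :
  Q `<=` Q' -> {subset P <= P'} -> same Q' P' z z' -> same Q P z z'.
Proof.
move=> QQ PP [z2 zz]; split => //; case: ifP zz => // _ [zP zQ].
by split=> p /PP pP; [exact: zP|move=> /QQ; exact: zQ].
Qed.

Lemma cut_by_sub Q f i e (P P' : seq (W i)) : {subset P <= P'} ->
  cut_by Q f e P -> cut_by Q f e P'.
Proof.
move=> PP [fP fP']; split=> [t t' tt' s|t t0 tP].
  by apply: fP => //; exact: same_sub s.
by apply: fP' => //; apply: contra tP; exact: PP.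
Qed.

Lemma agree_off_eq i t t' : agree_off i t t' -> t i = t' i -> t = t'.
Proof.
move=> tt ti; apply: functional_extensionality_dep => j.
by have [->|/tt] := eqVneq j i.
Qed.

Lemma E_mem0 Q T : E_mem Q T (fun=> 0).
Proof.
split=> //; first by exists 0 => t; rewrite normr0.
move=> i e e0; exists [::]; split=> [t t' _ _|t _ _].
  by rewrite subrr normr0 ltW.
by rewrite normr0 ltW.
Qed.

Lemma E_memL Q T (a : R) f g : E_mem Q T f -> E_mem Q T g ->
  E_mem Q T (fun t => a *: f t + g t).
Proof.
move=> [fT [M fM] fc] [gT [N gN] gc]; split.
- by move=> t nT; rewrite fT// gT// scaler0 addr0.
- exists (`|a| * M + N) => t; rewrite (le_trans (ler_normD _ _))//.
  by rewrite lerD// normrZ ler_wpM2l.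
- move=> i e e0.
  have a0 : 0 < `|a| + 1 by rewrite ltr_wpDl.
  have e20 : 0 < e / 2 by rewrite divr_gt0.
  have [P fP] := fc i _ (divr_gt0 e20 a0); have [P' gP] := gc i _ e20.
  have {fP}[fP fP'] : cut_by Q f (e / 2 / (`|a| + 1)) (P ++ P').
    by apply: cut_by_sub fP => p; rewrite mem_cat => ->.
  have {gP}[gP gP'] : cut_by Q g (e / 2) (P ++ P').
    by apply: cut_by_sub gP => p; rewrite mem_cat => ->; rewrite orbT.
  have ae : `|a| * (e / 2 / (`|a| + 1)) <= e / 2.
    rewrite mulrCA ler_piMr ?(ltW e20)// ler_pdivrMr// mul1r lerDl//.
  exists (P ++ P'); split=> [t t' tt' s|t t0 tP].
    rewrite opprD addrACA -scalerBr (le_trans (ler_normD _ _))// [leRHS]splitr.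
    rewrite lerD ?gP// normrZ (le_trans _ ae)// ler_wpM2l// fP//.
  rewrite (le_trans (ler_normD _ _))// [leRHS]splitr.
  by rewrite lerD ?gP'// normrZ (le_trans _ ae)// ler_wpM2l// fP'.
Qed.

Lemma E_mem_bounded Q T f : E_mem Q T f -> exists M : R, forall t, `|f t| <= M * 1.
Proof. by move=> [_ [M fM] _]; exists M => t; rewrite mulr1. Qed.

Lemma E_mem_closed Q T (g : point -> X) :
  (forall e : R, 0 < e -> exists2 f, E_mem Q T f &
     forall t, `|g t - f t| <= e * 1) -> E_mem Q T g.
Proof.
move=> gf; split.
- move=> t nT; apply/eqP; rewrite -normr_le0; apply/ler_addgt0Pl => e e0.
  have [f [fT _ _] fg] := gf e e0.
  by rewrite addr0 -[leRHS]mulr1 -[g t]subr0 -(fT _ nT).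
- have [f [_ [M fM] _] fg] := gf 1 ltr01; exists (1 + M) => t.
  by rewrite -[g t](subrK (f t)) (le_trans (ler_normD _ _))// lerD// -[leRHS]mulr1.
- move=> i e e0; have e30 : 0 < e / 3 by rewrite divr_gt0.
  have [f [_ _ fc] fg] := gf _ e30; rewrite mulr1 in fg.
  have [P [fP fP']] := fc i _ e30.
  have e3 : e = e / 3 + (e / 3 + e / 3) by field.
  exists P; split=> [t t' tt' s|t t0 tP].
    have -> : g t - g t' = (g t - f t) + ((f t - f t') + (f t' - g t')).
      by rewrite !addrA !subrK.
    rewrite (le_trans (ler_normD _ _))// [leRHS]e3 lerD//.
    by rewrite (le_trans (ler_normD _ _))// lerD ?fP// distrC.
  rewrite -[g t](subrK (f t)) (le_trans (ler_normD _ _))// [leRHS]e3.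
  by rewrite lerD// ler_wpDl ?(ltW e30)// fP'.
Qed.

Definition E_funSpace Q T : @funSpace R point X :=
  FunSpace (fun=> ler01) (@E_mem0 Q T) (@E_memL Q T) (@E_mem_bounded Q T) (@E_mem_closed Q T).

Definition E_space Q T : completeNormedModType R := funOf (E_funSpace Q T).

Definition mkE Q T f (Ef : E_mem Q T f) : E_space Q T :=
  @FunOf _ _ _ (E_funSpace Q T) f (asboolT Ef).

Lemma E_spaceP Q T (f : E_space Q T) : E_mem Q T f.
Proof. exact: asboolW (funValP f). Qed.

Lemma E_norm_le Q T (f : E_space Q T) (M : R) : 0 <= M ->
  (forall t, `|f t| <= M) -> `|f| <= M.
Proof. by move=> M0 fM; apply: fs_norm_le => // t; rewrite mulr1. Qed.

Lemma E_normP Q T (f : E_space Q T) t : `|f t| <= `|f|.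
Proof. by rewrite (le_trans (fs_normP f t))//= mulr1. Qed.

Lemma E_mem_sub (Q Q' : forall i, set (W i)) (T T' : set point) f :
  (forall i, Q i `<=` Q' i) -> (forall t, T t -> T' t) -> E_mem Q T f -> E_mem Q' T' f.
Proof.
move=> QQ TT [fT fb fc]; split => //.
  by move=> t nT; apply: fT => /TT.
move=> i e e0; have [P [fP fP']] := fc i e e0; exists P; split => // t t' tt' s.
by apply: fP => //; apply: same_sub s; first exact: QQ.
Qed.

(** With no cuts only labels and discrete coordinates are compared, so [T] does not constrain the
    position of a coordinate with label 0. *)
Definition saturated (T : set point) :=
  forall t t', (forall i, same (@set0 (W i)) [::] (t i) (t' i)) -> T t -> T t'.

(** These are the sets by which members of the spaces may be truncated: finitely many cuts in the
    coordinates with label 0, arbitrary dependence on labels and discrete coordinates. *)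
Definition cellular (V : set point) (P : forall i, seq (W i)) :=
  forall t t', (forall i, same set0 (P i) (t i) (t' i)) -> V t -> V t'.

Definition restr (V : set point) (f : point -> X) t := if `[< V t >] then f t else 0.

Lemma cellularE V P t t' : cellular V P ->
  (forall i, same set0 (P i) (t i) (t' i)) -> `[< V t >] = `[< V t' >].
Proof.
move=> cV s; apply/asboolP/asboolP; apply: cV => // i; exact: same_sym.
Qed.

Lemma E_mem_restr Q (T T' V : set point) P f : cellular V P ->
  (forall t, V t -> T t -> T' t) -> E_mem Q T f -> E_mem Q T' (restr V f).
Proof.
move=> cV VT [fT [M fM] fc]; split.
- move=> t nT'; rewrite /restr; case: asboolP => // Vt; apply: fT => Tt.
  by apply: nT'; exact: VT.
- exists M => t; rewrite /restr; case: asboolP => // _.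
  by rewrite normr0 (le_trans _ (fM t)).
- move=> i e e0; have [P' fP] := fc i e e0.
  have {fP}[fP fP'] : cut_by Q f e (P i ++ P').
    by apply: cut_by_sub fP => p; rewrite mem_cat => ->; rewrite orbT.
  exists (P i ++ P'); split=> [t t' tt' s|t t0 tP]; rewrite /restr.
    rewrite -(@cellularE V P t t') //.
      case: asboolP => _; first exact: fP.
      by rewrite subrr normr0 ltW.
    move=> j; have [->|/tt' ->] := eqVneq j i; last exact: same_refl.
    by apply: same_sub s => // p; rewrite mem_cat => ->.
  case: asboolP => _; first exact: fP'.
  by rewrite normr0 ltW.
Qed.

Definition cell (P : forall i, seq (W i)) (t : point) : set point :=
  [set t' | forall i, same set0 (P i) (t i) (t' i)].

Lemma cell_cellular P t : cellular (cell P t) P.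
Proof. by move=> t1 t2 s tt1 i; exact: same_trans (tt1 i) (s i). Qed.

Lemma E_mem_cell Q (T : set point) P t (x : X) : saturated T -> T t ->
  E_mem Q T (restr (cell P t) (fun=> x)).
Proof.
move=> sT Tt; split.
- move=> t' nT'; rewrite /restr; case: asboolP => // Vt; exfalso; apply: nT'.
  by apply: sT Tt => i; apply: same_sub (Vt i).
- exists `|x| => t'; rewrite /restr; case: asboolP => // _.
  by rewrite normr0.
- move=> i e e0; exists ((t i).1 :: P i); split=> [t1 t2 tt s|t' t0 tP]; rewrite /restr.
    rewrite -(@cellularE _ P t1 t2) ?subrr ?normr0 ?(ltW e0)//; first exact: cell_cellular.
    move=> j; have [->|/tt ->] := eqVneq j i; last exact: same_refl.
    by apply: same_sub s => // p; rewrite inE => ->; rewrite orbT.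
  case: asboolP => [/(_ i)[l2]|_]; last by rewrite normr0 ltW.
  rewrite l2 (negbTE t0) => tt'; move: tP.
  by rewrite tt' inE eqxx.
Qed.

End Spaces.

Arguments point {n} W.
Arguments agree_off {n W} i t t'.

(** * Functionals are determined by countably many atoms *)

Lemma ultra_bounded_cvg {R : realType} {I : Type} (U : set_system I)
  (UU : UltraFilter U) (h : I -> R) (M : R) :
  (forall i, `|h i| <= M) -> exists l : R, h @ U --> l.
Proof.
move=> hM; have PU := ultra_proper (F := U).
have hU : U (h @^-1` `[- M, M]).
  by apply: filterE => i /=; rewrite in_itv /= -ler_norml.
have [l [_ lU]] := @segment_compact R (- M) M (h @ U) _ hU.
exists l => B lB; have [//|UnB] := in_ultra_setVsetC (h @^-1` B) UU.
by have [x [nBx Bx]] := lU (~` B) B UnB lB.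
Qed.

Lemma dep_choice {I : Type} {A : I -> Type} (P : forall i, A i -> Prop) :
  (forall i, exists x, P i x) -> exists f : forall i, A i, forall i, P i (f i).
Proof. by move=> PE; exists (fun i => sval (cid (PE i))) => i; exact: svalP. Qed.

Definition refines {n : nat} {W : 'I_n -> eqType} (P0 P : forall i, seq (W i)) :=
  forall i, {subset P0 i <= P i}.

(** Along one such ultrafilter all bounded functions of the cut set converge at once, and their
    limits depend linearly on them; this is how atoms are obtained. *)
Lemma fin_ultrafilter {n : nat} (W : 'I_n -> eqType) :
  exists2 U : set_system (forall i, seq (W i)), UltraFilter U &
    forall P0 : forall i, seq (W i), U [set P | refines P0 P].
Proof.
pose B (P0 : forall i, seq (W i)) := [set P : forall i, seq (W i) | refines P0 P].
pose F := filter_from [set: forall i, seq (W i)] B.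
have FF : ProperFilter F.
  apply: filter_from_proper => [|P _]; last by exists P => i.
  apply: filter_from_filter => [|P P' _ _]; first by exists (fun i => [::]).
  exists (fun i => P i ++ P' i) => [|P'' sP]; [by []|split=> i p pP; apply: sP].
    by rewrite mem_cat pP.
  by rewrite mem_cat pP orbT.
have [U [UU FU]] := ultraFilterLemma FF.
by exists U => // P0; apply: FU; exists P0.
Qed.

(** * Oscillation on cells, and induction over lower boxes *)

Section Cells.
Context {R : realType} {n : nat} {W : 'I_n -> eqType} (le : forall i, rel (W i)).
Hypothesis wo : forall i, well_order (@le i).
Context {X : completeNormedModType R}.

Lemma E_cell_osc Q T (f : point W -> X) (e : R) : E_mem le Q T f -> 0 < e ->
  exists P : forall i, seq (W i), forall t t',
    (forall i, same le (Q i) (P i) (t i) (t' i)) -> `|f t - f t'| <= e.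
Proof.
(* The coordinates are changed one at a time, at the cost [e'] each; [n.+1] keeps the divisor
   nonzero when [n] is 0. *)
move=> [_ _ fc] e0; pose e' := e / n.+1%:R.
have e'0 : 0 < e' by rewrite divr_gt0.
have /dep_choice[P fP] := fun i => fc i e' e'0.
exists P => t t' s.
pose hyb k : point W := fun i => if (i < k)%N then t' i else t i.
have hk k : (k <= n)%N -> `|f t - f (hyb k)| <= k%:R * e'.
  elim: k => [_|k IH kn].
    have -> : hyb 0%N = t by apply: functional_extensionality_dep.
    by rewrite subrr normr0 mul0r.
  rewrite -(subrKA (f (hyb k))) (le_trans (ler_normD _ _))// -natr1 mulrDl mul1r.
  rewrite lerD ?IH ?(ltnW kn)//; apply: (fP (Ordinal kn)).1 => [j jk|].
    have jk' : (nat_of_ord j == k) = false.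
      by apply: contraNF jk => /eqP jk; apply/eqP/val_inj.
    by rewrite /hyb [in RHS]ltnS [in RHS]leq_eqVlt jk'.
  by rewrite /hyb /= ltnn ltnSn.
have <- : hyb n = t' by apply: functional_extensionality_dep => i; rewrite /hyb ltn_ord.
rewrite (le_trans (hk _ (leqnn n)))// /e' mulrCA ler_piMr ?(ltW e0)//.
by rewrite ler_pdivrMr// mul1r ler_nat.
Qed.

Definition down (t : point W) : set (point W) :=
  [set t' | forall i, (t' i).2 = (t i).2 /\
     if (t i).2 == 0%N then is_true (le (t' i).1 (t i).1) else (t' i).1 = (t i).1].

Lemma down_cellular t : cellular le (down t) (fun i => [:: (t i).1]).
Proof.
move=> t1 t2 s d i; have [l1 d1] := d i; have [l2 s2] := s i.
rewrite -l2; split => //; move: s2 d1; rewrite l1; case: ifP => _; last by move=> <-.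
by move=> [sP _]; rewrite (sP _ (mem_head _ _)).
Qed.

Lemma down_refl t : down t t.
Proof. by move=> i; split => //; case: ifP => // _; exact: (wo_refl (wo i)). Qed.

Lemma down_trans t t' t'' : down t t' -> down t' t'' -> down t t''.
Proof.
move=> d d' i; have [l1 d1] := d i; have [l2 d2] := d' i.
split; first by rewrite l2.
move: d1 d2; rewrite l1; case: ifP => _; last by move=> <-.
by move=> d1 d2; exact: (wo_trans (wo i)) d1.
Qed.

(** The coordinates are minimised one after the other, each among the points of [A] below the one
    found so far; later choices cannot move an earlier coordinate any more. *)
Lemma down_min (A : set (point W)) : A !=set0 ->
  exists t, A t /\ forall t', A t' -> down t t' -> t' = t.
Proof.
move=> [t0 At0].
have H k : (k <= n)%N -> exists t, A t /\
    forall t', A t' -> down t t' -> forall i : 'I_n, (i < k)%N -> t' i = t i.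
  elim: k => [_|k IH kn]; first by exists t0.
  have [t [At tmin]] := IH (ltnW kn).
  pose k' := Ordinal kn.
  have [|x [[t1 [At1 dt1 t1x]] xmin]] := wo_min (wo k')
      (A := [set x | exists t', [/\ A t', down t t' & (t' k').1 = x]]).
    by exists (t k').1, t; split => //; exact: down_refl.
  exists t1; split => // t' At' dt' i; rewrite ltnS leq_eqVlt => /orP[/eqP ik|ik].
    have -> : i = k' by exact: val_inj.
    have [l1 d1] := dt' k'.
    rewrite (surjective_pairing (t' k')) (surjective_pairing (t1 k')) l1; congr pair.
    move: d1; case: ifP => // _ d1; apply: (wo_eq (wo k') d1).
    by rewrite t1x; apply: xmin; exists t'; split => //; exact: down_trans dt'.
  rewrite (tmin t')//; last exact: down_trans dt'.
  by rewrite (tmin t1).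
have [t [At tmin]] := H n (leqnn n); exists t; split => // t' At' dt'.
by apply: functional_extensionality_dep => i; apply: tmin.
Qed.

End Cells.

Section Atoms.
Context {R : realType} {n : nat} {W : 'I_n -> eqType} (le : forall i, rel (W i)).
Hypothesis wo : forall i, well_order (@le i).
Context {X : completeNormedModType R} (T : set (point W)).
Hypothesis sT : saturated le T.
Variable m : nat.
Hypothesis Tm : forall t i, T t -> ((t i).2 <= m)%N.

Local Notation E := (@E_space R n W le X (fun=> set0) T).

Definition cellE (P : forall i, seq (W i)) (t : point W) (x : X) : E :=
  if pselect (T t) is left Tt then mkE (E_mem_cell (fun=> set0) P x sT Tt) else 0.

Lemma cellEE P t x t' : T t -> cellE P t x t' = restr (cell le P t) (fun=> x) t'.
Proof. by move=> Tt; rewrite /cellE; case: pselect. Qed.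

Lemma cellE_norm P t x : `|cellE P t x| <= `|x|.
Proof.
apply: E_norm_le => // t'; rewrite /cellE; case: pselect => [Tt|_].
  by rewrite /= /restr; case: asboolP => // _; rewrite normr0.
by rewrite /= normr0.
Qed.

Lemma cellE_linear P t : linear (cellE P t).
Proof.
move=> a x y; apply: funOfP => t'; rewrite funOfDE funOfZE /cellE.
case: pselect => [Tt|_] /=; last by rewrite scaler0 addr0.
by rewrite /restr; case: asboolP => // _; rewrite scaler0 addr0.
Qed.

Section Fixed.
Variable mu : dual E.

(* The atom of [mu] at [t] is a generalised limit of [mu] over the cells
   shrinking to [t], taken along an ultrafilter on the finite cut sets. *)
Lemma atoms : exists (U : set_system (forall i, seq (W i))) (a : point W -> dual X),
  [/\ UltraFilter U,
   forall P0, U [set P | refines P0 P] &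
   forall t x, (fun P => mu (cellE P t x)) @ U --> a t x].
Proof.
have [U UU UP] := fin_ultrafilter W; exists U.
have PU : ProperFilter U by exact: ultra_proper.
have muM t x P : `|mu (cellE P t x)| <= `|mu| * `|x|.
  by rewrite (le_trans (dual_bound _ _))// ler_wpM2l// cellE_norm.
have /choice[a aP] : forall t, exists a : dual X,
    forall x, (fun P => mu (cellE P t x)) @ U --> a x.
  move=> t; have /choice[l lP] : forall x, exists l : R, (fun P => mu (cellE P t x)) @ U --> l.
    by move=> x; apply: (ultra_bounded_cvg UU); exact: muM.
  have ll : linear (l : X -> R^o).
    move=> b x y; apply: (cvg_unique _ (lP (b *: x + y))) => //.
    rewrite (_ : (fun P => _) = fun P => b *: mu (cellE P t x) + mu (cellE P t y)); last first.
      by apply/funext => P; rewrite cellE_linear dual_linear.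
    by apply: cvgD (lP y); apply: cvgZr; exact: lP.
  have lM x : `|l x| <= `|mu| * `|x|.
    have c : (fun P => `|mu (cellE P t x)|) @ U --> `|l x| by apply: cvg_norm; exact: lP.
    rewrite -(cvg_lim _ c)//; apply: limr_le; first by apply/cvg_ex; eexists; exact: c.
    by apply: filterE => P; exact: muM.
  by exists (mkdual_le ll lM).
by exists a; split.
Qed.

Variables (U : set_system (forall i, seq (W i))) (a : point W -> dual X).
Hypothesis UU : UltraFilter U.
Hypothesis UP : forall P0, U [set P | refines P0 P].
Hypothesis aU : forall t x, (fun P => mu (cellE P t x)) @ U --> a t x.

Section Null.
Variable f : E.

Definition mu_restr (V : set (point W)) P (cV : cellular le V P) : R :=
  mu (mkE (E_mem_restr cV (fun t _ (Tt : T t) => Tt) (E_spaceP f))).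

(** The product of [f] and [mu] is treated as a finitely additive measure on cellular sets. Asking
    that its variation vanish, and not only its mass, makes the notion pass to subsets and finite
    unions. *)
Definition null (V : set (point W)) := forall V' P (cV : cellular le V' P),
  V' `<=` V -> mu_restr cV = 0.

Lemma cellular_sub (V : set (point W)) P P' : (forall i, {subset P i <= P' i}) ->
  cellular le V P -> cellular le V P'.
Proof. by move=> PP cV t t' s; apply: cV => i; exact: same_sub (s i). Qed.

Lemma cellularI (V V' : set (point W)) P : cellular le V P -> cellular le V' P ->
  cellular le (V `&` V') P.
Proof.
by move=> cV cV' t t' s [Vt V't]; split; [exact: cV Vt|exact: cV' V't].
Qed.

Lemma cellularC (V : set (point W)) P : cellular le V P -> cellular le (~` V) P.
Proof.
move=> cV t t' s nV /= V't; apply: nV; apply: cV V't => i; exact: same_sym.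
Qed.

Lemma mu_restr_split V D P P' P'' (cV : cellular le V P)
   (cVD : cellular le (V `&` D) P') (cVC : cellular le (V `&` ~` D) P'') :
  mu_restr cV = mu_restr cVD + mu_restr cVC.
Proof.
rewrite /mu_restr -dualD; congr (mu _); apply: funOfP => t; rewrite funOfDE /= /restr.
case: asboolP => [Vt|nV]; last first.
  by rewrite !asboolF ?addr0// => -[].
have [Dt|nD] := pselect (D t).
  by rewrite asboolT// asboolF ?addr0// => -[].
by rewrite asboolF => [|[]//]; rewrite asboolT ?add0r.
Qed.

Lemma null_cover (I : eqType) (s : seq I) (D : I -> set (point W)) PD :
  (forall k, k \in s -> cellular le (D k) (PD k)) ->
  (forall k, k \in s -> null (D k)) ->
  null [set t | exists2 k, k \in s & D k t].
Proof.
elim: s => [|k s IH] cD nD V P cV Vs.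
  rewrite /mu_restr -(dual0 mu); congr (mu _); apply: funOfP => t /=.
  by rewrite /restr asboolF// => /Vs[].
pose P' i := P i ++ PD k i.
have cV' : cellular le V P'.
  by apply: cellular_sub cV => i p; rewrite mem_cat => ->.
have cD' : cellular le (D k) P'.
  apply: cellular_sub (cD k (mem_head _ _)) => i p; rewrite mem_cat => ->.
  by rewrite orbT.
rewrite (mu_restr_split cV (cellularI cV' cD') (cellularI cV' (cellularC cD'))).
rewrite (nD k (mem_head _ _) _ _ (cellularI cV' cD')); last by move=> t [].
rewrite add0r; apply: IH => [k' k's|k' k's|t [Vt nDt]].
- by apply: cD; rewrite inE k's orbT.
- by apply: nD; rewrite inE k's orbT.
- have [k'] := Vs t Vt; rewrite inE => /orP[/eqP ->//|k's Dk].
  by exists k'.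
Qed.

Lemma null_sub (V V' : set (point W)) : V' `<=` V -> null V -> null V'.
Proof. by move=> V'V nV V'' P cV V''V'; apply: nV => t /V''V'/V'V. Qed.

Hypothesis fa : forall t, T t -> a t (f t) = 0.

(** At a minimal counterexample [t], all of the box outside a small cell at [t] is covered by
    finitely many smaller boxes, which are null, and the cell carries in the limit only the atom at
    [t], which kills [f t]. *)
Lemma null_down t0 : null (down le t0).
Proof.
pose B := [set t | ~ null (down le t)].
apply: contrapT => nt; have [|t [tB tmin]] := @down_min _ _ _ wo B; first by exists t0.
apply: tB => V P0 cV0 Vt.
pose D (k : {i : 'I_n & W i}) := down le (dfwith t (tag k) (tagged k, 0%N)).
pose keys (P : forall i, seq (W i)) :=
  [seq k <- [seq Tagged W p | i <- enum 'I_n, p <- P i] |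
   ((t (tag k)).2 == 0%N) && ~~ le (t (tag k)).1 (tagged k)].
have nD k : ((t (tag k)).2 == 0%N) && ~~ le (t (tag k)).1 (tagged k) -> null (D k).
  case: k => i p /= /andP[/eqP l0 tp]; apply: contrapT => nDk.
  have dt : down le t (dfwith t i (p, 0%N)).
    move=> j; case: dfwithP => [|k ik] /=.
      by rewrite l0 eqxx; split => //; exact: (wo_nle (wo i)).
    by split => //; case: ifP => // _; exact: (wo_refl (wo k)).
  have := tmin _ nDk dt => /(congr1 (fun u : point W => (u i).1)).
  by rewrite dfwithin /= => tpi; move: tp; rewrite -tpi (wo_refl (wo i)).
(* A point of the box outside the cell is separated from [t] by a cut [p] below [t] in some
   coordinate with label 0, so it lies in the box with that coordinate lowered to [p]. *)
have nC P : null (down le t `\` cell le P t).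
  apply: (@null_sub [set u | exists2 k, k \in keys P & D k u]); last first.
    apply: (@null_cover _ _ _ (fun k i => [:: (dfwith t (tag k) (tagged k, 0%N) i).1])).
      by move=> k _; exact: down_cellular.
    by move=> k; rewrite mem_filter => /andP[/nD].
  move=> u [du /existsNP[i nui]].
  have [lu dui] := du i.
  have [l0|l0] := eqVneq (t i).2 0%N; last first.
    by exfalso; apply: nui; split => //; rewrite (negbTE l0); move: dui; rewrite (negbTE l0).
  rewrite l0 eqxx in dui.
  have [p pP [up tp]] : exists2 p, p \in P i & le (u i).1 p /\ ~~ le (t i).1 p.
    apply: contrapT => np; apply: nui; split => //; rewrite l0 eqxx; split => // p pP.
    apply/idP/idP => [tp|up]; first exact: (wo_trans (wo i)) tp.
    by apply/negPn/negP => ntp; apply: np; exists p.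
  exists (Tagged W p).
    rewrite mem_filter /= l0 eqxx tp /=; apply/allpairsPdep.
    by exists i, p; rewrite mem_enum.
  move=> j /=; case: dfwithP => [|k ik] /=; last exact: du.
  by rewrite lu l0.
have nCV (P : forall i, seq (W i)) P' (cV : cellular le V P') :
    cell le P t `&` V = set0 -> mu_restr cV = 0.
  move=> CV; apply: (nC P) => u Vu; split; first exact: Vt.
  by move=> Cu; have : (cell le P t `&` V) u by []; rewrite CV.
have [Vtt|nVt] := pselect (V t); last first.
  apply: (nCV P0); apply/seteqP; split => // u [Cu Vu]; apply: nVt.
  by apply: cV0 Vu => i; exact: same_sym.
have [Tt|nTt] := pselect (T t); last first.
  rewrite /mu_restr -(dual0 mu); congr (mu _); apply: funOfP => u /=.
  rewrite /restr; case: asboolP => // Vu; have [fT _ _] := E_spaceP f; apply: fT => Tu.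
  apply: nTt; apply: sT Tu => i; have [l1 d1] := Vt _ Vu i.
  split => //; rewrite l1; case: ifP d1 => // _ _; by split.
have PU : ProperFilter U by exact: ultra_proper.
apply/eqP; rewrite -normr_le0; apply/ler_addgt0Pl => e e0; rewrite addr0.
have mu0 : 0 < `|mu| + 1 by rewrite ltr_wpDl.
have e20 : 0 < e / 2 by rewrite divr_gt0.
have [Pe Pef] := E_cell_osc (E_spaceP f) (divr_gt0 e20 mu0).
have /cvgrPdist_lt/(_ _ e20) Ue := @aU t (f t).
(* Along this cut set [V] is cellular, [f] is nearly constant on the cell of [t], and [mu] of the
   constant [f t] on that cell is close to the vanishing atom. *)
have [P [[P0P PeP] Pa]] := filter_ex (filterI (filterI (UP P0) (UP Pe)) Ue).
rewrite fa// sub0r normrN in Pa.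
have cVP : cellular le V P by exact: cellular_sub cV0.
have cC : cellular le (cell le P t) P by exact: cell_cellular.
have -> : mu_restr cV0 = mu_restr cC.
  rewrite (mu_restr_split cV0 (cellularI cVP cC) (cellularI cVP (cellularC cC))).
  rewrite (nC P _ _ (cellularI cVP (cellularC cC))) => [|u [Vu nCu]]; last by split; [exact: (Vt _ Vu)|exact: nCu].
  rewrite addr0; congr (mu _); apply: funOfP => u /=; rewrite /restr.
  have [Cu|nCu] := pselect (cell le P t u); last first.
    by rewrite !asboolF// => -[].
  by rewrite !asboolT//; split => //; exact: cVP Vtt.
rewrite -(subrK (mu (cellE P t (f t))) (mu_restr cC)) (le_trans (ler_normD _ _))//.
rewrite [leRHS]splitr lerD ?(ltW Pa)// -dualB (le_trans (dual_bound _ _))//.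
have -> : e / 2 = (`|mu| + 1) * (e / 2 / (`|mu| + 1)) by field; rewrite gt_eqF.
rewrite ler_pM// ?lerDl//.
apply: E_norm_le => [|u]; first by rewrite divr_ge0 ?ltW.
rewrite funOfBE /= cellEE// /restr; case: asboolP => Cu; last by rewrite subrr normr0 divr_ge0 ?ltW.
rewrite distrC; apply: Pef => i; exact: same_sub (Cu i).
Qed.

(** Up to a small error [f] lives on points whose discrete coordinates come from finite lists. As
    labels are at most [m], finitely many lower boxes cover them, with the greatest element as
    corner in the label 0 coordinates. *)
Lemma atomless_eq0 : mu f = 0.
Proof.
have [[t0 _]|npt] := pselect (exists t : point W, True); last first.
  by rewrite -(dual0 mu); congr (mu _); apply: funOfP => t; exfalso; apply: npt; exists t.
have /dep_choice[top topP] := fun i => wo_top (wo i) (t0 i).1.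
apply/eqP; rewrite -normr_le0; apply/ler_addgt0Pl => e e0; rewrite addr0.
have mu0 : 0 < `|mu| + 1 by rewrite ltr_wpDl.
pose e' := e / (`|mu| + 1); have e'0 : 0 < e' by rewrite divr_gt0.
have [_ _ fc] := E_spaceP f.
have /dep_choice[P fP] := fun i => fc i e' e'0.
pose V := [set t : point W | forall i, ((t i).2 <= m)%N /\ ((t i).2 != 0%N -> (t i).1 \in P i)].
have cV : cellular le V (fun i => [::]).
  move=> t t' s Vt i; have [l1 s1] := s i; have [tm tP] := Vt i.
  rewrite -l1; split => // l0; move: s1; rewrite (negbTE l0) => <-; exact: tP.
pose zl i := (top i, 0%N) :: [seq (p, j) | p <- P i, j <- iota 1 m].
(* Exceeds the length of every list [zl i], so that all corners are indexed by one finite function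
   type. *)
pose N := (\max_(i < n) size (zl i)).+1.
pose c (k : {ffun 'I_n -> 'I_N}) : point W := fun i => nth (top i, 0%N) (zl i) (k i).
have nV : null V.
  apply: (@null_sub [set u | exists2 k, k \in enum {ffun 'I_n -> 'I_N} & down le (c k) u]); last first.
    apply: (@null_cover _ _ _ (fun k i => [:: (c k i).1])) => k _.
      exact: down_cellular.
    exact: null_down.
  move=> t Vt.
  have /dep_choice[k kP] : forall i, exists k : 'I_N,
      nth (top i, 0%N) (zl i) k = if (t i).2 == 0%N then (top i, 0%N) else t i.
    move=> i; set z := if _ then _ else _.
    have zi : z \in zl i.
      rewrite /z; case: ifP => [_|/negbT l0]; first exact: mem_head.
      have [tm tP] := Vt i.
      rewrite inE; apply/orP; right; apply/allpairsPdep.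
      exists (t i).1, (t i).2; rewrite tP// mem_iota add1n ltnS tm lt0n l0.
      by rewrite -surjective_pairing.
    have kN : (index z (zl i) < N)%N.
      rewrite ltnS ltnW//; apply: leq_trans (leq_bigmax i).
      by rewrite index_mem.
    by exists (Ordinal kN); rewrite /= nth_index.
  exists [ffun i => k i]; first by rewrite mem_enum.
  move=> i; rewrite /c ffunE kP; case: ifP => [/eqP l0|l0] /=; first by rewrite l0.
  by rewrite l0.
pose g := mkE (E_mem_restr cV (fun t _ (Tt : T t) => Tt) (E_spaceP f)).
have -> : mu f = mu (f - g).
  by rewrite dualB (_ : mu g = 0) ?subr0//; exact: (nV _ _ cV).
rewrite (le_trans (dual_bound _ _))//.
have -> : e = (`|mu| + 1) * e' by rewrite /e'; field; rewrite gt_eqF.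
rewrite ler_pM// ?lerDl//.
apply: E_norm_le => [|u]; first exact: ltW.
rewrite funOfBE /= /restr; case: asboolP => Vu; first by rewrite subrr normr0 ltW.
rewrite subr0; have [Tu|nTu] := pselect (T u); last first.
  by have [fT _ _] := E_spaceP f; rewrite fT// normr0 ltW.
have [i [ul uP]] : exists i, (u i).2 != 0%N /\ (u i).1 \notin P i.
  apply: contrapT => ni; apply: Vu => i; split; first exact: Tm.
  by move=> l0; apply: contrapT => /negP uP; apply: ni; exists i.
exact: (fP i).2.
Qed.

End Null.

(** One cut set separates finitely many atoms, and a signed sum of bumps on their disjoint cells has
    norm at most 1; hence only finitely many atoms exceed a given size. *)
Lemma atoms_countable : countable [set t | exists x, a t x <> 0].
Proof.
pose A k := [set t : point W | exists x : X, `|x| <= 1 /\ k.+1%:R^-1 < `|a t x| :> R].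
have -> : [set t | exists x, a t x <> 0] = \bigcup_k A k.
  apply/seteqP; split=> [t [x ax]|t [k _ [x [_ kx]]]]; last first.
    exists x => ax; move: kx; rewrite ax normr0.
    by rewrite ltNge invr_ge0 ler0n.
  have x0 : 0 < `|x|.
    by rewrite normr_gt0; apply: contra_notN ax => /eqP ->; rewrite dual0.
  pose y := `|x|^-1 *: x.
  have ay : 0 < `|a t y|.
    rewrite normr_gt0; apply: contra_notN ax => /eqP.
    have -> : y = `|x|^-1 *: x + 0 by rewrite addr0.
    rewrite dual_linear dual0 addr0 => /eqP.
    by rewrite scaler_eq0 invr_eq0 (gt_eqF x0) /= => /eqP.
  have [k kP] := ltr_add_invr ay; exists k => //; exists y.
  by rewrite normrZ normrV ?unitfE ?gt_eqF// normr_id mulVf ?gt_eqF//; move: kP; rewrite add0r.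
apply: bigcup_countable => // k _; apply: finite_set_countable.
apply: contrapT => /infiniteP/card_le_typeE[u ui uA].
have /choice[x xP] : forall j, exists x : X, `|x| <= 1 /\ k.+1%:R^-1 < `|a (u j) x| :> R by move=> j; exact: uA.
(* So many atoms of size above the inverse of [k.+1] would exceed the norm of [mu]. *)
pose N := (Num.truncn (`|mu| * k.+1%:R)).+1.
have NM : `|mu| < N%:R / k.+1%:R.
  rewrite ltr_pdivlMr// /N; have /andP[] := @truncn_itv _ (`|mu| * k.+1%:R) (mulr_ge0 (normr_ge0 _) (ler0n _ _)).
  by [].
have PU : ProperFilter U by exact: ultra_proper.
pose P0 i : seq (W i) := [seq (u (val j) i).1 | j <- enum 'I_N].
have Tu j : T (u j).
  apply: contrapT => nT; have [_] := xP j.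
  suff -> : a (u j) (x j) = 0 by rewrite normr0 ltNge invr_ge0 ler0n.
  apply: (cvg_unique _ (@aU (u j) (x j))) => //.
  rewrite (_ : (fun P => _) = fun=> 0); first exact: cvg_cst.
  apply/funext => P; rewrite /cellE; case: pselect => // _; exact: dual0.
have [P [P0P Pa]] : exists P, refines P0 P /\
    forall j : 'I_N, k.+1%:R^-1 < `|mu (cellE P (u (val j)) (x (val j)))| :> R.
  have H : forall r : seq 'I_N, U [set P | forall j, j \in r -> k.+1%:R^-1 < `|mu (cellE P (u (val j)) (x (val j)))| :> R].
    elim=> [|j r IH]; first by apply: filterE => P j.
    have c : (fun P => `|mu (cellE P (u (val j)) (x (val j)))|) @ U --> `|a (u (val j)) (x (val j))|.
      by apply: cvg_norm; exact: aU.
    have c2 := cvgr_gt _ c _ (proj2 (xP (val j))).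
    have FU : Filter U by exact: (@filter_filter _ _ PU).
    move: (@filterI _ U FU _ _ (c2 FU) IH); apply: filterS => P /= [Pj Pr] i; rewrite inE => /orP[/eqP -> //|].
    exact: Pr.
  have [P [P0P Pa]] := filter_ex (filterI (UP P0) (H (enum 'I_N))).
  by exists P; split => // j; apply: Pa; rewrite mem_enum.
pose sgn j : R := Num.sg (mu (cellE P (u j) (x j))).
pose g := \sum_(j < N) sgn (val j) *: cellE P (u (val j)) (x (val j)).
have gE t : g t = \sum_(j < N) sgn (val j) *: (cellE P (u (val j)) (x (val j)) t).
  rewrite /g; elim/big_rec2: _ => // j y1 y2 _ yE.
  by rewrite funOfDE yE.
have cellI t (j j' : 'I_N) : cell le P (u (val j)) t -> cell le P (u (val j')) t -> j = j'.
  move=> cj cj'; apply/val_inj/ui; apply: functional_extensionality_dep => i.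
  have [l1 s1] := same_trans (cj i) (same_sym (cj' i)).
  rewrite (surjective_pairing (u (val j) i)) (surjective_pairing (u (val j') i)) l1.
  congr pair; move: s1; case: ifP => // _ [s1 _].
  have Pj (h : 'I_N) : (u (val h) i).1 \in P i.
    by apply: P0P; apply/mapP; exists h; rewrite ?mem_enum.
  apply: (wo_eq (wo i)); first by rewrite s1 ?Pj// (wo_refl (wo i)).
  by rewrite -s1 ?Pj// (wo_refl (wo i)).
have g1 : `|g| <= 1.
  apply: E_norm_le => // t; rewrite gE.
  have [[j cj]|nj] := pselect (exists j : 'I_N, cell le P (u (val j)) t).
    rewrite (bigD1 j)//= big1 => [|j' j'j]; last first.
      rewrite cellEE// /restr asboolF ?scaler0// => cj'.
      by move: j'j; rewrite (cellI _ _ _ cj' cj) eqxx.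
    rewrite addr0 cellEE// /restr asboolT// normrZ.
    rewrite -[leRHS]mulr1 ler_pM//; last by have [] := xP (val j).
    by rewrite /sgn normr_sg; case: (_ == _).
  rewrite big1 ?normr0// => j _; rewrite cellEE// /restr asboolF ?scaler0// => cj.
  by apply: nj; exists j.
have muZ b e : mu (b *: e) = b * mu e.
  have := dual_linear mu b e 0; rewrite addr0 dual0 [in RHS]addr0 => ->; exact: erefl.
have : mu g <= `|mu|.
  rewrite (le_trans (ler_norm _))// (le_trans (dual_bound _ _))//.
  by rewrite ler_piMr.
apply/negP; rewrite -ltNge; apply: (lt_le_trans NM).
rewrite /g dual_sum (eq_bigr (fun j : 'I_N => `|mu (cellE P (u (val j)) (x (val j)))|)); last first.
  by move=> j _; rewrite muZ /sgn -normrEsg.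
rewrite (@le_trans _ _ (\sum_(j < N) k.+1%:R^-1))//.
  by rewrite big_const_ord iter_addr_0 mulr_natl.
by apply: ler_sum => j _; exact: ltW.
Qed.

End Fixed.
End Atoms.

(** * The space Delta as a function space *)

(** Cofinality at least [kappa] from below. For infinite [kappa], the empty [D] excludes the least
    point and singletons exclude successors. *)
Definition uncountably_cofinal (kappa : Type) {W : eqType} (le : rel W) (p : W) :=
  forall D : set W, (forall d, D d -> ~~ le p d) -> card_lt D [set: kappa] ->
    exists s, ~~ le p s /\ forall d, D d -> ~~ le s d.

(** [r] sends a point to the least element above it of the closure of [D] with the top added.
    Closedness makes it pull cuts back to cuts; below a [p] of cofinality at least [kappa], [D]
    stays away from [p], so two cuts determine the fibre of [p]. *)
Lemma retraction {W : eqType} (le : rel W) (wo : well_order le) (kappa : Type)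
    (D : set W) : card_lt D [set: kappa] ->
  exists r : W -> W, [/\ forall d, D d -> r d = d,
    forall p, exists Q : seq W, forall y y', (forall q, q \in Q -> le y q = le y' q) ->
      le (r y) p = le (r y') p &
    forall p, uncountably_cofinal kappa le p -> exists Q : seq W, forall y y',
      (forall q, q \in Q -> le y q = le y' q) -> (r y == p) = (r y' == p)].
Proof.
move=> Dk.
pose lim z := forall s, ~~ le z s -> exists d, [/\ D d, ~~ le d s & ~~ le z d].
pose D' z := [\/ D z, forall y, le y z | lim z].
have /choice[r rP] : forall y, exists z, [/\ D' z, le y z &
    forall z', D' z' -> le y z' -> le z z'].
  move=> y; have [t tP] := wo_top wo y.
  have [|z [[D'z yz] zP]] := wo_min wo (A := [set z | D' z /\ le y z]).
    by exists t; split => //; apply: Or32.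
  by exists z; split => // z' D'z' yz'; apply: zP.
(* [q] is the supremum of the part of [D'] that is at most [p]; it belongs to [D'] because limits
   were included. *)
have cut1 p : exists q, forall y, le (r y) p = le y q.
  have [|q [qub qmin]] := wo_min wo (A := [set z | forall d, D' d -> le d p -> le d z]).
    by exists p.
  have qp : le q p by apply: qmin.
  have D'q : D' q.
    apply: contrapT => nD'q; apply: (nD'q); apply: Or33 => s qs.
    have [d [D'd dp ds]] : exists d, [/\ D' d, le d p & ~~ le d s].
      apply: contrapT => nd; move: qs; rewrite qmin// => d D'd dp.
      by apply: contrapT => /negP ds; apply: nd; exists d.
    have dq := qub _ D'd dp.
    have qd : ~~ le q d by apply/negP => qd; apply: nD'q; rewrite -(wo_eq wo dq qd).
    case: D'd => [Dd|Td|ld]; first by exists d.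
      by exfalso; move: qd; rewrite Td.
    have [d' [Dd' d's dd']] := ld s ds; exists d'; split => //.
    exact: (wo_lt_le_trans wo) dq.
  exists q => y; have [D'r yr rmin] := rP y; apply/idP/idP => [ryp|yq].
    by apply: (wo_trans wo) yr _; exact: qub.
  by apply: (wo_trans wo) qp; exact: rmin.
exists r; split=> [d Dd|p|p pc].
- have [_ dr rmin] := rP d; apply: (wo_eq wo) => //.
  by apply: rmin; [exact: Or31|exact: (wo_refl wo)].
- have [q qP] := cut1 p; exists [:: q] => y y' yy.
  by rewrite !qP yy ?mem_head.
- have [|//|s [ps sP]] := pc [set d | D d /\ ~~ le p d].
  + by move=> d [].
  + by apply: card_le_lt Dk; apply: subset_card_le => d [].
  have D's z : D' z -> ~~ le p z -> le z s.
    case=> [Dz|Tz|lz] pz; last 1 first.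
    - apply/negPn/negP => zs; have [d [Dd ds zd]] := lz s zs.
      have := sP d (conj Dd (wo_lt_trans wo zd pz)).
      by rewrite (wo_nle wo ds).
    - by apply: (wo_nle wo); exact: sP.
    - by move: pz; rewrite Tz.
  have [q qP] := cut1 p; have [q' q'P] := cut1 s.
  (* As [s] bounds all of [D'] below [p], a value of [r] above [s] and at most [p] must be [p]. *)
  have rE y : (r y == p) = le (r y) p && ~~ le (r y) s.
    apply/eqP/andP => [->|[ryp rys]]; first by rewrite (wo_refl wo).
    apply: (wo_eq wo) => //; apply/negPn/negP => pry.
    by have [D'r _ _] := rP y; rewrite D's in rys.
  exists [:: q; q'] => y y' yy; rewrite !rE !qP !q'P.
  by rewrite !yy ?inE ?eqxx ?orbT.
Qed.

Section PreDelta.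
Context {R : realType} {n : nat} {W : 'I_n -> eqType} (le : forall i, rel (W i)).
Hypothesis wo : forall i, well_order (@le i).
Variables (kappa : Type) (kr : regular_cardinal kappa).
Hypothesis ku : ~ countable [set: kappa].
Context {X : completeNormedModType R} (T : set (point W)).
Hypothesis X_mazur : mazur X.
Hypothesis sT : saturated le T.
Variable m : nat.
Hypothesis Tm : forall t i, T t -> ((t i).2 <= m)%N.

Let L i : set (W i) := uncountably_cofinal kappa (@le i).

Local Notation E := (@E_space R n W le X (fun=> set0) T).
Local Notation E' := (@E_space R n W le X L T).

(** Precomposing with retractions in the coordinates with label 0 turns isolated points of Lambda
    into ordinary cuts and leaves [phi] unchanged on [D]. *)
Lemma E_extend (phi : point W -> X) (D : set (point W)) :
  E_mem le L T phi -> card_lt D [set: kappa] -> exists f : E,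
    (forall t, D t -> f t = phi t) /\
    (forall M, (forall t, `|phi t| <= M) -> forall t, `|f t| <= M).
Proof.
move=> [pT [M pM] pc] Dk.
have /dep_choice[r rP] := fun i => retraction (wo i)
   (card_le_lt (card_image_le (fun t : point W => (t i).1) D) Dk).
pose rr (t : point W) : point W := fun i => if (t i).2 == 0%N then (r i (t i).1, 0%N) else t i.
have rr2 t i : (rr t i).2 = (t i).2 by rewrite /rr; case: ifP => // /eqP ->.
have Tr t : T (rr t) -> T t.
  apply: sT => i; split; first by rewrite rr2.
  by rewrite rr2; case: ifP => // l0; rewrite /rr l0.
have cr : E_mem le (fun=> set0) T (phi \o rr).
  split => /=; first by move=> t nT; apply: pT => /Tr.
    by exists M => t.
  move=> i e e0; have [P [pP pP']] := pc i e e0.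
  have [_ r1 r2] := rP i.
  have [Q QP] : exists Q : seq (W i), forall p, p \in P -> forall y y',
      (forall q, q \in Q -> le y q = le y' q) ->
      le (r i y) p = le (r i y') p /\ (L p -> (r i y == p) = (r i y' == p)).
    elim: (P) => [|p P' [Q QP]]; first by exists [::].
    have [Q1 Q1P] := r1 p.
    have [Q2 Q2P] : exists Q2 : seq (W i), forall y y',
      (forall q, q \in Q2 -> le y q = le y' q) -> L p -> (r i y == p) = (r i y' == p).
      have [Lp|nLp] := pselect (L p); last by exists [::].
      by have [Q2 Q2P] := r2 p Lp; exists Q2 => y y' /Q2P.
    exists (Q1 ++ Q2 ++ Q) => p'; rewrite inE => /orP[/eqP -> y y' yy|p'P y y' yy].
      split; first by apply: Q1P => q qQ; apply: yy; rewrite mem_cat qQ.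
      by apply: Q2P => q qQ; apply: yy; rewrite !mem_cat qQ orbT.
    by apply: QP => // q qQ; apply: yy; rewrite !mem_cat qQ !orbT.
  exists (P ++ Q); split=> [t t' tt [l s]|t l tP].
    apply: pP => [j ji|]; first by rewrite /rr tt.
    split; first by rewrite !rr2.
    rewrite rr2; move: s; rewrite /rr -l; case: ifP => //= l0 [s _].
    by split=> p pP0; have [] // := QP p pP0 (t i).1 (t' i).1 _ => q qQ; apply: s; rewrite mem_cat qQ orbT.
  apply: pP'; first by rewrite rr2.
  rewrite /rr (negbTE l); apply: contra tP => tP; by rewrite mem_cat tP.
exists (mkE cr); split=> [t Dt|M' M'P t]; last exact: M'P.
rewrite /=; congr phi; apply: functional_extensionality_dep => i; rewrite /rr.
case: ifP => // /eqP l0; have [rD _ _] := rP i.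
by rewrite rD; [rewrite (surjective_pairing (t i)) l0|exists t].
Qed.

Lemma eval_linear t (x : dual X) : linear (fun f : E => x (f t) : R^o).
Proof. by move=> a f g; rewrite funOfDE funOfZE dual_linear. Qed.

Lemma eval_le t (x : dual X) (f : E) : `|x (f t)| <= `|x| * `|f|.
Proof. by rewrite (le_trans (dual_bound _ _))// ler_wpM2l// E_normP. Qed.

Definition eval_dual t (x : dual X) : dual E := mkdual_le (eval_linear t x) (eval_le t x).

Lemma eval_dual_norm t x : `|eval_dual t x| <= `|x|.
Proof. by apply: dual_norm_le => // f; exact: eval_le. Qed.

(** * Cut conditions for the values of an element of Delta *)

Section Values.
Variables (Phi : bidual E) (phi : point W -> X).
Hypothesis PhiD : pre_Delta kappa Phi.
Hypothesis Phi_phi : forall t (x : dual X), Phi (eval_dual t x) = x (phi t).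

(** Each difference is tested with a norming functional, and one member of [E] answers fewer than
    [kappa] tests; so it inherits any large oscillation of [phi] on that many pairs. *)
Lemma agree_norm {S : Type} (C : set S) (t1 t2 : S -> point W) :
  card_lt C [set: kappa] -> exists f : E, forall c, C c ->
    `|phi (t1 c) - phi (t2 c)| <= `|f (t1 c) - f (t2 c)|.
Proof.
move=> Ck.
have /choice[x xP] : forall c, exists x : dual X,
    x (phi (t1 c) - phi (t2 c)) = `|phi (t1 c) - phi (t2 c)| :> R /\ `|x| <= 1.
  by move=> c; exact: norming_functional.
have [f fP] := PhiD (card_le_lt
  (card_image_le (fun c => eval_dual (t1 c) (x c) - eval_dual (t2 c) (x c)) C) Ck).
exists f => c Cc; have := fP _ (ex_intro2 _ _ c Cc erefl).
rewrite dualB !Phi_phi funOfBE /= -!dualB (proj1 (xP c)) => ->.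
rewrite (le_trans (ler_norm _))// (le_trans (dual_bound _ _))//.
by rewrite ler_piMl//; have [] := xP c.
Qed.

Lemma agree_norm1 {S : Type} (C : set S) (t1 : S -> point W) :
  card_lt C [set: kappa] -> exists f : E, forall c, C c ->
    `|phi (t1 c)| <= `|f (t1 c)|.
Proof.
move=> Ck.
have /choice[x xP] : forall c, exists x : dual X,
    x (phi (t1 c)) = `|phi (t1 c)| :> R /\ `|x| <= 1.
  by move=> c; exact: norming_functional.
have [f fP] := PhiD (card_le_lt
  (card_image_le (fun c => eval_dual (t1 c) (x c)) C) Ck).
exists f => c Cc; have := fP _ (ex_intro2 _ _ c Cc erefl).
rewrite Phi_phi /= (proj1 (xP c)) => ->.
rewrite (le_trans (ler_norm _))// (le_trans (dual_bound _ _))//.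
by rewrite ler_piMl//; have [] := xP c.
Qed.

(** Among infinitely many bad positions a sequence is chosen; by [agree_norm1] one member of [E] is
    large at all of them, against its own c_0 condition. *)
Lemma values_far (i : 'I_n) (e : R) : 0 < e -> exists P : seq (W i), forall t : point W,
  (t i).2 != 0%N -> (t i).1 \notin P -> `|phi t| <= e.
Proof.
move=> e0.
pose B := [set w | exists t : point W, [/\ (t i).2 != 0%N, (t i).1 = w & e < `|phi t|]].
have [/finite_seqP[P BP]|/infiniteP/card_le_typeE[u ui uB]] := pselect (finite_set B).
  exists P => t l tP; rewrite leNgt; apply: contra tP => et.
  have : B (t i).1 by exists t.
  by rewrite BP.
have /choice[t tP] : forall k, exists t : point W, [/\ (t i).2 != 0%N, (t i).1 = u k & e < `|phi t|].
  by move=> k; exact: uB.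
have [|f fP] := @agree_norm1 _ [set: nat] t.
  by apply: countable_card_lt => //; exact: card_lexx.
have [_ _ fc] := E_spaceP f; have [P [_ PP]] := fc i e e0.
have : finite_set [set: nat]; last by move/infinite_nat.
have : [set: nat] #<= [set` P].
  apply: (card_le_type ui) => k; have [l tk et] := tP k.
  apply: contrapT => /= /negP ukP; rewrite -tk in ukP.
  by move: et; rewrite ltNge (le_trans (fP k I))// PP.
by move=> /card_le_finite; apply; exact: finite_seq.
Qed.

(** The cut condition at label 0 on an initial segment only, so that it can be proved by
    well-founded induction on [x]. *)
Definition tame (i : 'I_n) (e : R) (x : W i) := exists P : seq (W i), forall t t' : point W,
  agree_off i t t' -> (t i).2 = 0%N -> le (t i).1 x -> le (t' i).1 x ->
  same le (@L i) P (t i) (t' i) -> `|phi t - phi t'| <= e.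

(** At a first failure [x], a partition that works up to [s], with [s] and [x] added, can fail only
    on pairs above [s]; if [x] is in [L] it is isolated, which keeps both points of the pair below
    it. *)
Lemma wild_pairs (i : 'I_n) (e : R) (x : W i) : 0 <= e ->
  (forall y, ~~ le x y -> tame e y) -> ~ tame e x ->
  (exists s, ~~ le x s) /\
  (forall s, ~~ le x s -> exists t t' : point W, [/\ agree_off i t t',
     (t i).2 = 0%N /\ (t' i).2 = 0%N,
     [/\ ~~ le (t i).1 s, ~~ le (t' i).1 s, le (t i).1 x & le (t' i).1 x],
     L x -> ~~ le x (t i).1 /\ ~~ le x (t' i).1 & e < `|phi t - phi t'|]).
Proof.
move=> e0 ty ntx.
have eqt (t t' : point W) : agree_off i t t' -> (t i).2 = (t' i).2 -> (t i).1 = (t' i).1 ->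
    `|phi t - phi t'| <= e.
  move=> tt l2 l1; rewrite (agree_off_eq tt) ?subrr ?normr0//.
  by rewrite (surjective_pairing (t i)) l1 l2 -surjective_pairing.
split.
  apply: contrapT => ns; apply: ntx; exists [::] => t t' tt l tx tx' [l2 _].
  have lx y : le x y by apply/negPn/negP => xy; apply: ns; exists y.
  apply: eqt => //; apply: (wo_eq (wo i)); last exact: (wo_trans (wo i)) tx' _.
  exact: (wo_trans (wo i)) tx _.
move=> s xs; apply: contrapT => nt; apply: ntx.
have [P PP] := ty s xs; exists (s :: x :: P) => t t' tt l tx tx' st.
have st' : same le (@L i) P (t i) (t' i).
  by apply: same_sub st => // p pP; rewrite !inE pP !orbT.
have [l2] := st; rewrite l eqxx => -[s1 s2].
have [ts|ts] := boolP (le (t i).1 s).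
  by apply: PP => //; rewrite -s1 ?mem_head.
have ts' : ~~ le (t' i).1 s by rewrite -s1 ?mem_head.
rewrite leNgt; apply/negP => ett; apply: nt; exists t, t'; split => //.
  by rewrite -l2.
move=> Lx.
have tt' : ((t i).1 == x) = ((t' i).1 == x) by apply: s2 => //; rewrite !inE eqxx orbT.
have nx : (t i).1 != x.
  apply: contraTneq ett => etx; rewrite -leNgt; apply: eqt => //.
  by rewrite etx; apply/esym/eqP; rewrite -tt' etx.
split; apply/negP => xt.
  by move: nx; rewrite (wo_eq (wo i) tx xt) eqxx.
by move: nx; rewrite tt' (wo_eq (wo i) tx' xt) eqxx.
Qed.

Lemma same0I (i : 'I_n) (P : seq (W i)) (z z' : W i * nat) : z.2 = 0%N -> z'.2 = 0%N ->
  (forall p, p \in P -> le z.1 p = le z'.1 p) -> same le set0 P z z'.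
Proof. by move=> l l' zz; split; [rewrite l l'|rewrite l eqxx; split]. Qed.

Lemma values_tame (i : 'I_n) (e : R) (x : W i) : 0 < e -> tame e x.
Proof.
move=> e0; apply: contrapT => nx.
have [|{nx}y [ny ymin]] := wo_min (wo i) (A := [set y | ~ tame e y]); first by exists x.
have {}ymin z : ~~ le y z -> tame e z.
  by move=> yz; apply: contrapT => nz; move: yz; rewrite ymin.
have [[s0 ys0] wild] := wild_pairs (ltW e0) ymin ny.
(* For cofinality at least [kappa], countably many bad pairs climb to a limit [u] below [y], which
   members of [E] do not isolate. Otherwise bad pairs above a cofinal set of fewer than [kappa]
   points climb to [y]. Either way one member of [E] inherits the oscillation, against its cut
   condition. *)
have [Ly|nLy] := pselect (L y).
  have /choice[F FP] : forall s, exists q : (point W * point W) * W i, ~~ le y s ->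
      [/\ agree_off i q.1.1 q.1.2, (q.1.1 i).2 = 0%N /\ (q.1.2 i).2 = 0%N,
       [/\ ~~ le (q.1.1 i).1 s, ~~ le (q.1.2 i).1 s,
           ~~ le q.2 (q.1.1 i).1 & ~~ le q.2 (q.1.2 i).1],
       ~~ le y q.2 & e < `|phi q.1.1 - phi q.1.2|].
    move=> s; have [ys|nys] := pselect (~~ le y s); last first.
      by have [t [t' _]] := wild s0 ys0; exists ((t, t'), s0).
    have [t [t' [tt l [ts ts' _ _] /(_ Ly)[ty ty'] ett]]] := wild s ys.
    have [||s' [ys' s'P]] := Ly [set (t i).1; (t' i).1].
    - by move=> d [->|->].
    - by apply: countable_card_lt => //; apply: finite_set_countable; exact: finite_set2.
    by exists ((t, t'), s') => _; split => //; split => //; apply: s'P; [left|right].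
  pose s k := iter k (fun s => (F s).2) s0.
  have sy k : ~~ le y (s k) by elim: k => //= k /FP[].
  have [||z [yz zs]] := Ly (range s).
  - by move=> _ [k _ <-].
  - apply: countable_card_lt => //; apply: card_le_trans (card_image_le _ _) _.
    exact: card_lexx.
  have [|u [us umin]] := wo_min (wo i) (A := [set u | forall k, ~~ le u (s k)]).
    by exists z => k; apply: zs; exists k.
  have [|f fP] := @agree_norm _ [set: nat] (fun k => (F (s k)).1.1) (fun k => (F (s k)).1.2).
    by apply: countable_card_lt => //; exact: card_lexx.
  have [_ _ fc] := E_spaceP f; have [P [PP _]] := fc i e e0.
  have [s' [us' _ s'P]] := wo_below (wo i) P (us 0%N).
  have [k s'k] : exists k, le s' (s k).
    apply: contrapT => nk; move: us'; rewrite umin// => k.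
    by apply/negP => s'k; apply: nk; exists k.
  have [tt [l l'] [ts ts' ts1 ts1'] _ ett] := FP _ (sy k).
  move: ett; rewrite ltNge (le_trans (fP k I))// PP//; apply: same0I => // p pP.
  have H (w : W i) : ~~ le w (s k) -> ~~ le (s k.+1) w -> le w p = le u p.
    move=> ws sw; have [up|up] := boolP (le u p).
      apply: (wo_trans (wo i)) up; apply: (wo_nle (wo i)).
      exact: (wo_lt_trans (wo i)) sw (us _).
    apply/negbTE; apply: contra ws => wp.
    by apply: (wo_trans (wo i)) s'k; apply: (wo_trans (wo i)) wp _; exact: s'P.
  by rewrite !H.
have [C [Cy Ck CP]] : exists C : set (W i), [/\ forall d, C d -> ~~ le y d,
    card_lt C [set: kappa] & forall s, ~~ le y s -> exists2 c, C c & le s c].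
  apply: contrapT => nC; apply: nLy => D Dy Dk; apply: contrapT => ns; apply: nC.
  exists D; split => // s ys; apply: contrapT => nc; apply: ns; exists s; split => // d Dd.
  by apply/negP => sd; apply: nc; exists d.
have /choice[F FP] : forall s, exists q : point W * point W, ~~ le y s ->
      [/\ agree_off i q.1 q.2, (q.1 i).2 = 0%N /\ (q.2 i).2 = 0%N,
       [/\ ~~ le (q.1 i).1 s, ~~ le (q.2 i).1 s, le (q.1 i).1 y & le (q.2 i).1 y]
       & e < `|phi q.1 - phi q.2|].
  move=> s; have [ys|nys] := pselect (~~ le y s); last first.
    by have [t [t' _]] := wild s0 ys0; exists (t, t').
  by have [t [t' [tt l lt _ ett]]] := wild s ys; exists (t, t').
have [f fP] := agree_norm (fun k => (F k).1) (fun k => (F k).2) Ck.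
have [_ _ fc] := E_spaceP f; have [P [PP _]] := fc i e e0.
have [s' [ys' _ s'P]] := wo_below (wo i) P ys0.
have [c Cc s'c] := CP s' ys'.
have [tt [l l'] [ts ts' ts1 ts1'] ett] := FP _ (Cy c Cc).
move: ett; rewrite ltNge (le_trans (fP c Cc))// PP//; apply: same0I => // p pP.
have H (w : W i) : ~~ le w c -> le w y -> le w p = le y p.
  move=> wc wy; have [yp|yp] := boolP (le y p); first exact: (wo_trans (wo i)) yp.
  apply/negbTE; apply: contra wc => wp.
  by apply: (wo_trans (wo i)) s'c; apply: (wo_trans (wo i)) wp _; exact: s'P.
by rewrite !H.
Qed.

Lemma values_E_mem : E_mem le L T phi.
Proof.
split.
- move=> t nT; apply: contrapT => /eqP pt.
  have [x [xp _]] := norming_functional (phi t).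
  have : `|phi t| = 0.
    rewrite -xp -Phi_phi (_ : eval_dual t x = 0) ?dual0//.
    apply: funOfP => f /=; have [fT _ _] := E_spaceP f.
    by rewrite fT// dual0.
  by move/eqP; rewrite normr_eq0 (negbTE pt).
- exists `|Phi| => t; have [x [xp x1]] := norming_functional (phi t).
  rewrite -xp -Phi_phi (le_trans (ler_norm _))// (le_trans (dual_bound _ _))//.
  by rewrite ler_piMr// (le_trans (eval_dual_norm _ _)).
- move=> i e e0; have [P PP] := values_far i e0.
  have [[t0 _]|npt] := pselect (exists t : point W, True); last first.
    by exists [::]; split=> [t|t]; exfalso; apply: npt; exists t.
  have [top topP] := wo_top (wo i) (t0 i).1.
  have [P' PP'] := values_tame top e0.
  exists (P ++ P'); split=> [t t' tt s|t l tP]; last first.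
    by apply: PP => //; apply: contra tP => tP; rewrite mem_cat tP.
  have [l0|l0] := eqVneq (t i).2 0%N.
    apply: PP' => //; apply: same_sub s => // p pP'.
    by rewrite mem_cat pP' orbT.
  rewrite (agree_off_eq tt) ?subrr ?normr0 ?(ltW e0)//.
  have [l2] := s; rewrite (negbTE l0) => l1.
  by rewrite (surjective_pairing (t i)) l1 l2 -surjective_pairing.
Qed.

End Values.

(** A weak-star convergent sequence and its limit give countably many tests at [t], answered by a
    single [f]; so the functional is weak-star sequentially continuous and the Mazur property yields
    the value. *)
Lemma pre_Delta_values (Phi : bidual E) : pre_Delta kappa Phi ->
  exists phi : point W -> X, forall t (x : dual X), Phi (eval_dual t x) = x (phi t).
Proof.
move=> PhiD; suff /choice[phi phiP] : forall t, exists v : X, forall x : dual X,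
    Phi (eval_dual t x) = x v by exists phi.
move=> t.
have lx : linear (fun x : dual X => Phi (eval_dual t x) : R^o).
  move=> a x y; rewrite -dual_linear; congr (Phi _).
  exact: funOfP.
have lb (x : dual X) : `|Phi (eval_dual t x)| <= `|Phi| * `|x|.
  by rewrite (le_trans (dual_bound _ _))// ler_wpM2l// eval_dual_norm.
have [|v vP] := @X_mazur (mkdual_le lx lb).
  move=> u y uy.
  have [|f fP] := PhiD ([set eval_dual t y] `|` range (fun k => eval_dual t (u k))).
    apply: countable_card_lt => //; apply: countableU; first exact: countable1.
    by apply: card_le_trans (card_image_le _ _) _; exact: card_lexx.
  rewrite [X in _ --> X](_ : _ = y (f t)); last by apply: fP; left.
  rewrite (_ : (fun k => _) = fun k => u k (f t)); first exact: uy.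
  by apply/funext => k; apply: fP; right; exists k.
by exists v => x; have /(congr1 (fun h : bidual X => h x)) := vP.
Qed.

Lemma dual_support (mu : dual E) : exists a : point W -> dual X,
  countable [set t | exists x, a t x <> 0] /\
  forall f : E, (forall t, T t -> a t (f t) = 0) -> mu f = 0.
Proof.
have [U [a [UU UP aU]]] := atoms sT mu.
exists a; split; first exact: atoms_countable UP aU.
by move=> f; exact: (atomless_eq0 wo Tm UU UP aU).
Qed.

(* A bidual functional in [pre_Delta] is determined by its values on evaluations,
   and [mu] only sees countably many points, on which phi agrees with a member of [E]. *)
Lemma bidual_of_values : exists H : E' -> bidual E, [/\ linear H,
  forall phi, `|H phi| = `|phi|,
  forall phi, pre_Delta kappa (H phi),
  forall Phi, pre_Delta kappa Phi -> exists phi, H phi = Phi &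
  forall (phi : E') (f : E), (forall t, phi t = f t) -> H phi = bidual_emb f].
Proof.
have /choice[a aP] := dual_support.
pose D mu := [set t | exists x, a mu t x <> 0].
have Dc mu : countable (D mu) by have [] := aP mu.
have D0 mu (f g : E) : (forall t, D mu t -> f t = g t) -> mu f = mu g.
  move=> fg; apply/eqP; rewrite -subr_eq0 -dualB; apply/eqP.
  have [_ aP'] := aP mu; apply: aP' => t _.
  apply: contrapT => nz; have Dt : D mu t by exists ((f - g) t).
  by apply: nz; rewrite funOfBE fg// subrr dual0.
have ext (phi : E') (A : set (dual E)) : card_lt A [set: kappa] -> exists f : E,
    (forall mu t, A mu -> D mu t -> f t = phi t) /\ `|f| <= `|phi|.
  move=> Ak; have Bk := bigcup_card_lt kr ku Ak (fun mu _ => Dc mu).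
  have [f [fP fM]] := E_extend (E_spaceP phi) Bk.
  exists f; split=> [mu t Amu Dt|]; first by apply: fP; exists mu.
  by apply: E_norm_le => // t; apply: fM => t'; exact: E_normP.
have fin (A : set (dual E)) : finite_set A -> card_lt A [set: kappa].
  by move=> fA; apply: countable_card_lt => //; exact: finite_set_countable.
(* [h] is the common value of [mu] on all members of [E] that agree with [phi] on the countable
   support of [mu]. *)
have /choice[h hP] : forall q : E' * dual E, exists v : R,
    forall f : E, (forall t, D q.2 t -> f t = q.1 t) -> q.2 f = v.
  move=> [phi mu]; have [f [fP _]] := ext phi [set mu] (fin _ (finite_set1 _)).
  by exists (mu f) => g gP; apply: D0 => t Dt; rewrite gP//= (fP mu).
have hl phi : linear (fun mu => h (phi, mu) : R^o).
  move=> b mu nu.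
  have [f [fP _]] := ext phi _ (fin _ (finite_set3 mu nu (b *: mu + nu))).
  have hE k : [set mu; nu; b *: mu + nu] k -> h (phi, k) = k f.
    by move=> kA; apply/esym/(hP (phi, k)) => t Dt; exact: (fP k).
  by rewrite !hE//; [left; right|left; left|right].
have hb phi mu : `|h (phi, mu)| <= `|phi| * `|mu|.
  have [f [fP fM]] := ext phi _ (fin _ (finite_set1 mu)).
  rewrite -(hP (phi, mu) f) => [|t Dt]; last exact: (fP mu).
  by rewrite mulrC (le_trans (dual_bound _ _))// ler_wpM2l.
pose H phi : bidual E := mkdual_le (hl phi) (hb phi).
have HE (phi : E') mu (f : E) : (forall t, D mu t -> f t = phi t) -> H phi mu = mu f.
  by move=> fphi; apply/esym/(hP (phi, mu)).
have Hev (phi : E') t x : H phi (eval_dual t x) = x (phi t).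
  have Bk : card_lt (D (eval_dual t x) `|` [set t]) [set: kappa].
    by apply: countable_card_lt => //; apply: countableU => //; exact: countable1.
  have [f [fP _]] := E_extend (E_spaceP phi) Bk.
  rewrite (HE _ _ f) => [|t' Dt']; last by apply: fP; left.
  by rewrite /= fP//; right.
exists H; split.
- move=> b phi psi; apply: funOfP => mu.
  have [f [fP _]] := ext phi _ (fin _ (finite_set1 mu)).
  have [g [gP _]] := ext psi _ (fin _ (finite_set1 mu)).
  rewrite funOfDE funOfZE (HE phi mu f) => [|t Dt]; last exact: (fP mu).
  rewrite (HE psi mu g) => [|t Dt]; last exact: (gP mu).
  rewrite -dual_linear; apply: HE => t Dt.
  by rewrite !funOfDE !funOfZE (fP mu)// (gP mu).
- move=> phi; apply/eqP; rewrite eq_le; apply/andP; split.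
    by apply: dual_norm_le => // mu; exact: hb.
  apply: E_norm_le => // t; have [x [xp x1]] := norming_functional (phi t).
  rewrite -xp -Hev (le_trans (ler_norm _))// (le_trans (dual_bound _ _))//.
  by rewrite ler_piMr// (le_trans (eval_dual_norm _ _)).
- move=> phi A Ak; have [f [fP _]] := ext phi A Ak.
  by exists f => mu Amu; apply: HE => t Dt; exact: (fP mu).
- move=> Phi PhiD; have [phi Pp] := pre_Delta_values PhiD.
  have phiE := values_E_mem PhiD Pp.
  exists (mkE phiE); apply: funOfP => mu.
  (* Testing [Phi] on [mu] together with its atoms gives an [f] on which every atom takes the same
     value as on [phi]; this determines the value of [mu]. *)
  have [|f fP] := PhiD ([set mu] `|` (fun t => eval_dual t (a mu t)) @` D mu).
    apply: countable_card_lt => //; apply: countableU; first exact: countable1.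
    exact: card_le_trans (card_image_le _ _) (Dc mu).
  have [g [gP _]] := ext (mkE phiE) _ (fin _ (finite_set1 mu)).
  rewrite (HE _ _ g) => [|t Dt]; last exact: (gP mu).
  rewrite (fP mu); last by left.
  apply/eqP; rewrite -subr_eq0 -dualB; apply/eqP.
  have [_ aP'] := aP mu; apply: aP' => t _.
  have [Dt|nDt] := pselect (D mu t); last first.
    by apply: contrapT => nz; apply: nDt; exists ((g - f) t).
  have := fP _ (or_intror (ex_intro2 _ _ t Dt erefl)).
  by rewrite funOfBE dualB (gP mu)// Pp /= => ->; rewrite subrr.
- by move=> phi f pf; apply: funOfP => mu; exact: HE.
Qed.

End PreDelta.

(** * Splitting off jumps, one coordinate at a time *)

Section Splitting.
Context {R : realType} {n : nat} {W : 'I_n -> eqType} (le : forall i, rel (W i)).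
Hypothesis wo : forall i, well_order (@le i).
Variable (kappa : Type).
Hypothesis ku : ~ countable [set: kappa].
Context {X : completeNormedModType R}.

Let L i : set (W i) := uncountably_cofinal kappa (@le i).

(* After [m] steps the labels are at most [m] and each of 1, ..., [m] occurs; the
   coordinates in [s] may moreover carry the label [m.+1]. *)
Definition stage m (s : seq 'I_n) : set (point W) :=
  [set t | [/\ forall i, ((t i).2 <= m)%N \/ ((t i).2 = m.+1 /\ i \in s),
     forall i, (t i).2 != 0%N -> L (t i).1 &
     forall j, (0 < j <= m)%N -> exists i, (t i).2 = j]].

(** In a coordinate of [s] the jumps are already recorded under label [m.+1], so its label 0 part
    needs no isolated points. *)
Definition isolated (s : seq 'I_n) i : set (W i) := if i \in s then set0 else @L i.

Local Notation F s m := (E_mem le (X := X) (isolated s) (stage m s)).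

Lemma dfwithK (t : point W) k z z' : t k = z' -> dfwith (dfwith t k z) k z' = t.
Proof.
move=> tk; apply: functional_extensionality_dep => i; case: dfwithP => // j kj.
by rewrite dfwithout.
Qed.

Lemma dfwith_id (t : point W) k z : t k = z -> dfwith t k z = t.
Proof. by move=> tk; apply: functional_extensionality_dep => i; case: dfwithP. Qed.

Lemma agree_off_dfwith i k (t t' : point W) z : i != k -> agree_off i t t' ->
  agree_off i (dfwith t k z) (dfwith t' k z).
Proof.
move=> ik tt j ji; have [->|jk] := eqVneq j k; first by rewrite !dfwithin.
by rewrite !dfwithout 1?eq_sym//; exact: tt.
Qed.

Lemma agree_off_dfwith2 k (t : point W) z z' : agree_off k (dfwith t k z) (dfwith t k z').
Proof. by move=> j jk; rewrite !dfwithout// eq_sym. Qed.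

Lemma agree_off_dfwith1 k (t : point W) z : agree_off k t (dfwith t k z).
Proof. by move=> j jk; rewrite dfwithout// eq_sym. Qed.

Lemma agree_off_dfwith3 k (t t' : point W) z z' : agree_off k t t' ->
  agree_off k (dfwith t k z) (dfwith t' k z').
Proof. by move=> tt j jk; rewrite !dfwithout 1?eq_sym//; exact: tt. Qed.

Section Theta.
Variables (m : nat) (k : 'I_n).

(** Inverse of the splitting in coordinate [k]: label [m.+1] holds the jumps at points of Lambda,
    and [theta] adds them back to the part with label 0. In this direction linearity is
    immediate. *)
Definition theta (psi : point W -> X) (t : point W) : X :=
  if (t k).2 == m.+1 then 0
  else if ((t k).2 == 0%N) && `[< L (t k).1 >]
    then psi t + psi (dfwith t k ((t k).1, m.+1))
  else psi t.

Lemma theta_linear (a : R) f g t :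
  theta (fun t => a *: f t + g t) t = a *: theta f t + theta g t.
Proof.
rewrite /theta; case: ifP => _; first by rewrite scaler0 addr0.
by case: ifP => _ //; rewrite scalerDr addrACA.
Qed.

Lemma theta_le psi (M : R) : 0 <= M -> (forall t, `|psi t| <= M) ->
  forall t, `|theta psi t| <= 2 * M.
Proof.
move=> M0 pM t; have M2 : M <= 2 * M by rewrite ler_peMl// ler1n.
rewrite /theta; case: ifP => _; first by rewrite normr0 mulr_ge0.
case: ifP => _; last exact: le_trans (pM t) M2.
by rewrite (le_trans (ler_normD _ _))// mulr2n mulrDl mul1r lerD.
Qed.

Variable s : seq 'I_n.
Hypothesis ks : k \notin s.

Lemma isolated_neq i : i != k -> @isolated (k :: s) i = @isolated s i.
Proof. by move=> ik; rewrite /isolated inE (negbTE ik). Qed.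

Lemma isolatedk : @isolated (k :: s) k = set0.
Proof. by rewrite /isolated mem_head. Qed.

Lemma isolatedkN : @isolated s k = @L k.
Proof. by rewrite /isolated (negbTE ks). Qed.

Lemma stage_cons t : (t k).2 != m.+1 -> stage m (k :: s) t -> stage m s t.
Proof.
move=> tk [t1 t2 t3]; split => // i; case: (t1 i) => [|[ti]]; first by left.
rewrite inE => /orP[/eqP ik|]; last by right.
by move: tk; rewrite -ik ti eqxx.
Qed.

Lemma stage_consW t : stage m s t -> stage m (k :: s) t.
Proof.
move=> [t1 t2 t3]; split => // i; case: (t1 i) => [|[ti si]]; first by left.
by right; rewrite inE si orbT.
Qed.

Lemma stage_lower t a : (t k).2 = m.+1 -> stage m (k :: s) t ->
  stage m s (dfwith t k (a, 0%N)).
Proof.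
move=> tk [t1 t2 t3]; split=> [i|i|j jm].
- case: dfwithP => [|i' ki]; first by left.
  case: (t1 i') => [|[ti]]; first by left.
  by rewrite inE eq_sym (negbTE ki) => si; right.
- by case: dfwithP => [//|i' _]; exact: t2.
- have [i ij] := t3 j jm; exists i; rewrite dfwithout//.
  by apply: contraTneq jm => ki; rewrite -ij -ki tk ltnn andbF.
Qed.

Lemma stage_raise t : (t k).2 = 0%N -> stage m (k :: s) (dfwith t k ((t k).1, m.+1)) ->
  stage m s t.
Proof.
move=> tk st; have := @stage_lower _ (t k).1 _ st; rewrite dfwithin => /(_ erefl).
by rewrite dfwithK// -tk -surjective_pairing.
Qed.

Lemma stage_raiseW t : (t k).2 = m.+1 -> L (t k).1 ->
  stage m s (dfwith t k ((t k).1, 0%N)) -> stage m (k :: s) t.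
Proof.
move=> tk Lt [t1 t2 t3]; split=> [i|i|j jm].
- have [->|ik] := eqVneq i k; first by right; rewrite tk mem_head.
  have := t1 i; rewrite dfwithout 1?eq_sym// => -[|[ti si]]; first by left.
  by right; rewrite inE si orbT.
- have [->//|ik] := eqVneq i k.
  by have := t2 i; rewrite dfwithout 1?eq_sym.
- have [i] := t3 j jm; case: dfwithP => [j0|i' _ ij]; last by exists i'.
  by move: jm; rewrite -j0.
Qed.

Lemma theta_mem psi : F (k :: s) m psi -> F s m (theta psi).
Proof.
move=> [pT [M pM] pc]; split.
- move=> t nT; rewrite /theta; case: ifPn => // tk.
  have pt : psi t = 0 by apply: pT => /(stage_cons tk).
  by case: ifP => // /andP[/eqP t0 _]; rewrite pt add0r pT// => /(stage_raise t0).
- by exists (2 * `|M|); apply: theta_le => // t; rewrite (le_trans (pM t))// ler_norm.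
- move=> i e e0; have e30 : 0 < e / 3 by rewrite divr_gt0.
  have e3 : e = e / 3 + (e / 3 + e / 3) by field.
  have e23 : e / 3 + e / 3 <= e by rewrite [leRHS]e3 lerDr ltW.
  have e13 : e / 3 <= e by apply: le_trans e23; rewrite lerDr ltW.
  have [P [PP PP']] := pc i _ e30; exists P.
  have [ik|ik] := eqVneq i k.
    move: P PP PP'; rewrite ik isolatedk => P PP PP'; split=> [t t' tt st|t tk tP].
      rewrite isolatedkN in st.
      have [abs|tt'] := eqVneq (t k) (t' k).
        by rewrite (agree_off_eq tt abs) subrr normr0 ltW.
      have [l2 l1] := st; move: l1; case: ifP => [/eqP l0 [s1 s2]|_ l1]; last first.
        by move: tt'; rewrite (surjective_pairing (t k)) l1 l2 -surjective_pairing eqxx.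
      have ptt : `|psi t - psi t'| <= e / 3.
        by apply: PP => //; apply: same_sub st => //; exact: sub0set.
      have t12 : ((t k).1 == (t' k).1) = false.
        apply: contraNF tt' => /eqP l1.
        by rewrite (surjective_pairing (t k)) l1 l2 -surjective_pairing.
      (* Of two distinct points in one cell, one that lies in [L] is not in [P], where it would be
         isolated; so the jump added there is small. *)
      have far (u : point W) : (L (u k).1 -> (u k).1 \notin P) ->
          `|(if `[< L (u k).1 >] then psi (dfwith u k ((u k).1, m.+1)) else 0)| <= e / 3.
        move=> uP; case: asboolP => [Lu|_]; last by rewrite normr0 ltW.
        by apply: PP'; rewrite dfwithin//; exact: uP.
      have thE (u : point W) : (u k).2 = 0%N -> theta psi u = psi u +
          (if `[< L (u k).1 >] then psi (dfwith u k ((u k).1, m.+1)) else 0).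
        by move=> u0; rewrite /theta u0 /=; case: ifP => //; rewrite addr0.
      rewrite !thE -?l2// opprD addrACA (le_trans (ler_normD _ _))// [leRHS]e3.
      rewrite lerD// (le_trans (ler_normB _ _))// lerD//; apply: far => Lt.
        by apply/negP => /s2/(_ Lt); rewrite eqxx eq_sym t12.
      by apply/negP => /s2/(_ Lt); rewrite eqxx t12.
    rewrite /theta (negbTE tk) /=; case: ifP => _; first by rewrite normr0 ltW.
    by rewrite (le_trans _ e13)// PP'.
  split=> [t t' tt st|t ti tP].
    have st' : same le (@isolated (k :: s) i) P (t i) (t' i) by rewrite isolated_neq.
    have tk : t k = t' k by apply: tt; rewrite eq_sym.
    have ptt : `|psi t - psi t'| <= e / 3 by exact: PP.
    rewrite /theta -tk; case: ifP => _; first by rewrite subrr normr0 ltW.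
    case: ifP => _; last exact: le_trans e13.
    rewrite opprD addrACA (le_trans (ler_normD _ _))// (le_trans _ e23)// lerD//.
    apply: PP; first by apply: agree_off_dfwith.
    by rewrite !dfwithout// eq_sym.
  have pt : `|psi t| <= e / 3 by exact: PP'.
  rewrite /theta; case: ifP => _; first by rewrite normr0 ltW.
  case: ifP => _; last exact: le_trans e13.
  rewrite (le_trans (ler_normD _ _))// (le_trans _ e23)// lerD//.
  by apply: PP'; rewrite dfwithout// eq_sym.
Qed.

Lemma cofinal_lt (x : W k) (D : set (W k)) : L x -> (forall d, D d -> ~~ le x d) ->
  countable D -> exists y, ~~ le x y /\ forall d, D d -> ~~ le y d.
Proof. by move=> Lx Dx Dc; apply: Lx => //; exact: countable_card_lt. Qed.

(** Just left of a point of [L] there are points outside the finite list, where the jump part is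
    small. So [theta psi] bounds the label 0 part there and, by left continuity, at the point. The
    jump is a difference of the two, whence the factor 2. *)
Lemma theta_lower psi (M : R) : F (k :: s) m psi -> 0 <= M ->
  (forall t, `|theta psi t| <= M) -> forall t, `|psi t| <= 2 * M.
Proof.
move=> [pT _ pc] M0 tM.
have M2 : M <= 2 * M by rewrite ler_peMl// ler1n.
have c0 t : (t k).2 = 0%N -> `|psi t| <= M.
  move=> t0; have := tM t; rewrite /theta t0 /=; case: asboolP => // Lt _.
  apply/ler_addgt0Pl => e e0; have e20 : 0 < e / 2 by rewrite divr_gt0.
  have [P [PP PP']] := pc k _ e20; rewrite isolatedk in PP.
  have [||s0 [ts0 _]] := cofinal_lt Lt (D := set0) => //.
  have [s1 [ts1 _ s1P]] := wo_below (wo k) P ts0.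
  have [||s2 [ts2 s2P]] := cofinal_lt Lt (D := [set s1]).
  - by move=> _ ->.
  - exact: countable1.
  have s12 := s2P s1 erefl.
  pose u := dfwith t k (s2, 0%N).
  have tu : `|psi t - psi u| <= e / 2.
    apply: PP; first exact: agree_off_dfwith1.
    rewrite /u dfwithin; split => //; rewrite t0 eqxx; split => // p pP /=.
    have [tp|tp] := boolP (le (t k).1 p).
      by apply/esym; apply: (wo_trans (wo k)) tp; exact: (wo_nle (wo k)).
    apply/esym/negbTE; apply: contra s12 => s2p.
    by apply: (wo_trans (wo k)) s2p _; exact: s1P.
  have uP : s2 \notin P.
    by apply: contra s12 => s2P'; exact: s1P.
  rewrite -(subrK (psi u) (psi t)) (le_trans (ler_normD _ _))//.
  have ue : `|psi u| <= M + e / 2.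
    have := tM u; rewrite /theta /u dfwithin /=; case: asboolP => [Ls|_ uM]; last first.
      by rewrite (le_trans uM)// lerDl ltW.
    pose v := dfwith u k (s2, m.+1); rewrite -/u -/v => uM.
    have ve : `|psi v| <= e / 2 by apply: PP'; rewrite /v dfwithin.
    rewrite -(addrK (psi v) (psi _)) (le_trans (ler_normB _ _))//.
    by rewrite lerD.
  by rewrite (le_trans (lerD tu ue))//; lra.
move=> t; have [tk|tk] := eqVneq (t k).2 m.+1; last first.
  have [t0|t0] := eqVneq (t k).2 0%N; first exact: le_trans (c0 _ t0) M2.
  by have := tM t; rewrite /theta (negbTE tk) (negbTE t0) /= => /le_trans; apply.
have [Lt|nLt] := pselect (L (t k).1); last first.
  rewrite pT ?normr0 ?mulr_ge0// => -[_ /(_ k)].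
  by rewrite tk => /(_ isT).
pose u := dfwith t k ((t k).1, 0%N).
have := tM u; rewrite /theta /u dfwithin /= asboolT//= dfwithK; last first.
  by rewrite -tk -surjective_pairing.
move=> uM; rewrite -(addKr (psi u) (psi t)) (le_trans (ler_normD _ _))// normrN.
by rewrite mulr2n mulrDl mul1r lerD// c0// /u dfwithin.
Qed.

(* Uncountable cofinality makes the left limits at [L] eventually attained. *)
Lemma left_limits phi : F s m phi -> exists sg : W k -> W k, forall a, L a ->
  ~~ le a (sg a) /\ forall b, ~~ le a b -> le (sg a) b ->
    forall t, phi (dfwith t k (b, 0%N)) = phi (dfwith t k (sg a, 0%N)).
Proof.
move=> [pT _ pc]; suff /choice[sg sgP] : forall a, exists s, L a ->
    ~~ le a s /\ forall b, ~~ le a b -> le s b ->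
      forall t, phi (dfwith t k (b, 0%N)) = phi (dfwith t k (s, 0%N)) by exists sg.
move=> a; have [La|nLa] := pselect (L a); last by exists a.
have /choice[P PP] : forall l : nat, exists P : seq (W k), cut_by le (isolated s) phi l.+1%:R^-1 P.
  by move=> l; apply: pc; rewrite invr_gt0.
(* The points below [a] in all partitions [P l] are countably many, hence bounded strictly below
   [a]; from [s1] on, no partition separates points below [a]. *)
have [||s1 [as1 s1P]] := cofinal_lt La (D := \bigcup_l [set p | p \in P l /\ ~~ le a p]).
- by move=> d [l _ []].
- apply: bigcup_countable => // l _; apply: finite_set_countable.
  by apply: sub_finite_set (finite_seq (P l)) => p [].
exists s1 => _; split => // b ab s1b t; apply/eqP; rewrite -subr_eq0 -normr_le0.
apply/ler_addgt0Pl => e e0; rewrite addr0.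
have [l le_] := ltr_add_invr e0; rewrite add0r in le_.
apply: le_trans (ltW le_); have [+ _] := PP l; apply; first exact: agree_off_dfwith2.
rewrite !dfwithin; split => //; rewrite eqxx /=.
have lt c p : ~~ le a c -> le s1 c -> p \in P l -> le c p = le a p /\ (c == p) = false \/ a = p.
  move=> ac sc pP; have [ap|ap] := boolP (le a p).
    have cp : le c p by apply: (wo_trans (wo k)) ap; exact: (wo_nle (wo k)).
    left; split; first by rewrite cp.
    by apply: (wo_ltNeq (wo k)); exact: (wo_lt_le_trans (wo k)) ap.
  have ps : ~~ le s1 p by apply: s1P; exists l.
  have pc' : ~~ le c p := wo_lt_le_trans (wo k) ps sc.
  by left; split; [rewrite (negbTE pc')|rewrite eq_sym (wo_ltNeq (wo k) pc')].
have lep c p : ~~ le a c -> le s1 c -> p \in P l -> le c p = le a p /\ (c == p) = false.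
  move=> ac sc pP; have [//|ap] := lt c p ac sc pP; rewrite -ap; split.
    by rewrite (wo_refl (wo k)); exact: (wo_nle (wo k)).
  exact: (wo_ltNeq (wo k)).
split=> p pP.
  by rewrite (lep b p ab s1b pP).1 (lep s1 p as1 (wo_refl (wo k) _) pP).1.
by rewrite (lep b p ab s1b pP).2 (lep s1 p as1 (wo_refl (wo k) _) pP).2.
Qed.

Lemma theta_surj phi : F s m phi ->
  exists2 psi, F (k :: s) m psi & forall t, theta psi t = phi t.
Proof.
move=> Fphi; have [sg sgP] := left_limits Fphi.
move: Fphi => [pT [M pM] pc].
(* At points of [L], label 0 takes the left limit of [phi], attained at [sg], and label [m.+1] takes
   the jump. *)
pose psi (t : point W) := if (t k).2 == m.+1 then
    (if `[< L (t k).1 >] then phi (dfwith t k ((t k).1, 0%N)) - phi (dfwith t k (sg (t k).1, 0%N)) else 0)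
  else if ((t k).2 == 0%N) && `[< L (t k).1 >] then phi (dfwith t k (sg (t k).1, 0%N))
  else phi t.
have stage0 (t : point W) a b : stage m s (dfwith t k (a, 0%N)) -> stage m s (dfwith t k (b, 0%N)).
  move=> [t1 t2 t3]; split=> [i|i|j jm].
  - by have := t1 i; have [->|ik] := eqVneq i k; rewrite ?dfwithin// !dfwithout// eq_sym.
  - by have := t2 i; have [->|ik] := eqVneq i k; rewrite ?dfwithin// !dfwithout// eq_sym.
  - have [i ij] := t3 j jm; exists i; move: ij; have [->|ik] := eqVneq i k.
      by rewrite !dfwithin.
    by rewrite !dfwithout// eq_sym.
have stageE (t : point W) : (t k).2 = 0%N -> dfwith t k ((t k).1, 0%N) = t.
  by move=> t0; rewrite dfwith_id// -t0 -surjective_pairing.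
have nk (t : point W) : (t k).2 = m.+1 -> ~ stage m s t.
  by move=> tk [/(_ k)]; rewrite tk ltnn (negbTE ks) => -[|[]].
exists psi; last first.
  move=> t; rewrite /theta; case: ifPn => [/eqP tk|tk]; first by rewrite pT//; exact: nk.
  case: ifP => [/andP[/eqP t0 Lt]|tL]; last by rewrite /psi (negbTE tk) tL.
  have -> : psi t = phi (dfwith t k (sg (t k).1, 0%N)).
    by rewrite /psi (negbTE tk) t0 /= Lt.
  have -> : psi (dfwith t k ((t k).1, m.+1)) = phi t - phi (dfwith t k (sg (t k).1, 0%N)).
    have dE z : dfwith (dfwith t k ((t k).1, m.+1)) k z = dfwith t k z.
      apply: functional_extensionality_dep => i.
      by case: dfwithP => [|j kj]; rewrite ?dfwithin// !dfwithout.
    by rewrite /psi !dfwithin /= eqxx Lt !dE stageE.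
  by rewrite addrC subrK.
split.
- move=> t nT; rewrite /psi; case: ifPn => [/eqP tk|tk].
    case: asboolP => // Lt.
    have n0 a : phi (dfwith t k (a, 0%N)) = 0.
      by apply: pT => /(@stage0 t a (t k).1); exact: contra_not (@stage_raiseW t tk Lt) nT.
    by rewrite !n0 subrr.
  have nT' : ~ stage m s t by move/stage_consW.
  case: ifP => [/andP[/eqP t0 _]|_]; last exact: pT.
  by apply: pT => /(@stage0 t _ (t k).1); rewrite stageE.
- exists (`|M| + `|M|) => t.
  have pM' u : `|phi u| <= `|M| by rewrite (le_trans (pM u))// ler_norm.
  have pM2 u : `|phi u| <= `|M| + `|M| by rewrite (le_trans (pM' u))// lerDl.
  rewrite /psi; case: ifP => _; last by case: ifP.
  case: ifP => _; last by rewrite normr0 addr_ge0.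
  by rewrite (le_trans (ler_normB _ _))// lerD.
- move=> i e e0; have e20 : 0 < e / 2 by rewrite divr_gt0.
  have e2e : e / 2 <= e by rewrite ler_piMr ?(ltW e0)// invf_le1// ler1n.
  have [P [PP PP']] := pc i _ e20; exists P.
  have [ik|ik] := eqVneq i k; last first.
    split=> [t t' tt st|t ti tP].
      have st' : same le (@isolated s i) P (t i) (t' i) by rewrite -isolated_neq.
      have tk : t k = t' k by apply: tt; rewrite eq_sym.
      have dP z : `|phi (dfwith t k z) - phi (dfwith t' k z)| <= e / 2.
        apply: PP; first exact: agree_off_dfwith.
        by rewrite !dfwithout// eq_sym.
      rewrite /psi -tk; case: ifP => _; last first.
        by case: ifP => _; [exact: le_trans (dP _) e2e|exact: le_trans (PP _ _ tt st') e2e].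
      case: ifP => _; last by rewrite subrr normr0 ltW.
      rewrite opprD opprK addrACA (le_trans (ler_normD _ _))// [leRHS]splitr.
      by rewrite lerD ?dP// addrC distrC dP.
    have dP z : `|phi (dfwith t k z)| <= e / 2 by apply: PP'; rewrite dfwithout// eq_sym.
    rewrite /psi; case: ifP => _; last first.
      by case: ifP => _; [exact: le_trans (dP _) e2e|exact: le_trans (PP' _ ti tP) e2e].
    case: ifP => _; last by rewrite normr0 ltW.
    by rewrite (le_trans (ler_normB _ _))// [leRHS]splitr lerD.
  move: P PP PP'; rewrite ik => P PP PP'.
  (* [phi] may be evaluated arbitrarily close to the left of [a]. *)
  have near a : L a -> exists b, [/\ ~~ le a b, le (sg a) b &
      forall p, p \in P -> (le b p = le a p) /\ (b == p) = false].
    move=> La; have [asg _] := sgP a La.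
    have [s1 [as1 sgs1 s1P]] := wo_below (wo k) P asg.
    have [||s2 [as2 s2P]] := cofinal_lt La (D := [set s1]).
    - by move=> _ ->.
    - exact: countable1.
    have s12 := s2P s1 erefl.
    exists s2; split => // [|p pP].
      by apply: (wo_trans (wo k)) sgs1 _; exact: (wo_nle (wo k)).
    have [ap|ap] := boolP (le a p).
      have s2p : le s2 p by apply: (wo_trans (wo k)) ap; exact: (wo_nle (wo k)).
      by split; [rewrite s2p|apply: (wo_ltNeq (wo k)); exact: (wo_lt_le_trans (wo k)) ap].
    have ps1 : le p s1 by exact: s1P.
    have ps2 : ~~ le s2 p by exact: (wo_le_lt_trans (wo k)) s12.
    by split; [exact/negbTE|rewrite eq_sym; exact: (wo_ltNeq (wo k))].
  split=> [t t' tt st|t tk tP].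
    have [abs|tt'] := eqVneq (t k) (t' k).
      by rewrite (agree_off_eq tt abs) subrr normr0 ltW.
    rewrite isolatedk in st; have [l2 l1] := st; move: l1.
    case: ifP => [/eqP l0 [s1 _]|_ l1]; last first.
      by move: tt'; rewrite (surjective_pairing (t k)) l1 l2 -surjective_pairing eqxx.
    (* Every value of [psi] at label 0 is a value of [phi] at some [b] on the same side of all cuts
       and distinct from the isolated points in [P], so the cut condition of [phi] applies. *)
    have psiE (u : point W) : (u k).2 = 0%N -> exists b,
        psi u = phi (dfwith u k (b, 0%N)) /\ forall p, p \in P ->
          (le b p = le (u k).1 p) /\ (L p -> (b == p) = false).
      move=> u0; rewrite /psi u0 /=; case: asboolP => [Lu|nLu].
        have [b [ub sb bP]] := near _ Lu; exists b; split.
          by have [_ /(_ b ub sb) ->] := sgP _ Lu.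
        by move=> p pP; have [bp1 bp2] := bP p pP.
      exists (u k).1; rewrite stageE//; split => // p pP; split => // Lp.
      by apply/negP => /eqP up; apply: nLu; rewrite up.
    have [b [-> bP]] := psiE t l0; have [|b' [-> bP']] := psiE t'; first by rewrite -l2.
    apply: le_trans e2e; apply: PP; first exact: agree_off_dfwith3.
    rewrite !dfwithin; split => //; rewrite eqxx; split=> p pP /=.
      by rewrite (bP p pP).1 (bP' p pP).1 s1.
    by rewrite isolatedkN => Lp; rewrite ((bP p pP).2 Lp) ((bP' p pP).2 Lp).
  rewrite /psi (negbTE tk) /=; case: ifP => _; last exact: le_trans (PP' _ tk tP) e2e.
  case: asboolP => [Lt|_]; last by rewrite normr0 ltW.
  have [b [tb sb bP]] := near _ Lt.
  have [_ /(_ b tb sb) <-] := sgP _ Lt.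
  apply: le_trans e2e; apply: PP; first exact: agree_off_dfwith2.
  rewrite !dfwithin; split => //; rewrite eqxx; split=> p pP /=.
    by rewrite (bP p pP).1.
  move=> _; rewrite (bP p pP).2; apply/negbTE.
  by apply: contra tP => /eqP ->.
Qed.

(** A member of E_m has no part with label [m.+1], so the canonical copy of E_m passes through the
    splitting unchanged. *)
Lemma theta_fixed psi : (forall t, ~ stage m [::] t -> psi t = 0) ->
  forall t, theta psi t = psi t.
Proof.
move=> pT t; rewrite /theta; case: ifPn => [/eqP tk|_].
  by rewrite pT// => -[/(_ k)]; rewrite tk ltnn => -[|[]].
case: ifP => // _; rewrite [X in _ + X]pT ?addr0// => -[/(_ k)].
by rewrite dfwithin /= ltnn => -[|[]].
Qed.

End Theta.

Fixpoint Theta m (s : seq 'I_n) (psi : point W -> X) : point W -> X :=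
  if s is k :: s' then Theta m s' (theta m k psi) else psi.

Lemma Theta_linear m s (a : R) f g t :
  Theta m s (fun t => a *: f t + g t) t = a *: Theta m s f t + Theta m s g t.
Proof.
elim: s f g => //= k s IH f g; rewrite -IH; congr (Theta m s _ t).
by apply/funext => u; exact: theta_linear.
Qed.

Lemma Theta_le m s psi (M : R) : 0 <= M -> (forall t, `|psi t| <= M) ->
  forall t, `|Theta m s psi t| <= 2 ^+ size s * M.
Proof.
move=> M0; elim: s psi M M0 => [|k s IH] psi M M0 pM t /=; first by rewrite expr0 mul1r.
rewrite exprSr -mulrA; apply: IH; first by rewrite mulr_ge0.
by move=> u; exact: theta_le.
Qed.

Lemma Theta_mem m s psi : uniq s -> F s m psi -> F [::] m (Theta m s psi).
Proof.
by elim: s psi => //= k s IH psi /andP[ks us] Fp; apply: IH => //; exact: theta_mem.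
Qed.

Lemma Theta_lower m s psi (M : R) : uniq s -> F s m psi -> 0 <= M ->
  (forall t, `|Theta m s psi t| <= M) -> forall t, `|psi t| <= 2 ^+ size s * M.
Proof.
move=> + + M0; elim: s psi => [|k s IH] psi /=; first by rewrite expr0 mul1r.
move=> /andP[ks us] Fp tM t; rewrite exprS -mulrA.
apply: (theta_lower Fp); first by rewrite mulr_ge0// exprn_ge0.
by apply: IH => //; exact: theta_mem.
Qed.

Lemma Theta_surj m s phi : uniq s -> F [::] m phi ->
  exists2 psi, F s m psi & forall t, Theta m s psi t = phi t.
Proof.
elim: s => [|k s IH] /=; first by exists phi.
move=> /andP[ks us] Fp; have [psi Fpsi psiE] := IH us Fp.
have [psi' Fpsi' psiE'] := theta_surj ks Fpsi.
exists psi' => // t; rewrite -psiE; congr (Theta m s _ t).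
exact/funext.
Qed.

Lemma Theta_fixed m s psi : (forall t, ~ stage m [::] t -> psi t = 0) ->
  forall t, Theta m s psi t = psi t.
Proof.
move=> pT; elim: s => //= k s IH t.
by rewrite (_ : theta m k psi = psi)//; apply/funext => u; exact: theta_fixed.
Qed.

End Splitting.

(** * One application of S *)

Section Iteration.
Context {R : realType} {n : nat} {W : 'I_n -> eqType} (le : forall i, rel (W i)).
Hypothesis wo : forall i, well_order (@le i).
Variables (kappa : Type) (kr : regular_cardinal kappa).
Hypothesis ku : ~ countable [set: kappa].
Context {X : completeNormedModType R}.
Hypothesis X_mazur : mazur X.

Let L i : set (W i) := uncountably_cofinal kappa (@le i).
Local Notation stage := (stage le kappa).
Local Notation E m := (@E_space R n W le X (fun=> set0) (stage m [::])).
Local Notation E' m := (@E_space R n W le X L (stage m [::])).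

Lemma stage_saturated m : saturated le (stage m [::]).
Proof.
move=> t t' tt [t1 t2 t3]; split=> [i|i l|j jm].
- by have [<- _] := tt i.
- have [l2 l1] := tt i; rewrite -l2 in l; have := t2 i l.
  by move: l1; rewrite (negbTE l) => ->.
- by have [i <-] := t3 j jm; exists i; have [->] := tt i.
Qed.

Lemma stage_label m t i : stage m [::] t -> ((t i).2 <= m)%N.
Proof. by move=> [/(_ i)[//|[]]]. Qed.

Lemma stageS_full m t : stage m.+1 [::] t -> stage m (enum 'I_n) t.
Proof.
move=> [t1 t2 t3]; split=> [i|//|j /andP[j0 jm]]; last first.
  by apply: t3; rewrite j0 ltnW.
have [|[]//] := t1 i; rewrite leq_eqVlt => /orP[/eqP ->|]; last by left.
by right; rewrite mem_enum.
Qed.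

Lemma stage_full m t : stage m [::] t -> stage m (enum 'I_n) t.
Proof. by move=> [t1 t2 t3]; split => // i; case: (t1 i) => [|[]//]; left. Qed.

Lemma full_stage m t : stage m (enum 'I_n) t -> stage m [::] t \/ stage m.+1 [::] t.
Proof.
move=> [t1 t2 t3]; have [[i im]|ni] := pselect (exists i, (t i).2 = m.+1).
  right; split => // [k|j /andP[j0]]; first by left; case: (t1 k) => [/leqW|[->]].
  rewrite leq_eqVlt => /orP[/eqP ->|jm]; first by exists i.
  by apply: t3; rewrite j0.
left; split => // i; left; case: (t1 i) => [//|[im _]].
by exfalso; apply: ni; exists i.
Qed.

Lemma stageS_disjoint m t : stage m.+1 [::] t -> ~ stage m [::] t.
Proof.
move=> [_ _ /(_ m.+1)]; rewrite ltnS leqnn => /(_ isT)[i im] /stage_label -/(_ i).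
by rewrite im ltnn.
Qed.

(** [H] identifies Delta with functions, which [Theta] over all coordinates splits into a part on
    stage [m], the canonical copy, and a part on stage [m.+1], its complement. [Y] is given only up
    to isomorphism so that the step can be repeated. *)
Theorem S_lt_stage m (Y : completeNormedModType R) :
  isomorphic Y (E m) -> isomorphic (S_lt kappa Y) (E m.+1).
Proof.
move=> YE; apply: isomorphic_sym.
have [H [Hl Hn HD Hs He]] := bidual_of_values wo kr ku X_mazur (@stage_saturated m)
  (fun t i => @stage_label m t i).
pose s := enum 'I_n; have us : uniq s := enum_uniq _.
have Fs (psi : point W -> X) T : (forall t, T t -> stage m s t) ->
    E_mem le (fun=> set0) T psi -> E_mem le (isolated le kappa s) (stage m s) psi.
  by move=> Ts; apply: E_mem_sub => // i; exact: sub0set.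
have Th (z : E m.+1) : E_mem le L (stage m [::]) (Theta le kappa m s z).
  by apply: Theta_mem => //; apply: Fs (E_spaceP z); exact: stageS_full.
have E'f (f : E m) : E_mem le L (stage m [::]) f.
  by apply: E_mem_sub (E_spaceP f) => // i; exact: sub0set.
have Tf (f : E m) t : Theta le kappa m s f t = f t.
  by apply: Theta_fixed => t' nt; have [fT _ _] := E_spaceP f; exact: fT.
have HDl (phi psi : E' m) : H (phi + psi) = H phi + H psi.
  by rewrite -[phi]scale1r Hl !scale1r.
pose C : R := 2 ^+ size s; have C0 : 0 <= C by rewrite exprn_ge0.
have gE (z : E m.+1) (f : E m) (phi : E' m) :
    (forall t, phi t = Theta le kappa m s (fun t => z t + f t) t) ->
    H phi = H (mkE (Th z)) + bidual_emb f.
  move=> phiE; rewrite -(He (mkE (E'f f)) f)// -HDl; congr (H _); apply: funOfP => t.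
  rewrite phiE funOfDE /= -(Tf f t).
  have := Theta_linear le kappa m s 1 z f t; rewrite scale1r => <-.
  by congr (Theta _ _ _ _ _ t); apply/funext => u; rewrite scale1r.
apply: (@S_lt_isomorphic_transport _ kappa (E m) Y (E m.+1) (fun z => H (mkE (Th z))) C C) => //.
- move=> a x y; rewrite -Hl; congr (H _); apply: funOfP => t.
  rewrite funOfDE funOfZE /= -(Theta_linear le kappa m s a x y t).
  by congr (Theta _ _ _ _ _ t); apply/funext.
- by move=> z; apply: subset_closure; exact: HD.
- move=> z; rewrite Hn; apply: E_norm_le => [|t]; first by rewrite mulr_ge0.
  by rewrite /= Theta_le// => u; exact: E_normP.
- move=> z f.
  pose phi := mkE (Th z) + mkE (E'f f).
  have phiE t : phi t = Theta le kappa m s (fun t => z t + f t) t.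
    rewrite /phi funOfDE /= -(Tf f t).
    have := Theta_linear le kappa m s 1 z f t; rewrite scale1r => <-.
    by congr (Theta _ _ _ _ _ t); apply/funext => u; rewrite scale1r.
  rewrite -(gE z f phi phiE) Hn; apply: E_norm_le => [|t]; first by rewrite mulr_ge0.
  have [zT _ _] := E_spaceP z; have [fT _ _] := E_spaceP f.
  have [st|nst] := pselect (stage m.+1 [::] t); last by rewrite zT// normr0 mulr_ge0.
  (* The supports of [z] and [f] are disjoint, so the sum bounds [z]. *)
  have -> : z t = z t + f t by rewrite fT ?addr0//; exact: stageS_disjoint.
  have Fzf : E_mem le (isolated le kappa s) (stage m s) (fun t => z t + f t).
    have -> : (fun t => z t + f t) = fun t => 1 *: z t + f t.
      by apply/funext => u; rewrite scale1r.
    apply: E_memL; first by apply: Fs (E_spaceP z); exact: stageS_full.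
    by apply: Fs (E_spaceP f); exact: stage_full.
  apply: (Theta_lower wo ku us Fzf) => // u; rewrite -phiE.
  exact: E_normP.
- move=> v vD.
  have /(_ v vD)/Hs[phi <-] : closed (@pre_Delta R kappa (E m)).
    apply: (@bounded_linear_closure _ _ _ H 1) => // [v' /Hs[phi <-]|phi|phi].
    + by exists phi.
    + by rewrite mul1r Hn.
    + by rewrite mul1r Hn.
  have [psi Fpsi psiE] := Theta_surj wo ku us (E_spaceP phi).
  (* With all coordinates in [s] no point is isolated any more, so truncation to either of the two
     disjoint stages stays in the required space. *)
  have cut0 T : saturated le T -> E_mem le (fun=> set0) T (restr T psi).
    move=> sT; apply: (@E_mem_restr _ _ _ _ _ _ (stage m s) T T (fun=> [::])) => //.
    apply: E_mem_sub Fpsi => // i; rewrite /isolated mem_enum; exact: subset_refl.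
  have e1 := cut0 _ (@stage_saturated m.+1); have e0 := cut0 _ (@stage_saturated m).
  exists (mkE e1), (mkE e0); apply: gE => t; rewrite -psiE.
  congr (Theta _ _ _ _ _ t); apply/funext => u /=; rewrite /restr.
  case: asboolP => [u1|nu1].
    by rewrite asboolF ?addr0//; exact: stageS_disjoint.
  case: asboolP => [_|nu0]; rewrite ?add0r//.
  have [pT _ _] := Fpsi; apply: pT => /full_stage[]//.
Qed.

Corollary S_iter_stage m (Y : completeNormedModType R) :
  isomorphic Y (E 0) -> isomorphic (S_iter kappa m Y) (E m).
Proof. by move=> YE; elim: m => // m IH; exact: S_lt_stage. Qed.

End Iteration.

(** * Compact trees as compact well-orders *)

Section TreeTopology.
Context {d : Order.disp_t} (K : porderType d) (tK : is_tree K).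
Local Notation T := (interval_space K).
Implicit Types x y z s t : K.

Lemma tree_comparable x y t : (x <= t)%O -> (y <= t)%O -> (x <= y)%O || (y <= x)%O.
Proof.
rewrite !le_eqVlt => /orP[/eqP ->|xt] /orP[/eqP ->|yt].
- by rewrite eqxx.
- by rewrite yt !orbT.
- by rewrite xt orbT.
- have := wochoice.wo_chainW (@tK t) (x := x) (y := y); rewrite -!le_eqVlt; apply => //.
Qed.

(** The tree axiom well orders only the strict predecessors of [t], so a set reduced to [t] is
    treated apart. *)
Lemma tree_min (A : set K) t : A !=set0 -> (forall x, A x -> (x <= t)%O) ->
  exists x, A x /\ forall y, A y -> (x <= y)%O.
Proof.
move=> [x0 Ax0] At.
have [[x1 [Ax1 x1t]]|nA] := pselect (exists x, A x /\ (x < t)%O); last first.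
  have At' x : A x -> x = t.
    move=> Ax; have := At x Ax; rewrite le_eqVlt => /orP[/eqP //|xt].
    by exfalso; apply: nA; exists x.
  by exists x0; split => // y Ay; rewrite (At' x0)// (At' y).
have [||x [[xA xmin] _]] := @tK t [pred x : K | `[< A x >] && (x < t)%O].
- by move=> x; rewrite !inE => /andP[].
- by exists x1; rewrite inE x1t andbT; apply/asboolP.
move: xA; rewrite inE => /andP[/asboolP Ax xt]; exists x; split => // y Ay.
have := At y Ay; rewrite le_eqVlt => /orP[/eqP ->|yt]; first exact: ltW.
by apply: xmin; rewrite inE yt andbT; apply/asboolP.
Qed.

Lemma open_subbase (V : set T) : interval_subbase V -> open V.
Proof.
move=> VD; exists [set V]; last by rewrite bigcup_set1.
move=> _ ->; exists [fset V]%fset; first by move=> U /fset1P ->; apply: mem_set.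
apply/seteqP; split=> [y|y Vy U /= /fset1P -> //].
by apply; apply/fset1P.
Qed.

Lemma open_oc s t : open ([set y | (s < y <= t)%O] : set T).
Proof.
apply: open_subbase; left; exists s, t; by apply/seteqP; split=> y /=; rewrite in_itv.
Qed.

Lemma open_minimal x : (forall y, ~ (y < x)%O) -> open ([set x] : set T).
Proof. by move=> xmin; apply: open_subbase; right; exists x. Qed.

Lemma tree_nbhs x (U : set T) : nbhs (x : T) U ->
  (exists2 s, (s < x)%O & forall y, (s < y <= x)%O -> U y) \/
  ((forall y, ~ (y < x)%O) /\ U x).
Proof.
move=> xU; have [[s0 s0x]|xmin] := pselect (exists s, (s < x)%O); last first.
  by right; split; [move=> y yx; apply: xmin; exists y|exact: (nbhs_singleton xU)].
left; move: xU; rewrite nbhsE => -[B [[D DI <-] [A DA Ax] BU]].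
have [D' D'D AE] := DI _ DA.
suff [s sx sA] : exists2 s, (s < x)%O & forall y, (s < y <= x)%O -> A y.
  by exists s => // y sy; apply: BU; exists A => //; exact: sA.
have [s sx sP] : exists2 s, (s < x)%O & forall V, V \in (D' : seq _) ->
    forall y, (s < y <= x)%O -> V y.
  have : forall V, V \in (D' : seq _) -> interval_subbase V /\ V x.
    move=> V VD'; split; first by apply: set_mem; exact: D'D.
    by move: Ax; rewrite -AE; apply.
  elim: (D' : seq _) => [_|V r IH rP]; first by exists s0.
  have [|s sx sP] := IH; first by move=> V' V'r; apply: rP; rewrite inE V'r orbT.
  have [VB Vx] := rP V (mem_head _ _).
  have [[s' [t VE]]|[x' x'min VE]] := VB; last first.
    by move: Vx; rewrite VE /= => xx; rewrite -xx in x'min; case: (x'min s).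
  have [s'x xt] : (s' < x)%O /\ (x <= t)%O.
    by move: Vx; rewrite VE /= in_itv => /andP[].
  have V'P y : (s' < y <= x)%O -> V y.
    by move=> /andP[s'y yx]; rewrite VE /= in_itv /= s'y (le_trans yx).
  have /orP[ss'|s's] := tree_comparable (ltW sx) (ltW s'x).
    exists s' => // V'; rewrite inE => /orP[/eqP -> //|V'r] y /andP[s'y yx].
    by apply: (sP V' V'r); rewrite yx (le_lt_trans ss').
  exists s => // V'; rewrite inE => /orP[/eqP -> y /andP[sy yx]|V'r y].
    by apply: V'P; rewrite yx (le_lt_trans s's).
  exact: sP.
by exists s => // y sy; rewrite -AE => V VD'; exact: (sP V VD').
Qed.

Lemma open_down t : open ([set y | (y <= t)%O] : set T).
Proof.
rewrite openE => y yt; rewrite /interior.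
have [[s sy]|ymin] := pselect (exists s, (s < y)%O).
  apply: (filterS _ (open_nbhs_nbhs (conj (open_oc s y) _))) => [z /= /andP[_ zy]|].
    exact: le_trans yt.
  by rewrite /= sy lexx.
apply: (filterS _ (open_nbhs_nbhs (conj (@open_minimal y _) _))) => [z /= -> //||//].
by move=> z zy; apply: ymin; exists z.
Qed.

(** A point [z] of the closure that is not below [t] is a limit whose predecessors all lie below
    [t]. The least [z'] at most [t] above all of them is a limit of the same chain, so
    neighbourhoods of [z] and [z'] meet. *)
Lemma closed_down (hK : hausdorff_space T) t : closed ([set y | (y <= t)%O] : set T).
Proof.
move=> z zt; apply: contrapT => /negP nzt.
have zc s : (s < z)%O -> exists y, [/\ (s < y)%O, (y <= z)%O & (y <= t)%O].
  move=> sz; have [|y [/= yt /andP[sy yz]]] := zt [set y | (s < y <= z)%O].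
    by apply: open_nbhs_nbhs; split; [exact: open_oc|rewrite /= sz lexx].
  by exists y.
have ct s : (s < z)%O -> (s < t)%O.
  by move=> /zc[y [sy _ yt]]; exact: lt_le_trans yt.
have [[s0 s0z]|zmin] := pselect (exists s, (s < z)%O); last first.
  have [|y [/= yt yz]] := zt [set z].
    apply: open_nbhs_nbhs; split => //; apply: open_minimal => y yz.
    by apply: zmin; exists y.
  by move: nzt; rewrite -yz yt.
have zc' s : (s < z)%O -> exists2 y, (s < y)%O & (y < z)%O.
  move=> /zc[y [sy yz yt]]; exists y => //; rewrite lt_neqAle yz andbT.
  by apply: contraNneq nzt => <-.
have [|x /= /andP[_ //]|z' [/andP[/asboolP z'P z't] z'min]] :=
    @tree_min [set y | `[< forall s, (s < z)%O -> (s < y)%O >] && (y <= t)%O] t.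
- by exists t; rewrite /= lexx andbT; apply/asboolP.
have zz' : z <> z' by move=> zz'; move: nzt; rewrite zz' z't.
apply: zz'; apply: hK => A B zA z'B.
have [[s1 s1z s1A]|[zmin _]] := tree_nbhs zA; last by case: (zmin _ s0z).
have [[s2 s2z s2B]|[zmin _]] := tree_nbhs z'B; last by case: (zmin _ (z'P _ s0z)).
have [s3 s3z s23] : exists2 s, (s < z)%O & (s2 <= s)%O.
  apply: contrapT => ns; suff : (z' <= s2)%O by rewrite lt_geF.
  apply: z'min; rewrite /= (le_trans (ltW s2z) z't) andbT; apply/asboolP => s sz.
  have /orP[ss|ss] := tree_comparable (ltW (ct _ sz)) (le_trans (ltW s2z) z't).
    rewrite lt_neqAle ss andbT; apply/negP => /eqP ss2; apply: ns.
    by exists s => //; rewrite ss2.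
  by exfalso; apply: ns; exists s.
have [s [sz s13 s33]] : exists s, [/\ (s < z)%O, (s1 <= s)%O & (s3 <= s)%O].
  have /orP[ss|ss] := tree_comparable (ltW s1z) (ltW s3z); first by exists s3.
  by exists s1.
have [y sy yz] := zc' s sz; exists y; split.
  by apply: s1A; rewrite (le_lt_trans s13)// ltW.
by apply: s2B; rewrite (le_lt_trans (le_trans s23 s33))// ltW// z'P.
Qed.

End TreeTopology.

(** Initial segments are clopen and finitely many cuts fit inside any neighbourhood: the topology is
    the one generated by the cuts used in [same]. *)
Record ordering {T : topologicalType} (le : rel T) : Prop := Ordering {
  ord_wo : well_order le;
  ord_open : forall p, open [set y | le y p];
  ord_closed : forall p, closed [set y | le y p];
  ord_nbhs : forall x U, nbhs x U -> exists P : seq T,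
    forall y, (forall p, p \in P -> le y p = le x p) -> U y }.

(* A compact tree is a finite union of chains [y <= t]; listing the chains one
   after the other turns it into a compact well-ordered space. *)
Lemma tree_ordering (K : compactTree) : exists le : rel (tree_space K), ordering le.
Proof.
have tK := @ct_tree K; have hK := @ct_hausdorff K.
have [ts tsP] : exists ts : seq K, forall y, has (fun t => (y <= t)%O) ts.
  have [[x0 _]|nK] := pselect (exists x : tree_space K, True); last first.
    by exists [::] => y; exfalso; apply: nK; exists y.
  pose pK : ptopologicalType := HB.pack (Topological.sort (tree_space K)) (isPointed.Build (tree_space K) x0).
  have : compact [set: pK] := @ct_compact K.
  rewrite compact_cover => /(_ (tree_space K) setT (fun t => [set y : K | (y <= t)%O])).
  case=> [t _|y _|D _ cD]; first exact: open_down.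
    by exists y => //=.
  exists (enum_fset D) => y; have [t tD yt] := cD y I.
  by apply/hasP; exists t.
pose idx (y : K) := find (fun t => (y <= t)%O) ts.
pose le (y z : tree_space K) := (idx y < idx z)%N || ((idx y == idx z) && (y <= z :> K)%O).
have yt (x0 y : K) : (y <= nth x0 ts (idx y))%O by have := nth_find x0 (tsP y).
have idx_nth (x0 y : K) j : (y <= nth x0 ts j)%O -> (idx y <= j)%N.
  by rewrite leqNgt => yj; apply/negP => /(before_find x0); rewrite yj.
have idx_le y z : (y <= z)%O -> (idx y <= idx z)%N.
  by move=> yz; apply: (idx_nth z); apply: le_trans yz _; exact: yt.
(* An initial segment of [le] is a finite union of down-sets of the tree, hence clopen. *)
have leE y p : le y p = has (fun t => (y <= t)%O) (p :: take (idx p) ts).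
  rewrite /= has_take// /le.
  have [yp|yp|yp] := ltngtP (idx y) (idx p) => //=; rewrite ?orbF ?orbT//.
  by apply/esym/negP => /idx_le; rewrite leqNgt yp.
have cmp (y z : K) : idx y = idx z -> (y <= z)%O || (z <= y)%O.
  by move=> yz; apply: (tree_comparable tK (yt y y)); rewrite yz; exact: yt.
have lele (y z : K) : (y <= z)%O -> le y z by rewrite leE /= => ->.
have has_open l : open ([set y : tree_space K | has (fun t => (y <= t :> K)%O) l]).
  elim: l => [|t l IH] /=; first by rewrite (_ : [set _ | _] = set0); [exact: open0|apply/seteqP; split].
  have -> : [set y : tree_space K | (y <= t :> K)%O || has (fun t => (y <= t :> K)%O) l] =
      [set y : tree_space K | (y <= t :> K)%O] `|` [set y : tree_space K | has (fun t => (y <= t :> K)%O) l].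
    by apply/seteqP; split=> y /= => [/orP|] // [] ->; rewrite ?orbT.
  by apply: openU => //; exact: open_down.
have has_closed l : closed ([set y : tree_space K | has (fun t => (y <= t :> K)%O) l]).
  elim: l => [|t l IH] /=; first by rewrite (_ : [set _ | _] = set0); [exact: closed0|apply/seteqP; split].
  have -> : [set y : tree_space K | (y <= t :> K)%O || has (fun t => (y <= t :> K)%O) l] =
      [set y : tree_space K | (y <= t :> K)%O] `|` [set y : tree_space K | has (fun t => (y <= t :> K)%O) l].
    by apply/seteqP; split=> y /= => [/orP|] // [] ->; rewrite ?orbT.
  by apply: closedU => //; exact: closed_down.
exists le; split.
- split.
  + move=> y z; rewrite /le; case: ltngtP => //= yz; exact: cmp.
  + move=> y z; rewrite /le => /andP[]; case: ltngtP => //= _ yz zy.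
    by apply/le_anti; rewrite yz zy.
  + move=> y x z; rewrite /le => /orP[xy|/andP[/eqP xy lxy]] /orP[yz|/andP[/eqP yz lyz]].
    * by rewrite (ltn_trans xy yz).
    * by rewrite -yz xy.
    * by rewrite xy yz.
    * by rewrite xy yz eqxx (le_trans lxy lyz) orbT.
  + move=> A [x0 Ax0].
    have [|j /asboolP[x [Ax xj]] jmin] := @ex_minnP (fun j => `[< exists x, A x /\ idx x = j >]).
      by exists (idx x0); apply/asboolP; exists x0.
    have [||y [[Ay yj] ymin]] := @tree_min _ _ tK [set y | A y /\ idx y = j] (nth x ts j).
    * by exists x.
    * by move=> y [_ <-]; exact: yt.
    exists y; split => // z Az; rewrite /le yj.
    have : (j <= idx z)%N by apply: jmin; apply/asboolP; exists z.
    rewrite leq_eqVlt => /orP[/eqP jz|->//].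
    by rewrite jz eqxx ymin ?orbT.
  + move=> x0.
    (* The greatest element is the top of the last chain that contributes new points. *)
    have [||j /asboolP[x xj] jmax] := @ex_maxnP (fun j => `[< exists x : K, idx x = j >]) (size ts).
    * by exists (idx x0); apply/asboolP; exists x0.
    * by move=> j /asboolP[x <-]; exact: find_size.
    have jt : idx (nth x ts j) = j.
      apply/eqP; rewrite eqn_leq; apply/andP; split; first exact: (idx_nth x).
      by rewrite -{1}xj; apply: idx_le; rewrite -xj; exact: yt.
    exists (nth x ts j) => z; rewrite /le jt.
    have : (idx z <= j)%N by apply: jmax; apply/asboolP; exists z.
    rewrite leq_eqVlt => /orP[/eqP zj|->//].
    by rewrite zj eqxx -[in nth _ _ _]zj yt orbT.
- move=> p; rewrite (_ : [set _ | _] = [set y : tree_space K | has (fun t => (y <= t :> K)%O) (p :: take (idx p) ts)]).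
    exact: has_open.
  by apply/seteqP; split=> y /=; rewrite leE.
- move=> p; rewrite (_ : [set _ | _] = [set y : tree_space K | has (fun t => (y <= t :> K)%O) (p :: take (idx p) ts)]).
    exact: has_closed.
  by apply/seteqP; split=> y /=; rewrite leE.
- move=> x U xU.
  (* Agreeing with [x] on the tops of the earlier chains keeps [y] out of them, and agreeing on [x]
     itself puts [y] below [x] in the same chain. *)
  have below (P : seq K) (y : K) : (forall p, p \in x :: take (idx x) ts ++ P -> le y p = le x p) ->
      idx y = idx x /\ (y <= x)%O.
    move=> yP; have yx : le y x by rewrite yP ?mem_head// lele.
    have yidx : (idx x <= idx y)%N.
      rewrite leqNgt -has_take//; apply/hasP => -[t tx ytt].
      have : le y t by exact: lele.
      rewrite yP; last by rewrite inE mem_cat tx orbT.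
      move: tx => /(nthP x)[i]; rewrite size_take_min ltn_min => /andP[ix _].
      rewrite nth_take// => it; rewrite /le.
      have ti : (idx t <= i)%N by apply: (idx_nth x); rewrite it.
      by rewrite gtn_eqF ?(leq_ltn_trans ti)//= orbF ltnNge ltnW ?(leq_ltn_trans ti).
    move: yx; rewrite /le; case: ltngtP yidx => //= yx _; by split.
  have [[s sx sU]|[xmin Ux]] := tree_nbhs tK xU; last first.
    exists (x :: take (idx x) ts ++ [::]) => y /below[_].
    by rewrite le_eqVlt => /orP[/eqP ->//|yx]; case: (xmin y).
  exists (x :: take (idx x) ts ++ [:: s]) => y yP; apply: sU.
  have [yx lyx] := below _ _ yP; rewrite lyx andbT.
  have /orP[ys|sy] := tree_comparable tK lyx (ltW sx).
    have : le y s by exact: lele.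
    rewrite yP; last by rewrite inE mem_cat mem_head !orbT.
    have := idx_le _ _ (ltW sx).
    by rewrite /le; case: ltngtP => //= _ _; rewrite lt_geF.
  rewrite lt_neqAle sy andbT; apply/negP => /eqP ys.
  have : le y s by rewrite ys; exact: lele.
  rewrite yP; last by rewrite inE mem_cat mem_head !orbT.
  have := idx_le _ _ (ltW sx).
  by rewrite /le; case: ltngtP => //= _ _; rewrite lt_geF.
Qed.

(** Intervals ending at [x] and starting in a cofinal set form a local base; conversely the members
    of a local base contain such intervals, whose left ends are cofinal below [x]. *)
Lemma character_cofinal {T : topologicalType} (le : rel T) (kappa : Type) (x : T) :
  ordering le -> ~ countable [set: kappa] ->
  character_ge kappa x <-> uncountably_cofinal kappa le x.
Proof.
move=> [wo lo lc ln] ku.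
have cellN (s : T) : ~~ le x s -> nbhs x [set y | ~~ le y s && le y x].
  move=> xs; apply: open_nbhs_nbhs; split; last by rewrite /= xs (wo_refl wo).
  rewrite (_ : [set _ | _] = ~` [set y | le y s] `&` [set y | le y x]).
    by apply: openI => //; exact: closed_openC.
  by apply/seteqP; split=> y /= => [/andP[/negP]|[/negP -> ->]].
have nbhsU (U : set T) s0 : ~~ le x s0 -> nbhs x U ->
    exists2 s, ~~ le x s & forall y, ~~ le y s && le y x -> U y.
  move=> xs0 /ln[P PU]; have [s [xs _ sP]] := wo_below wo P xs0.
  exists s => // y /andP[ys yx]; apply: PU => p pP.
  have [xp|xp] := boolP (le x p); first exact: (wo_trans wo) xp.
  by apply/negbTE; apply: contra ys => yp; apply: (wo_trans wo) yp _; exact: sP.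
split=> [[B [[Bx Bb] Bmin] kB]|xc].
  move=> D Dx Dk; apply: contrapT => ns.
  (* A least point is isolated, and its local base with one element would make [kappa] countable. *)
  have [[s0 xs0]|xmin] := pselect (exists s, ~~ le x s); last first.
    pose B' := [set [set y | le y x]].
    have B'x : local_base x B'.
      split=> [_ ->|U /ln[P PU]].
        by apply: open_nbhs_nbhs; split => //=; exact: (wo_refl wo).
      exists [set y | le y x] => // y /= yx.
      have -> : y = x.
        apply: (wo_eq wo) => //; apply/negPn/negP => xy.
        by apply: xmin; exists y.
      exact: PU.
    apply: ku; apply: card_le_trans kB _; apply: card_le_trans (Bmin _ B'x) _.
    exact: countable1.
  have cD s : ~~ le x s -> exists2 c, D c & le s c.
    move=> xs; apply: contrapT => nc; apply: ns; exists s; split => // c Dc.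
    by apply/negP => sc; apply: nc; exists c.
  pose B' := (fun c => [set y | ~~ le y c && le y x]) @` D.
  have B'x : local_base x B'.
    split=> [_ [c Dc <-]|U /(nbhsU _ _ xs0)[s xs sU]]; first exact: cellN (Dx c Dc).
    have [c Dc sc] := cD s xs; exists [set y | ~~ le y c && le y x]; first by exists c.
    move=> y /= /andP[yc yx]; apply: sU; rewrite yx andbT.
    by apply: contra yc => ys; exact: (wo_trans wo) sc.
  have /card_ltN := card_le_lt (card_image_le _ _ : B' #<= D) Dk; apply.
  exact: card_le_trans kB (Bmin _ B'x).
have [||s0 [xs0 _]] := xc set0 => //; first by apply: countable_card_lt => //; exact: countable0.
have big B : local_base x B -> [set: kappa] #<= B.
  move=> [Bx Bb]; apply: contrapT => /card_ltN Bk.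
  have /choice[f fP] : forall U, exists s, B U -> ~~ le x s /\ forall y, ~~ le y s && le y x -> U y.
    move=> U; have [BU|nBU] := pselect (B U); last by exists x.
    by have [s xs sU] := nbhsU U s0 xs0 (Bx U BU); exists s.
  (* A point strictly above all chosen left ends lies in every member of [B], so none of these fits
     into the interval starting at it. *)
  have [||s [xs sP]] := xc (f @` B).
  - by move=> _ [U BU <-]; have [] := fP U BU.
  - exact: card_le_lt (card_image_le _ _) Bk.
  have [U BU Us] := Bb _ (cellN s xs).
  have [xf fU] := fP U BU; have fs := sP (f U) (ex_intro2 _ _ U BU erefl).
  have /Us /= : U s by apply: fU; rewrite fs (wo_nle wo).
  by rewrite (wo_refl wo).
have [|B Bb Bmin] := @card_least _ (local_base x).
  by exists (nbhs x); split => // U xU; exists U.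
by exists B; [split|exact: big].
Qed.

(** * The first and the last space *)

Section Products.
Context {R : realType} {n : nat} {T : 'I_n -> topologicalType} (le : forall i, rel (T i)).
Hypothesis ord : forall i, ordering (@le i).
Context {X : completeNormedModType R}.
Local Notation PT := (prod_topology T).

Definition box (P : forall i, seq (T i)) (x : PT) : set PT :=
  [set y | forall i p, p \in P i -> le (y i) p = le (x i) p].

Lemma nbhs_box (x : PT) (U : set PT) : nbhs x U -> exists P, box P x `<=` U.
Proof.
move=> xU; pose F := filter_from [set: forall i, seq (T i)] (fun P => box P x).
have FF : Filter F.
  apply: filter_from_filter; first by exists (fun i => [::]).
  move=> P P' _ _; exists (fun i => P i ++ P' i) => // y yP.
  by split=> i p pP; apply: yP; rewrite mem_cat pP ?orbT.
suff : F --> x by move=> /(_ U xU)[P _ PU]; exists P.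
apply/cvg_sup => i A; rewrite nbhsE => -[B [[C oC <-] Bx BA]].
have [P PC] := ord_nbhs (ord i) (open_nbhs_nbhs (conj oC Bx)).
exists (dfwith (fun j => [::]) i P) => // y yP; apply: BA; apply: PC => p pP.
by apply: yP; rewrite dfwithin.
Qed.

Lemma box_nbhs (P : forall i, seq (T i)) (x : PT) : nbhs x (box P x).
Proof.
apply: (@filter_forall _ _ (fun i (y : PT) => forall p, p \in P i -> le (y i) p = le (x i) p)
  _ (nbhs_filter x)) => i; elim: (P i) => [|p r IH].
  by apply: filterE => y p.
have c : nbhs x [set y : PT | le (y i) p = le (x i) p].
  have pc : (fun y : PT => y i) @ nbhs x --> x i by exact: proj_continuous.
  apply: (pc [set z | le z p = le (x i) p]).
  have [xp|xp] := boolP (le (x i) p).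
    apply: filterS (open_nbhs_nbhs (conj (ord_open (ord i) p) xp)).
    by move=> z /= ->.
  have oC : open (~` [set z | le z p]) by apply: closed_openC; exact: ord_closed.
  have xC : (~` [set z | le z p]) (x i) by exact/negP.
  apply: filterS (open_nbhs_nbhs (conj oC xC)) => z /= /negP zp.
  exact/negbTE.
apply: filterS (filterI c IH) => y [/= yp yr] q.
by rewrite inE => /orP[/eqP ->|] //; exact: yr.
Qed.

(** Compactness, with refinement of cut sets as the filter, makes the cuts uniform in the centre;
    points are compared through the centre of a covering box, hence [e / 2]. *)
Lemma continuous_box_osc (cT : compact [set: PT]) (f : PT -> X) (e : R) :
  continuous f -> 0 < e -> exists P : forall i, seq (T i),
    forall x y, box P x y -> `|f x - f y| <= e.
Proof.
move=> fc e0; have e20 : 0 < e / 2 by rewrite divr_gt0.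
pose F := filter_from [set: forall i, seq (T i)] (fun P0 => [set P | refines P0 P]).
have FF : Filter F.
  apply: filter_from_filter; first by exists (fun i => [::]).
  move=> P P' _ _; exists (fun i => P i ++ P' i) => // P2 P2P.
  by split=> i p pP; apply: P2P; rewrite mem_cat pP ?orbT.
have /compact_near_coveringP/(_ _ F (fun P x => forall y, box P x y -> `|f x - f y| <= e) FF) := cT.
case=> [x _|P0 _ PP]; last first.
  by exists P0 => x y; apply: (PP P0 _ x I) => i p.
have [P PU] : exists P, box P x `<=` [set y | `|f x - f y| <= e / 2].
  by apply: nbhs_box; have /cvgrPdist_le/(_ _ e20) := fc x.
exists (box P x, [set P' | refines P P']).
  by split; [exact: box_nbhs|exists P].
move=> [x' P'] /= [xx' PP'] y x'y.
have xy : box P x y by move=> i p pP; rewrite x'y ?xx'//; exact: PP'.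
rewrite -(subrKA (f x)) (le_trans (ler_normD _ _))// [leRHS]splitr.
by rewrite lerD//; [rewrite distrC; exact: PU|exact: PU].
Qed.

Let W i : eqType := T i.

(** At stage 0 all labels are 0. On the compact product, continuity amounts to the cut condition in
    each coordinate: [continuous_box_osc] gives one direction and [E_cell_osc] the other. *)
Lemma C_space_isomorphic kappa (cT : compact [set: PT]) :
  isomorphic (C_space cT X)
    (@E_space R n W le X (fun=> set0) (stage (W := W) le kappa 0 [::])).
Proof.
pose z (t : point W) := [forall i, (t i).2 == 0%N].
pose pt (t : point W) : PT := fun i => (t i).1.
pose up (x : PT) : point W := fun i => (x i, 0%N).
have zS t : stage (W := W) le kappa 0 [::] t <-> z t.
  split=> [[t1 _ _]|/forallP tz].
    by apply/forallP => i; case: (t1 i) => [|[]//]; rewrite leqn0.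
  split=> [i|i|j]; first by left; rewrite (eqP (tz i)).
    by rewrite (eqP (tz i)).
  by case: j.
have upz x : z (up x) by apply/forallP => i.
have ptup t : z t -> up (pt t) = t.
  move=> /forallP tz; apply: functional_extensionality_dep => i.
  by rewrite /up /pt [RHS]surjective_pairing (eqP (tz i)).
pose g (f : PT -> X) (t : point W) := if z t then f (pt t) else 0.
have gE (f : C_space cT X) :
    E_mem le (fun i : 'I_n => @set0 (W i)) (stage (W := W) le kappa 0 [::]) (g f).
  have fc : continuous (f : PT -> X) := asboolW (funValP f).
  split.
  - by move=> t /zS/negP; rewrite /g => /negbTE ->.
  - have [M fM] := C_mem_bounded cT fc; exists `|M| => t; rewrite /g.
    case: ifP => _; last by rewrite normr0.
    by rewrite (le_trans (fM _))// mulr1 ler_norm.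
  - move=> i e e0; have [P PP] := continuous_box_osc cT fc e0; exists (P i).
    split=> [t t' tt [l s]|t l _]; rewrite /g; last first.
      by case: ifP => [/forallP/(_ i)|_]; rewrite ?(negbTE l)// normr0 ltW.
    have ztt : z t = z t'.
      by apply: eq_forallb => j; have [->|/tt ->] := eqVneq j i; rewrite ?l.
    rewrite -ztt; case: ifPn => [/forallP zt|_]; last by rewrite subrr normr0 ltW.
    apply: PP => j p pP; rewrite /pt; have [ji|/tt -> //] := eqVneq j i.
    by move: s p pP; rewrite ji zt => -[s _] p pP; rewrite s.
apply: (@isomorphic_intro _ _ _ (fun f => mkE (gE f)) 1 1).
- move=> a f h; apply: funOfP => t; rewrite funOfDE funOfZE /= /g.
  by case: ifP => _ //; rewrite scaler0 addr0.
- move=> f; rewrite mul1r; apply: E_norm_le => // t; rewrite /= /g.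
  by case: ifP => _; rewrite ?normr0// (le_trans (fs_normP f _))//= mulr1.
- move=> f; rewrite mul1r; apply: fs_norm_le => // x; rewrite /= mulr1.
  by have := E_normP (mkE (gE f)) (up x); rewrite /= /g upz.
- move=> h; pose f (x : PT) := h (up x).
  have fc : continuous f.
    move=> x; apply/(@cvgrPdist_le _ _ _ _ (nbhs_filter x)) => e e0.
    have [P PP] := E_cell_osc (E_spaceP h) e0.
    move: (box_nbhs P x); apply: (@filterS _ _ (nbhs_filter x)) => y xy; apply: PP => i; split => //=.
    by split=> // p pP; rewrite xy.
  exists (@FunOf _ _ _ (C_funSpace cT X) f (asboolT fc)); apply: funOfP => t.
  rewrite /= /g /f; case: ifPn => [zt|nzt]; first by rewrite ptup.
  by have [hT _ _] := E_spaceP h; rewrite hT// => /zS; exact/negP.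
Qed.

End Products.

(** * The last space as a c_0-sum *)

Section Discrete.
Context {R : realType} {n : nat} {W : 'I_n -> eqType} (le : forall i, rel (W i)).
Context {X : completeNormedModType R} (kappa : Type) (Lam : forall i, set (W i)).
Hypothesis LamE : forall i x, Lam x <-> uncountably_cofinal kappa (@le i) x.

Local Notation index := ('I_(n`!) * (forall i : 'I_n, @Lam i))%type.

(** At stage [n] the [n] coordinates use all labels 1, ..., [n], so a labelling is a permutation,
    which is the source of the factorial; all positions lie in Lambda. *)
Lemma stage_last : exists b : index -> point W, injective b /\
  (forall t, stage le kappa n [::] t <-> exists j, b j = t) /\
  forall j i, (b j i).2 != 0%N /\ (b j i).1 = val (j.2 i).
Proof.
have cS : n`! = #|{perm 'I_n}| by rewrite card_Sn.
pose perm_ (k : 'I_(n`!)) : {perm 'I_n} := enum_val (cast_ord cS k).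
pose b (j : index) : point W := fun i => (val (j.2 i), (perm_ j.1 i).+1).
exists b; split; [|split => // t; split].
- move=> [k l] [k' l'] E.
  have Ei i : b (k, l) i = b (k', l') i by rewrite E.
  congr pair.
    apply: (can_inj (cast_ordK cS)); apply: enum_val_inj; apply/perm.permP => i.
    by have [_ /val_inj] := Ei i.
  by apply: functional_extensionality_dep => i; apply: val_inj; have [] := Ei i.
- move=> [t1 t2 t3].
  have /choice[g gP] : forall j : 'I_n, exists i, (t i).2 = j.+1.
    by move=> j; apply: t3; rewrite /= ltn_ord.
  have gi : injective g.
    by move=> j j' jj; apply: val_inj; apply: succn_inj; rewrite -!gP jj.
  pose s := (perm gi)^-1%g.
  have ts i : (t i).2 = (s i).+1.
    have gs : g (s i) = i by rewrite -[RHS](permKV (perm gi) i) permE.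
    by rewrite -gP gs.
  have tL i : Lam (t i).1 by apply/LamE; apply: t2; rewrite ts.
  exists (cast_ord (esym cS) (enum_rank s), fun i => SigSub (mem_set (tL i))).
  apply: functional_extensionality_dep => i; rewrite /b /=.
  rewrite [RHS]surjective_pairing ts; congr (_, _.+1).
  by rewrite /perm_ cast_ordKV enum_rankK.
- move=> [j <-]; split=> [i|i _|k /andP[k0 kn]]; first by left; rewrite /b /= ltn_ord.
    by apply/LamE; apply: set_mem; exact: valP.
  case: k k0 kn => // k _ kn.
  exists ((perm_ j.1)^-1%g (Ordinal kn)).
  by rewrite /b /= permKV.
Qed.

Lemma finite_choices (P : forall i, seq (W i)) :
  finite_set [set x : forall i, @Lam i | forall i, val (x i) \in P i].
Proof.
pose N := \max_(i < n) size (P i).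
have : finite_set [set: {ffun 'I_n -> 'I_N.+1}] by exact: finite_finset.
apply: card_le_finite.
apply: (@card_le_ex _ _ _ _ (fun x : forall i, @Lam i => [ffun i => inord (seq.index (val (x i)) (P i)) : 'I_N.+1])) => //.
move=> x y xP yP /ffunP xy; apply: functional_extensionality_dep => i.
apply: val_inj; have := xy i; rewrite !ffunE => /(congr1 (fun k : 'I_N.+1 => k : nat)).
have iN (z : W i) : z \in P i -> (seq.index z (P i) < N.+1)%N.
  by move=> zP; rewrite ltnS; apply: leq_trans (leq_bigmax i); rewrite ltnW// index_mem.
rewrite !inordK ?iN// => E.
by rewrite -(nth_index (val (x i)) (xP i)) E nth_index.
Qed.

(** With all labels positive only the c_0 clause of [cut_by] matters. Holding in each coordinate, it
    confines the points where a function has norm at least [e] to a finite product of positions. *)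
Lemma E_space_last_isomorphic :
  isomorphic (@E_space R n W le X (fun=> set0) (stage le kappa n [::])) (c0_sum index X).
Proof.
have [b [bi [bS bl]]] := stage_last.
have gc (f : @E_space R n W le X (fun=> set0) (stage le kappa n [::])) :
    c0_mem ((f : point W -> X) \o b).
  move=> e e0; have e20 : 0 < e / 2 by rewrite divr_gt0.
  have [_ _ fc] := E_spaceP f.
  have /dep_choice[P PP] := fun i => fc i _ e20.
  apply: (@sub_finite_set _ _ ([set: 'I_(n`!)] `*` [set x : forall i, @Lam i | forall i, val (x i) \in P i])).
    move=> j /= ej; split => // i; have [jl <-] := bl j i.
    apply: contrapT => /negP jP; have := (PP i).2 _ jl jP.
    by rewrite leNgt (lt_le_trans _ ej)// ltr_pdivrMr// ltr_pMr// ltr1n.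
  by apply: finite_setX; [exact: finite_finset|exact: finite_choices].
pose g f : c0_sum index X := @FunOf _ _ _ (c0_funSpace index X) _ (asboolT (gc f)).
apply: (@isomorphic_intro _ _ _ g 1 1).
- by move=> a f h; apply: funOfP.
- move=> f; rewrite mul1r; apply: fs_norm_le => // j; rewrite mulr1.
  exact: E_normP.
- move=> f; rewrite mul1r; apply: E_norm_le => // t.
  have [/bS[j <-]|nS] := pselect (stage le kappa n [::] t).
    by have := fs_normP (g f) j; rewrite /= mulr1.
  by have [fT _ _] := E_spaceP f; rewrite fT// normr0.
- move=> h; have hc : c0_mem h := asboolW (funValP h).
  have /choice[f fP] : forall t, exists x : X,
      (forall j, b j = t -> x = h j) /\ (~ stage le kappa n [::] t -> x = 0).
    move=> t; have [[j jt]|nj] := pselect (exists j, b j = t).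
      by exists (h j); split=> [j'|[]]; [rewrite -jt => /bi ->|apply/bS; exists j].
    by exists 0; split=> // j jt; exfalso; apply: nj; exists j.
  have fE : E_mem le (fun i : 'I_n => @set0 (W i)) (stage le kappa n [::]) f.
    split.
    - by move=> t nt; have [_ ->] := fP t.
    - have [M hM] := c0_mem_bounded hc; exists `|M| => t.
      have [[j jt]|nj] := pselect (exists j, b j = t).
        by have [/(_ j jt) -> _] := fP t; rewrite (le_trans (hM j))// mulr1 ler_norm.
      by have [_ ->] := fP t; [rewrite normr0|move=> /bS].
    - move=> i e e0.
      have /(finite_image (fun j => (b j i).1))/finite_seqP[P PE] := hc e e0.
      exists P; split=> [t t' tt [l s]|t l tP].
        move: s; case: ifPn => [/eqP l0 _|_ s]; last first.
          rewrite (agree_off_eq tt) ?subrr ?normr0 ?(ltW e0)//.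
          by rewrite (surjective_pairing (t i)) l s -surjective_pairing.
        have nS (u : point W) : (u i).2 = 0%N -> f u = 0.
          move=> u0; have [_ ->] := fP u => // /bS[j ju].
          by have [] := bl j i; rewrite ju u0.
        by rewrite !nS -?l// subrr normr0 ltW.
      have [[j jt]|nj] := pselect (exists j, b j = t); last first.
        by have [_ ->] := fP t; [rewrite normr0 ltW|move=> /bS].
      have [/(_ j jt) -> _] := fP t; rewrite leNgt; apply: contra tP => ej.
      have : ((fun j => (b j i).1) @` [set j | e <= `|h j|]) (t i).1.
        by exists j; [exact: ltW|rewrite jt].
      by rewrite PE.
  exists (mkE fE); apply: funOfP => j /=.
  by have [/(_ j erefl) -> _] := fP (b j).
Qed.

End Discrete.

Section C0.
Context {R : realType} {X : completeNormedModType R}.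

Lemma c0_sum_reindex (I J : Type) : [set: I] #<= [set: J] -> [set: J] #<= [set: I] ->
  isomorphic (c0_sum I X) (c0_sum J X).
Proof.
move=> IJ JI.
have [f [g [fg gf]]] : exists (f : I -> J) (g : J -> I), cancel f g /\ cancel g f.
  have /card_bijP[f [g fg gf]] := Cantor_Bernstein IJ JI.
  exists (fun x => val (f (SigSub (in_setT x)))), (fun y => val (g (SigSub (in_setT y)))).
  split=> x.
    by rewrite (_ : SigSub _ = f (SigSub (in_setT x))) ?fg//; exact: val_inj.
  by rewrite (_ : SigSub _ = g (SigSub (in_setT x))) ?gf//; exact: val_inj.
have gc (h : c0_sum I X) : c0_mem ((h : I -> X) \o g).
  have hc : c0_mem h := asboolW (funValP h).
  move=> e e0; apply: card_le_finite (hc e e0).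
  apply: (@card_le_ex _ _ _ _ g) => // x y _ _; exact: (can_inj gf).
have fc (h : c0_sum J X) : c0_mem ((h : J -> X) \o f).
  have hc : c0_mem h := asboolW (funValP h).
  move=> e e0; apply: card_le_finite (hc e e0).
  apply: (@card_le_ex _ _ _ _ f) => // x y _ _; exact: (can_inj fg).
pose G h : c0_sum J X := @FunOf _ _ _ (c0_funSpace J X) _ (asboolT (gc h)).
apply: (@isomorphic_intro _ _ _ G 1 1).
- by move=> a h k; exact: funOfP.
- by move=> h; rewrite mul1r; apply: fs_norm_le => // j; exact: (fs_normP h).
- move=> h; rewrite mul1r; apply: fs_norm_le => // i.
  by have := fs_normP (G h) (f i); rewrite /= fg.
- move=> h; exists (@FunOf _ _ _ (c0_funSpace I X) _ (asboolT (fc h))).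
  by apply: funOfP => j /=; rewrite gf.
Qed.

End C0.

Theorem lemma6p8 (R : realType) (n : nat) (n_ge1 : (1 <= n)%N)
    (K : 'I_n -> compactTree)
    (kappa : Type) (kappa_regular : regular_cardinal kappa)
    (kappa_uncountable : ~ countable [set: kappa])
    (X : completeNormedModType R)
    (X_mazur : mazur X) (X_gp : gelfand_phillips X) :
  isomorphic
    (S_iter kappa n (C_space (tree_prod_compact K) X))
    (c0_sum ('I_(n`!) * (forall i : 'I_n, Lambda kappa (K i))) X)
  /\
  (infinite_set [set: forall i : 'I_n, Lambda kappa (K i)] ->
   isomorphic
     (S_iter kappa n (C_space (tree_prod_compact K) X))
     (c0_sum (forall i : 'I_n, Lambda kappa (K i)) X)).
Proof.
have /dep_choice[le ord] := fun i => tree_ordering (K i).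
pose W i : eqType := tree_space (K i).
have Siso := S_iter_stage (W := W) (fun i => ord_wo (ord i)) kappa_regular
  kappa_uncountable X_mazur n (C_space_isomorphic ord kappa (tree_prod_compact K)).
have c0iso : isomorphic (S_iter kappa n (C_space (tree_prod_compact K) X))
    (c0_sum ('I_(n`!) * (forall i : 'I_n, Lambda kappa (K i))) X).
  apply: isomorphic_trans Siso _; apply: (E_space_last_isomorphic (W := W)) => i x.
  exact: character_cofinal (ord i) kappa_uncountable.
split=> // Linf; apply: isomorphic_trans c0iso _; apply: c0_sum_reindex.
  (* The finite factor embeds into the natural numbers, which an infinite product absorbs. *)
  apply: card_le_trans (card_le_nat_prod Linf).
  apply: (@card_le_type _ _ (fun p => (val p.1, p.2))) => //.
  by move=> [k x] [k' x'] [/val_inj -> ->].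
apply: (@card_le_type _ _ (fun x => (Ordinal (fact_gt0 n), x))) => //.
by move=> x y [].
Qed.
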